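(* Let $K$ be a field with $\operatorname{char} K \neq 2$, let $a,b,c \in K^\times$, let $\varepsilon_{ij} \in \{1,-1\}$ for $i\ne j$ in $\{1,2,3\}$, and let $x_1,x_2,x_3$ be independent indeterminates over $K$. Let $G$ be the group of $K$-automorphisms of $K(x_1,x_2,x_3)$ generated by $$\sigma_1: x_1 \mapsto \frac{a}{x_1},\ x_2 \mapsto \varepsilon_{12}x_2,\ x_3 \mapsto \varepsilon_{13}x_3,$$ $$\sigma_2: x_1 \mapsto \varepsilon_{21}x_1,\ x_2 \mapsto \frac{b}{x_2},\ x_3 \mapsto \varepsilon_{23}x_3,$$ $$\sigma_3: x_1 \mapsto \varepsilon_{31}x_1,\ x_2 \mapsto \varepsilon_{32}x_2,\ x_3 \mapsto \frac{c}{x_3}.$$ Call the following four choices of signs exceptional: (i) $\varepsilon_{12}=\varepsilon_{21}=1$ and all other $\varepsilon_{ij}=-1$; or $\varepsilon_{13}=\varepsilon_{31}=1$ and all other $\varepsilon_{ij}=-1$; or $\varepsilon_{23}=\varepsilon_{32}=1$ and all other $\varepsilon_{ij}=-1$; (ii) all $\varepsilon_{ij}=-1$. If the signs are not exceptional, then $K(x_1,x_2,x_3)^G$ is rational over $K$. If the signs are exceptional, then $K(x_1,x_2,x_3)^G$ is rational over $K$ if and only if $[K(\sqrt{a},\sqrt{b},\sqrt{c}):K] \le 4$.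
   Context: Rational over $K$ means purely transcendental over $K$. For a group $H$ of automorphisms of a field $F$, $F^H$ is the fixed subfield. (The group $G$ is isomorphic to $C_2\times C_2\times C_2$.) *)

(* Defs.v *)
From HB Require Import structures.
From mathcomp Require Import all_boot all_order all_algebra all_field ring.
From mathcomp Require Import generic_quotient.
From mathcomp Require Export mpoly.
From Stdlib Require Classical_Prop.

Set Implicit Arguments.
Unset Strict Implicit.
Unset Printing Implicit Defensive.

Import GRing.Theory.
Local Open Scope ring_scope.

Section Extensions.

(* An extension F / K of arbitrary (possibly infinite) degree is an embedding
   [iota]; subfields of F are predicates on F. *)
Variables (K F : fieldType) (iota : {rmorphism K -> F}).

Definition algebraically_independent (S : F -> Prop) : Prop :=
  forall (n : nat) (y : n.-tuple F), uniq y -> (forall i, S (tnth y i)) ->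
  forall p : {mpoly K[n]}, mmap iota (tnth y) p = 0 -> p = 0.

Inductive adjoin (S : F -> Prop) : F -> Prop :=
| adjoin_base k : adjoin S (iota k)
| adjoin_gen f of S f : adjoin S f
| adjoin_add f g of adjoin S f & adjoin S g : adjoin S (f + g)
| adjoin_opp f of adjoin S f : adjoin S (- f)
| adjoin_mul f g of adjoin S f & adjoin S g : adjoin S (f * g)
| adjoin_inv f of adjoin S f : adjoin S f^-1.

Definition purely_transcendental (L : F -> Prop) : Prop :=
  exists2 S : F -> Prop,
    algebraically_independent S & forall f, L f <-> adjoin S f.

Definition is_automorphism_over (s : F -> F) : Prop :=
  bijective s /\ forall k, s (iota k) = iota k.

Inductive automorphism_group (S : (F -> F) -> Prop) : (F -> F) -> Prop :=
| automorphism_group_id : automorphism_group S id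
| automorphism_group_mem s of S s : automorphism_group S s
| automorphism_group_comp s t of automorphism_group S s & automorphism_group S t :
    automorphism_group S (s \o t)
| automorphism_group_inv s t of automorphism_group S s & cancel s t & cancel t s :
    automorphism_group S t.

Definition fixed_field (G : (F -> F) -> Prop) (f : F) : Prop :=
  forall s, G s -> s f = f.

End Extensions.

Section RationalFunctions.

Variable K : fieldType.

Definition ratfun3 : fieldType := {fraction {mpoly K[3]}}.

Definition const3 : {rmorphism K -> ratfun3} :=
  (@FracField.tofrac {mpoly K[3]} \o @mpolyC 3 K).

Definition indet (i : 'I_3) : ratfun3 := FracField.tofrac ('X_i : {mpoly K[3]}).
Definition x1 : ratfun3 := indet (@Ordinal 3 0 isT).
Definition x2 : ratfun3 := indet (@Ordinal 3 1 isT).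
Definition x3 : ratfun3 := indet (@Ordinal 3 2 isT).

Definition exceptional (e12 e13 e21 e23 e31 e32 : K) : Prop :=
  [\/ [/\ e12 = 1, e21 = 1, e13 = -1, e31 = -1 & e23 = -1 /\ e32 = -1],
      [/\ e13 = 1, e31 = 1, e12 = -1, e21 = -1 & e23 = -1 /\ e32 = -1],
      [/\ e23 = 1, e32 = 1, e12 = -1, e21 = -1 & e13 = -1 /\ e31 = -1]
    | [/\ e12 = -1, e21 = -1, e13 = -1, e31 = -1 & e23 = -1 /\ e32 = -1]].

End RationalFunctions.

Arguments x1 {K}.
Arguments x2 {K}.
Arguments x3 {K}.

Local Open Scope quotient_scope.

Section FracExt.
Variables (R : idomainType) (E : fieldType) (phi : {rmorphism R -> E}).
Hypothesis phi_inj : forall p, phi p = 0 -> p = 0.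
Local Notation tf := (@FracField.tofrac R).

Lemma frac_repr (f : {fraction R}) :
  tf \d_(repr f) != 0 /\ f = tf \n_(repr f) / tf \d_(repr f).
Proof.
have dn0 : tf \d_(repr f) != 0 by rewrite tofrac_eq0 denom_ratioP.
split=> //; apply: (mulIf dn0); rewrite divfK //.
rewrite -[in LHS](reprK f); set r := repr f.
unlock FracField.tofrac; rewrite -[LHS]FracField.pi_mul /FracField.mulf.
apply/eqmodP; rewrite /= FracField.equivfE !numden_Ratio ?oner_neq0 ?mulr1 ?denom_ratioP //.
by rewrite reprK mulrC.
Qed.

Definition fext (f : {fraction R}) : E := phi \n_(repr f) / phi \d_(repr f).

Lemma phi_neq0 d : d != 0 -> phi d != 0.
Proof. by apply: contra_neq => /phi_inj. Qed.

Lemma fextE n d : d != 0 -> fext (tf n / tf d) = phi n / phi d.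
Proof.
move=> d0; rewrite /fext; case: (frac_repr (tf n / tf d)).
set n' := \n_ _; set d' := \d_ _ => d'0 e.
have hd' : d' != 0 by rewrite tofrac_eq0 in d'0.
have : n * d' = n' * d.
  apply/eqP; rewrite -tofrac_eq !tofracM; apply/eqP.
  move/(congr1 (fun z => z * (tf d * tf d'))): e.
  have td0 : tf d != 0 by rewrite tofrac_eq0.
  rewrite mulrA divfK // => ->; rewrite [tf d * _]mulrC mulrA divfK //.
move/(congr1 phi); rewrite !rmorphM => e2.
apply/eqP; rewrite eqr_div ?phi_neq0 //; by rewrite e2.
Qed.

Lemma fracP (f : {fraction R}) : exists n d, d != 0 /\ f = tf n / tf d.
Proof.
case: (frac_repr f) => d0 e; exists \n_(repr f), \d_(repr f); split=> //.
by rewrite denom_ratioP.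
Qed.

Lemma fext_add f g : fext (f - g) = fext f - fext g.
Proof.
have [n [d [hd ->]]] := fracP f; have [n' [d' [hd' ->]]] := fracP g.
rewrite -mulNr addf_div ?tofrac_eq0 // -tofracN -!tofracM -tofracD !fextE ?mulf_neq0 //.
by rewrite -mulNr addf_div ?phi_neq0 // rmorphD !rmorphM rmorphN.
Qed.

Lemma fext_mul : monoid_morphism fext.
Proof.
split.
  have := @fextE 1 1 (oner_neq0 _); by rewrite tofrac1 rmorph1 !divr1.
move=> f g.
have [n [d [hd ->]]] := fracP f; have [n' [d' [hd' ->]]] := fracP g.
by rewrite mulf_div -!tofracM !fextE ?mulf_neq0 // !rmorphM -mulf_div.
Qed.

HB.instance Definition _ := GRing.isZmodMorphism.Build _ _ fext fext_add.
HB.instance Definition _ := GRing.isMonoidMorphism.Build _ _ fext fext_mul.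

Lemma frac_ext_exists : exists s : {rmorphism {fraction R} -> E}, forall p, s (tf p) = phi p.
Proof.
exists fext => p.
by have := @fextE p 1 (oner_neq0 _); rewrite tofrac1 rmorph1 !divr1.
Qed.
End FracExt.

Lemma rmor_ext_frac (K : fieldType) (s t : {rmorphism ratfun3 K -> ratfun3 K}) :
  (forall k, s (const3 K k) = t (const3 K k)) ->
  (forall i, s (indet K i) = t (indet K i)) -> s =1 t.
Proof.
move=> hk hx.
have hp (p : {mpoly K[3]}) : s (FracField.tofrac p) = t (FracField.tofrac p).
  elim/mpolyind: p => [|k m p _ _ IH]; first by rewrite !rmorph0.
  rewrite !rmorphD IH -mul_mpolyC !rmorphM; congr (_ * _ + _); first exact: hk.
  rewrite mpolyXE_id !rmorph_prod; apply: eq_bigr => i _.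
  by rewrite !rmorphXn; congr (_ ^+ _); apply: hx.
move=> f; case: (frac_repr f) => d0 ->; by rewrite !fmorph_div !hp.
Qed.

Lemma fext_ring1 (F : fieldType) (x y u v : F) :
  x * y * (u + v) = y * (x * u) + x * (y * v).
Proof. ring. Qed.
Lemma fext_ring2 (F : fieldType) (x y u v : F) :
  y * (x * u) + x * (y * v) = x * y * (u + v).
Proof. ring. Qed.

(* The monomial automorphisms prescribed on the indeterminates do exist, so
   quantifying over ring morphisms with the prescribed values is not vacuous. *)
Lemma sigma_exists (K : fieldType) (i : 'I_3) (a : K) (e : 'I_3 -> K) :
  a != 0 -> (forall j, e j = 1 \/ e j = -1) ->
  exists s : {rmorphism ratfun3 K -> ratfun3 K},
    is_automorphism_over (const3 K) s /\
    forall j, s (indet K j) =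
      if j == i then const3 K a / indet K i else const3 K (e j) * indet K j.
Proof.
move=> a0 he.
pose h j := if j == i then const3 K a / indet K i else const3 K (e j) * indet K j.
pose phi : {rmorphism {mpoly K[3]} -> ratfun3 K} := mmap (const3 K) h.
have x0 j : indet K j != 0.
  rewrite tofrac_eq0; apply/eqP => /(congr1 (fun p => p@_U_(j))).
  by rewrite mcoeffX eqxx mcoeff0 => /eqP; rewrite oner_eq0.
have phiC k : phi k%:MP = const3 K k by rewrite /phi /= mmapC.
have phiX j : phi 'X_j = h j by rewrite /phi /= mmapX mmap1U.
have ca0 : const3 K a != 0 by rewrite fmorph_eq0.
have hi0 : h i != 0 by rewrite /h eqxx; apply: mulf_neq0; [exact: ca0|rewrite invr_eq0; exact: x0].
have ee j : e j * e j = 1 by case: (he j) => ->; rewrite ?mulrNN mulr1.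
pose Q p := exists N q, indet K i ^+ N * phi p = FracField.tofrac q /\
                        phi q = h i ^+ N * FracField.tofrac p.
have QC k : Q k%:MP.
  by exists 0%N, k%:MP; rewrite !expr0 !mul1r phiC.
have QX j : Q 'X_j.
  case: (eqVneq j i) => [->|ji].
    exists 1%N, a%:MP; rewrite !expr1 phiX phiC /h eqxx; split.
      rewrite mulrC; exact: (divfK (x0 i)).
    exact: esym (divfK (x0 i) _).
  exists 0%N, ((e j)%:MP * 'X_j); rewrite !expr0 !mul1r (rmorphM phi) phiX phiC /h (negPf ji).
  split; first by rewrite tofracM.
  by rewrite mulrA -(rmorphM (const3 K)) ee rmorph1 mul1r.
have QM p q : Q p -> Q q -> Q (p * q).
  move=> [N [p' [e1 e2]]] [M [q' [e3 e4]]]; exists (N + M)%N, (p' * q').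
  by rewrite !(rmorphM phi) tofracM exprD mulrACA e1 e3 e2 e4 exprD mulrACA -!tofracM.
have QD p q : Q p -> Q q -> Q (p + q).
  move=> [N [p' [e1 e2]]] [M [q' [e3 e4]]].
  exists (N + M)%N, ('X_i ^+ M * p' + 'X_i ^+ N * q').
  rewrite !(rmorphD phi) !(rmorphM phi) !(rmorphXn phi) !tofracD !tofracM !tofracXn phiX -e1 -e3 e2 e4 !exprD.
  rewrite -[FracField.tofrac 'X_i]/(indet K i).
  by split; [exact: fext_ring1|exact: fext_ring2].
have Qall p : Q p.
  elim/mpolyind: p => [|k m p _ _ IH]; first by rewrite -[0]mpolyC0; apply: QC.
  apply: (QD) => //; rewrite -mul_mpolyC; apply: (QM).
    exact: QC.
  rewrite mpolyXE_id; elim/big_ind: _ => [|p' q|j _].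
  - exact: (QC 1).
  - exact: (QM p' q).
  - elim: (m j) => [|n IHn]; first exact: (QC 1).
    by rewrite exprS; apply: (QM).
have phi_inj p : phi p = 0 -> p = 0.
  move=> pp; case: (Qall p) => N [q []]; rewrite pp mulr0 => /esym/eqP.
  rewrite tofrac_eq0 => /eqP ->; rewrite rmorph0 => /esym/eqP.
  by rewrite mulf_eq0 expf_eq0 (negPf hi0) andbF /= tofrac_eq0 => /eqP.
case: (frac_ext_exists phi_inj) => s hs.
have sx j : s (indet K j) = h j by rewrite -phiX -hs.
have sk k : s (const3 K k) = const3 K k by rewrite -[RHS]phiC -hs.
exists s; split=> //; split=> //.
have ss : cancel s s.
  apply: (@rmor_ext_frac K (s \o s : {rmorphism _ -> _}) (idfun : {rmorphism _ -> _})) => [k|j] /=.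
    by rewrite !sk.
  rewrite sx /h; case: eqP => [->|/eqP ji].
    rewrite fmorph_div sk sx /h eqxx invfM invrK mulrA (divff ca0); exact: mul1r.
  by rewrite (rmorphM s) sk sx /h (negPf ji) mulrA -rmorphM ee rmorph1 mul1r.
by exists s.
Qed.

Lemma sqrt_step (K : fieldType) (L : fieldExtType K) (z : L) :
  exists (L' : fieldExtType K) (f : {rmorphism L -> L'}) (w : L'),
    (forall k : K, f k%:A = k%:A) /\ w ^+ 2 = f z.
Proof.
have [[y yz]|nr] := Classical_Prop.classic (exists y : L, y ^+ 2 = z).
  by exists L, idfun, y.
have sz : size ('X^2 - z%:P) = 3 by rewrite size_XnsubC.
have irr : irreducible_poly ('X^2 - z%:P).
  apply: cubic_irreducible; first by rewrite sz.
  move=> x; apply/negP; rewrite /root !hornerE subr_eq0 => /eqP xz.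
  by apply: nr; exists x.
have [M _ [w rw _]] := irredp_FAdjoin irr.
exists (baseFieldType M), (in_alg M : {rmorphism L -> M}), w; split.
  by move=> k; rewrite baseField_scaleE.
move: rw; rewrite /root rmorphB /= map_polyXn map_polyC !hornerE subr_eq0.
by move/eqP.
Qed.

(* A finite extension containing the three square roots exists over every K;
   the degree of the subfield they generate does not depend on the choice. *)
Lemma sqrt_ext_exists (K : fieldType) (a b c : K) :
  exists (L : fieldExtType K) (ra rb rc : L),
    [/\ ra ^+ 2 = a%:A, rb ^+ 2 = b%:A & rc ^+ 2 = c%:A].
Proof.
have [L1 [f1 [ra [h1 e1]]]] := sqrt_step (a : K^o).
have [L2 [f2 [rb [h2 e2]]]] := sqrt_step (b%:A : L1).
have [L3 [f3 [rc [h3 e3]]]] := sqrt_step (c%:A : L2).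
exists L3, (f3 (f2 ra)), (f3 rb), rc; split.
- have -> : a%:A = f3 (f2 (f1 (a%:A : K^o))) by rewrite h1 h2 h3.
  by rewrite -!rmorphXn e1 /GRing.scale /= mulr1.
- by rewrite -rmorphXn e2 h2 h3.
- by rewrite e3 h3.
Qed.

(* Main.v *)
(** Write (a_1, a_2, a_3) = (a, b, c) and zeta_i = (x_i^2 - a_i) / (x_i^2 + a_i).
    As sigma_j changes the sign of zeta_i exactly when i = j, the fixed field is
    generated by the Z_i = zeta_i^2 and by r_i = 2 a_i / (p_i m_i), where
    p_i = x_i + a_i / x_i and m_i is the product of the zeta_j with
    epsilon_ji = -1; they satisfy a_i (1 - Z_i) = m_i^2 r_i^2.  For
    nonexceptional signs elimination leaves three generators, which are
    algebraically independent by the exchange lemma.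

    For exceptional signs the fixed field is K(S, u, v, w) with
    w^2 = (S + a) (u^2 S + b) (v^2 S + c), with (a c, b c, c) instead of
    (a, b, c) in case (i).  If a nontrivial product of a, b, c is a square in K,
    which means that the degree is at most 4, then a quadric over K(S) has a
    rational point and projecting from it gives three generators.

    Otherwise suppose that the field is rational.  Comparing valuations, S is up
    to a constant and a square a product of norms p^2 - x q^2 with x in
    {a, b, c, a b c}.  Over E = K(u, S) the field is the function field of a
    conic which stays anisotropic over the fields E(sqrt x, sqrt y), so that a
    descent on the degree moves this relation into E.  There it is impossible:
    S has odd degree in S, but p^2 - x q^2 has even degree. *)

Require Import Defs.
From HB Require Import structures.
From mathcomp Require Import all_boot all_order all_algebra all_field ring zify.
From Stdlib Require Import Classical_Prop ClassicalEpsilon.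

Set Implicit Arguments.
Unset Strict Implicit.
Unset Printing Implicit Defensive.

Import Order.TTheory GRing.Theory Num.Theory.
Local Open Scope ring_scope.

(** * Adjunction and transcendence bases *)

(** The four types come from parity. Where S has odd valuation, a factor of w^2 has either valuation
    0 and its constant as residue, or odd valuation and the residue of S up to squares. Since w^2
    has even valuation, none or two factors are of the second kind, so a b c, a, b or c is a square
    in the residue field; an irreducible polynomial modulo which x is a square is a norm up to a
    constant. Variables are removed one by one by specialization, which needs K infinite: a finite
    field has only two square classes. The obstacle is that the relation obtained lives on a conic,
    while degrees in S can be compared only in E. Anisotropy over E(sqrt x, sqrt y) forces the
    degree of a closed point to be so divisible that a dimension count yields a generator of its
    ideal which is itself a norm of the right types, and which can be cancelled. Anisotropy is
    tested at S = -a or S = -b / u^2, where a zero would make a c or b c a square. The types have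
    odd length in a, b, c, so two of them generate only one nontrivial class of even length, and a c
    or b c avoids it. *)

Section Adjunction.
Variables (K F : fieldType) (iota : {rmorphism K -> F}).
Local Notation adj := (adjoin iota).
Implicit Types (A : F -> Prop) (l : seq F) (t f : F).

Lemma adjoin_sub A A' f : (forall g, A g -> adj A' g) -> adj A f -> adj A' f.
Proof.
move=> h; elim=> [k|g Ag|g g' _ h1 _ h2|g _ h1|g g' _ h1 _ h2|g _ h1].
- exact: adjoin_base.
- exact: h.
- exact: adjoin_add.
- exact: adjoin_opp.
- exact: adjoin_mul.
- exact: adjoin_inv.
Qed.

Lemma adjoin0 A : adj A 0.
Proof. by rewrite -(rmorph0 iota); apply: adjoin_base. Qed.

Lemma adjoin1 A : adj A 1.
Proof. by rewrite -(rmorph1 iota); apply: adjoin_base. Qed.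

Lemma adjoin_sub2 A f g : adj A f -> adj A g -> adj A (f - g).
Proof. by move=> h1 h2; apply: adjoin_add => //; apply: adjoin_opp. Qed.

Lemma adjoin_div A f g : adj A f -> adj A g -> adj A (f / g).
Proof. by move=> h1 h2; apply: adjoin_mul => //; apply: adjoin_inv. Qed.

Lemma adjoin_exp A f n : adj A f -> adj A (f ^+ n).
Proof.
move=> h; elim: n => [|n IH]; first by rewrite expr0; apply: adjoin1.
by rewrite exprS; apply: adjoin_mul.
Qed.

Lemma adjoin_nat A n : adj A n%:R.
Proof. by rewrite -(rmorph_nat iota); apply: adjoin_base. Qed.

(** Excluded middle turns adjunction into a boolean predicate, so that the adjoined field becomes a
    [fieldType] and the theory of algebraic elements applies over it. *)
Definition in_adjoin A : pred F :=
  fun f => if excluded_middle_informative (adj A f) then true else false.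

Lemma in_adjoinP A f : reflect (adj A f) (f \in in_adjoin A).
Proof. by rewrite /in_adjoin unfold_in; case: excluded_middle_informative => h; constructor. Qed.

Lemma in_adjoin_divring A : divring_closed (in_adjoin A).
Proof.
split; first by apply/in_adjoinP; apply: adjoin1.
  by move=> f g /in_adjoinP hf /in_adjoinP hg; apply/in_adjoinP; apply: adjoin_sub2.
by move=> f g /in_adjoinP hf /in_adjoinP hg; apply/in_adjoinP; apply: adjoin_div.
Qed.

HB.instance Definition _ A := GRing.isDivringClosed.Build F (in_adjoin A) (in_adjoin_divring A).

Record subfield_of A := SubfieldOf { subfield_val :> F; _ : subfield_val \in in_adjoin A }.
HB.instance Definition _ A := [isSub for @subfield_val A].
HB.instance Definition _ A := [Choice of subfield_of A by <:].
HB.instance Definition _ A := [SubChoice_isSubIntegralDomain of subfield_of A by <:].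
HB.instance Definition _ A := [SubIntegralDomain_isSubField of subfield_of A by <:].

Definition sf_val A : {rmorphism subfield_of A -> F} := val.

Lemma sf_valP A (z : subfield_of A) : adj A (sf_val A z).
Proof. by apply/in_adjoinP; apply: valP. Qed.

Lemma sf_exists A f : adj A f -> exists z : subfield_of A, sf_val A z = f.
Proof. by move/in_adjoinP => h; exists (SubfieldOf h). Qed.

Definition alg_over A f := algebraicOver (sf_val A) f.

Lemma lift_poly A (p : {poly F}) : (forall i, adj A p`_i) ->
  exists q : {poly subfield_of A}, map_poly (sf_val A) q = p.
Proof.
move=> hp; have [g hg] : exists g : nat -> subfield_of A, forall i, sf_val A (g i) = p`_i.
  exists (fun i => proj1_sig (constructive_indefinite_description _ (sf_exists (hp i)))).
  by move=> i; case: constructive_indefinite_description.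
exists (\poly_(i < size p) g i).
apply/polyP => i; rewrite coef_map coef_poly; case: ltnP => hi; first exact: hg.
by rewrite nth_default // (rmorph0 (sf_val A)).
Qed.

Lemma alg_overP A (p : {poly F}) f : p != 0 -> (forall i, adj A p`_i) -> root p f ->
  alg_over A f.
Proof.
move=> p0 /lift_poly[q qE] rp; exists q; last by rewrite qE.
by rewrite -(map_poly_eq0 (sf_val A)) qE.
Qed.

Lemma alg_over_adjoin A f : adj A f -> alg_over A f.
Proof. by move=> /sf_exists[z <-]; apply: algebraic_id. Qed.

Lemma alg_over_closed A f : adj (alg_over A) f -> alg_over A f.
Proof.
elim=> [k|g //|g g' _ h1 _ h2|g _ h1|g g' _ h1 _ h2|g _ h1].
- by apply: alg_over_adjoin; apply: adjoin_base.
- exact: algebraic_add.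
- exact: algebraic_opp.
- exact: algebraic_mul.
- exact: algebraic_inv.
Qed.

(** Over a field, algebraic means integral, and a root of a monic equation with integral
    coefficients is integral. *)
Lemma alg_over_trans A A' f : (forall g, A g -> alg_over A' g) -> alg_over A f -> alg_over A' f.
Proof.
move=> h [p p0 rp]; apply/integral_algebraic.
apply: (@integral_root _ _ _ (map_poly (sf_val A) p)) => //; first by rewrite map_poly_eq0.
move=> c /(nthP 0)[i _ <-]; apply/integral_algebraic.
rewrite -/(polyseq _) coef_map; apply: alg_over_closed.
exact: adjoin_sub (fun g Ag => adjoin_gen iota (h g Ag)) (sf_valP _).
Qed.

Lemma alg_over_sub A A' f : (forall g, A g -> A' g) -> alg_over A f -> alg_over A' f.
Proof.
by move=> h; apply: alg_over_trans => g /h Ag; apply: alg_over_adjoin; apply: adjoin_gen.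
Qed.

Definition with_list A l f := A f \/ f \in l.

Lemma adjoin_with A t f : adj (with_list A [:: t]) f ->
  exists p q : {poly subfield_of A},
    (map_poly (sf_val A) q).[t] != 0 /\ f = (map_poly (sf_val A) p).[t] / (map_poly (sf_val A) q).[t].
Proof.
set ev := fun p : {poly subfield_of A} => (map_poly (sf_val A) p).[t].
have evM p q : ev (p * q) = ev p * ev q by rewrite /ev rmorphM hornerM.
have evD p q : ev (p + q) = ev p + ev q by rewrite /ev rmorphD hornerD.
have evN p : ev (- p) = - ev p by rewrite /ev rmorphN hornerN.
have ev1 : ev 1 = 1 by rewrite /ev rmorph1 hornerC.
have evX : ev 'X = t by rewrite /ev map_polyX hornerX.
have evC c : ev c%:P = sf_val A c by rewrite /ev map_polyC hornerC.
have ev0 : ev 0 = 0 by rewrite /ev rmorph0 horner0.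
have poly_case p : exists a b, ev b != 0 /\ ev p = ev a / ev b.
  exists p, 1; rewrite ev1 divr1; split=> //; exact: oner_neq0.
elim=> [k|g [Ag|]|g g' _ [p [q [h1 ->]]] _ [p' [q' [h2 ->]]]|g _ [p [q [h1 ->]]]|
   g g' _ [p [q [h1 ->]]] _ [p' [q' [h2 ->]]]|g _ [p [q [h1 ->]]]].
- by have [z <-] := sf_exists (adjoin_base iota A k); rewrite -evC; apply: poly_case.
- by have [z <-] := sf_exists (adjoin_gen iota Ag); rewrite -evC; apply: poly_case.
- by rewrite inE => /eqP ->; have := poly_case 'X; rewrite evX; apply.
- exists (p * q' + p' * q), (q * q').
  by rewrite -!/(ev _) in h1 h2 *; rewrite evD !evM mulf_neq0 // addf_div.
- by exists (- p), q; rewrite -!/(ev _) evN mulNr.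
- exists (p * p'), (q * q').
  by rewrite -!/(ev _) in h1 h2 *; rewrite !evM mulf_neq0 // mulf_div.
- rewrite -!/(ev _) in h1 *; case: (eqVneq (ev p) 0) => [e|e].
    rewrite e mul0r invr0; have := poly_case 0; rewrite ev0; apply.
  by exists q, p; rewrite -!/(ev _) invf_div.
Qed.

(** An equation of f over A(t), cleared of denominators, is a polynomial relation between f and t
    over A; reading it as a polynomial in t gives an equation of t over A(f). *)
Lemma exchange A t f : alg_over (with_list A [:: t]) f -> ~ alg_over A f ->
  alg_over (with_list A [:: f]) t.
Proof.
case=> p p0 rp nf; set k := subfield_of A.
pose ev (q : {poly k}) := (map_poly (sf_val A) q).[t].
(* A common denominator for the first n coefficients, built by induction on n. *)
have clear n : exists (d : {poly k}) (P : nat -> {poly k}), ev d != 0 /\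
    forall i, (i < n)%N -> sf_val _ p`_i * ev d = ev (P i).
  elim: n => [|n [d [P [d0 IH]]]].
    by exists 1, (fun=> 0); rewrite /ev rmorph1 hornerC oner_neq0.
  have [a [b [b0 e]]] := adjoin_with (sf_valP p`_n).
  exists (d * b), (fun i => if i == n then a * d else P i * b).
  have evM q q' : ev (q * q') = ev q * ev q' by rewrite /ev rmorphM hornerM.
  split; first by rewrite evM mulf_neq0.
  move=> i; rewrite ltnS leq_eqVlt; case: eqP => [-> _|_ /= /IH h]; last by rewrite !evM mulrA h.
  rewrite e !evM -/(ev a) -/(ev b); move: b0; rewrite -/(ev b) => b0; field.
  exact: b0.
have [d [P [d0 hP]]] := clear (size p).
pose Q : {poly {poly k}} := \poly_(i < size p) P i.
have evQ : (map_poly (fun q => ev q) Q).[f] = 0.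
  have -> : map_poly (fun q => ev q) Q = ev d *: map_poly (sf_val _) p.
    apply/polyP => i; rewrite coefZ coef_map [LHS]coef_map_id0; last by rewrite /ev rmorph0 horner0.
    rewrite coef_poly; case: ltnP => hi; first by rewrite -hP // mulrC.
    rewrite [p`_i]nth_default //.
    rewrite /ev rmorph0 horner0.
    by rewrite raddf0 mulr0.
  by rewrite hornerZ (eqP rp) mulr0.
have Q0 : Q != 0.
  apply: contra_neq p0 => e; apply/polyP => i; rewrite coef0.
  case: (ltnP i (size p)) => hi; last by rewrite nth_default.
  apply: (fmorph_inj (sf_val _)); rewrite rmorph0; apply: (mulIf d0); rewrite mul0r hP //.
  have := congr1 (fun q : {poly {poly k}} => ev q`_i) e; rewrite coef_poly hi coef0 => ->.
  by rewrite /ev rmorph0 horner0.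
pose S := swapXY Q.
have S0 : S != 0 by rewrite swapXY_eq0.
pose evf (q : {poly k}) := (map_poly (sf_val A) q).[f].
pose T := map_poly evf S.
have evf0 : evf 0 = 0 by rewrite /evf rmorph0 horner0.
have Tt : T.[t] = 0.
  have cS i : (size (S`_i)%R <= size Q)%N.
    by apply/leq_sizeP => n hn; rewrite coef_swapXY [Q`_n]nth_default // coef0.
  have cQ i : (size (Q`_i)%R <= size S)%N.
    by apply/leq_sizeP => n hn; rewrite -coef_swapXY -/S [S`_n]nth_default // coef0.
  rewrite -[RHS]evQ (@horner_coef_wide _ (size S)); last exact: size_poly.
  rewrite (@horner_coef_wide _ (size Q)); last exact: size_poly.
  transitivity (\sum_(i < size S) \sum_(n < size Q) sf_val A S`_i`_n * f ^+ n * t ^+ i).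
    apply: eq_bigr => i _; rewrite coef_map_id0 // /evf (@horner_coef_wide _ (size Q)).
      by rewrite mulr_suml; apply: eq_bigr => n _; rewrite coef_map.
    by rewrite size_map_poly.
  rewrite exchange_big /=; apply: eq_bigr => n _; rewrite coef_map_id0; last by rewrite /ev rmorph0 horner0.
  rewrite /ev (@horner_coef_wide _ (size S)) ?size_map_poly // mulr_suml.
  by apply: eq_bigr => i _; rewrite coef_map /= /S coef_swapXY mulrAC.
apply: (@alg_overP _ T).
(* The leading coefficient of the swapped polynomial is a nonzero polynomial over A; if it vanished
   at f, then f would be algebraic over A. *)
- have lS : lead_coef S != 0 by rewrite lead_coef_eq0.
  apply/eqP => e; apply: nf; exists (lead_coef S) => //.
  have := congr1 (fun q : {poly F} => q`_(size S).-1) e; rewrite coef_map_id0 // coef0 => h.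
  exact/eqP.
- move=> i; rewrite coef_map_id0 // /evf horner_coef.
  elim/big_ind: _ => [|y z|j _]; first exact: adjoin0.
    exact: adjoin_add.
  apply: adjoin_mul; last by apply: adjoin_exp; apply: adjoin_gen; right; rewrite inE.
  rewrite coef_map; apply: adjoin_sub (sf_valP _) => g Ag.
  by apply: adjoin_gen; left.
- exact/eqP.
Qed.

(** Independence is stated one element at a time, which suits exchange arguments and towers;
    [seq_indep_mpoly] and [alg_indep_seq_indep] relate it to polynomial relations in several
    variables. *)
Fixpoint seq_indep A l : Prop :=
  if l is t :: l' then ~ alg_over A t /\ seq_indep (with_list A [:: t]) l' else True.

Lemma with_list_cat A l1 l2 f : with_list (with_list A l1) l2 f <-> with_list A (l1 ++ l2) f.
Proof.
rewrite /with_list mem_cat; split; first by move=> [[|->]|->]; rewrite ?orbT; auto.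
by move=> [|/orP[]]; auto.
Qed.

Lemma alg_over_eq A A' f : (forall g, A g <-> A' g) -> alg_over A f <-> alg_over A' f.
Proof. by move=> h; split; apply: alg_over_sub => g /h. Qed.

Lemma seq_indep_eq A A' l : (forall g, A g <-> A' g) -> seq_indep A l -> seq_indep A' l.
Proof.
elim: l A A' => //= t l IH A A' h [h1 h2]; split; first by move/(alg_over_eq _ h).
by apply: IH h2 => g; rewrite /with_list h.
Qed.

Lemma seq_indep_cat A l1 l2 :
  seq_indep A (l1 ++ l2) <-> seq_indep A l1 /\ seq_indep (with_list A l1) l2.
Proof.
elim: l1 A => [|t l IH] A /=.
  split=> [h|[_ h]]; last by apply: seq_indep_eq h => g; rewrite /with_list in_nil; split; [case|left].
  by split=> //; apply: seq_indep_eq h => g; rewrite /with_list in_nil; split; [left|case].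
split=> [[h1 /IH[h2 h3]]|[[h1 h2] h3]]; split=> //.
  by apply: seq_indep_eq h3 => g; apply: (with_list_cat A [:: t] l).
apply/IH; split=> //; apply: seq_indep_eq h3 => g.
by split=> h; apply/(with_list_cat A [:: t] l).
Qed.

(** The first y at which f becomes algebraic is the member that f can replace by [exchange]. *)
Lemma first_dependence A ys f : ~ alg_over A f -> alg_over (with_list A ys) f ->
  exists l y r, [/\ ys = l ++ y :: r, ~ alg_over (with_list A l) f
                  & alg_over (with_list A (l ++ [:: y])) f].
Proof.
elim/last_ind: ys => [|ys y IH] nf af.
  by case: nf; apply: alg_over_sub af => g [|].
have [h|h] := classic (alg_over (with_list A ys) f).
  have [l [z [r [-> h1 h2]]]] := IH nf h.
  by exists l, z, (rcons r y); rewrite rcons_cat rcons_cons.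
by exists ys, y, [::]; rewrite cats1.
Qed.

(** The head x of [xs] takes the place of a member y of [ys]; then x is moved into the base A and
    the induction continues with both lists shortened by one. *)
Lemma steinitz xs : forall A ys, seq_indep A xs ->
  (forall f, f \in xs -> alg_over (with_list A ys) f) -> (size xs <= size ys)%N.
Proof.
elim: xs => // x xs IH A ys /= [nx ix] hx.
have [l [y [r [yE h1 h2]]]] := first_dependence nx (hx x (mem_head _ _)); subst ys.
have hy : alg_over (with_list (with_list A [:: x]) (l ++ r)) y.
  have h2' : alg_over (with_list (with_list A l) [:: y]) x.
    exact/(alg_over_eq _ (with_list_cat A l [:: y])).
  apply: alg_over_sub (exchange h2' h1) => g [[|]|].
  - by left; left.
  - by rewrite /with_list mem_cat => ->; right.
  - by left; right.
have /IH h := ix; have := h (l ++ r); rewrite !size_cat /= addnS ltnS; apply.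
move=> f fx; apply: alg_over_trans (hx f _); last by rewrite inE fx orbT.
move=> g [Ag|]; first by apply: alg_over_adjoin; apply: adjoin_gen; left; left.
rewrite mem_cat inE => /or3P[gl|/eqP -> //|gr]; apply: alg_over_adjoin; apply: adjoin_gen; right;
by rewrite mem_cat ?gl ?gr ?orbT.
Qed.

(** A dependent member of [ys] could be dropped, leaving too few elements for [steinitz]. *)
Lemma generating_seq_indep A xs ys : seq_indep A xs -> (size ys <= size xs)%N ->
  (forall f, f \in xs -> alg_over (with_list A ys) f) -> seq_indep A ys.
Proof.
move=> ix sy hx; apply: NNPP => nind.
have [l [y [r [yE dy]]]] : exists l y r, ys = l ++ y :: r /\ alg_over (with_list A l) y.
  elim/last_ind: ys {sy hx} nind => [|ys y IH] nind; first by case: nind.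
  have [h|h] := classic (seq_indep A ys); last first.
    have [l [z [r [-> h']]]] := IH h.
    by exists l, z, (rcons r y); rewrite rcons_cat rcons_cons.
  exists ys, y, [::]; rewrite cats1; split=> //; apply: NNPP => ny; apply: nind.
  by rewrite -cats1; apply/seq_indep_cat; split=> //; split.
have := steinitz (ys := l ++ r) ix; suff h : forall f, f \in xs -> alg_over (with_list A (l ++ r)) f.
  by move/(_ h); move: sy; rewrite yE !size_cat /=; lia.
move=> f /hx; rewrite yE; apply: alg_over_trans => g [Ag|].
  by apply: alg_over_adjoin; apply: adjoin_gen; left.
rewrite mem_cat inE => /or3P[gl|/eqP ->|gr].
- by apply: alg_over_adjoin; apply: adjoin_gen; right; rewrite mem_cat gl.
- apply: alg_over_sub dy => h [|hl]; first by left.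
  by right; rewrite mem_cat hl.
- by apply: alg_over_adjoin; apply: adjoin_gen; right; rewrite mem_cat gr orbT.
Qed.

Definition in_list l f := f \in l.
Definition no_gen f : Prop := False.

Lemma with_no_gen l f : with_list no_gen l f <-> in_list l f.
Proof. by split; [case|right]. Qed.

Lemma adjoin_mmap n (y : n.-tuple F) f : adj (in_list y) f ->
  exists p q : {mpoly K[n]}, mmap iota (tnth y) q != 0 /\
    f = mmap iota (tnth y) p / mmap iota (tnth y) q.
Proof.
set ev := mmap iota (tnth y).
elim=> [k|g /tnthP[i ->]|g g' _ [p [q [h1 ->]]] _ [p' [q' [h2 ->]]]|g _ [p [q [h1 ->]]]|
   g g' _ [p [q [h1 ->]]] _ [p' [q' [h2 ->]]]|g _ [p [q [h1 ->]]]].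
- by exists k%:MP, 1; rewrite /ev rmorph1 /= mmapC divr1 oner_neq0.
- by exists 'X_i, 1; rewrite /ev rmorph1 /= mmapX mmap1U divr1 oner_neq0.
- exists (p * q' + p' * q), (q * q').
  by rewrite /ev !rmorphD !rmorphM /= mulf_neq0 // addf_div.
- by exists (- p), q; rewrite /ev rmorphN mulNr.
- exists (p * p'), (q * q').
  by rewrite /ev !rmorphM /= mulf_neq0 // mulf_div.
- case: (eqVneq (ev p) 0) => [e|e].
    by exists 0, 1; rewrite e mul0r invr0 /ev rmorph1 rmorph0 mul0r oner_neq0.
  by exists q, p; rewrite invf_div.
Qed.

Lemma lift_max_val n (i : 'I_n) : lift ord_max i = i :> nat.
Proof. by rewrite /= /bump leqNgt ltn_ord. Qed.

Lemma muni_lift n (i : 'I_n) : muni ('X_(lift ord_max i) : {mpoly K[n.+1]}) = ('X_i)%:P.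
Proof.
rewrite /muni mmapX mmap1U; case: splitP => [m hm|m].
  congr ('X_ _)%:P; apply: val_inj; rewrite /= in hm *.
  by rewrite -hm /bump leqNgt ltn_ord.
move=> /= h; have := ltn_ord i; have := lift_max_val i; rewrite /= h (ord1 m) addn0 => <-.
by rewrite ltnn.
Qed.

Lemma muni_max n : muni ('X_ord_max : {mpoly K[n.+1]}) = 'X.
Proof.
rewrite /muni mmapX mmap1U; case: splitP => [m /= h|//].
by have := ltn_ord m; rewrite -h ltnn.
Qed.

Lemma mpoly_morph_ext n (R : comNzRingType) (f g : {rmorphism {mpoly K[n]} -> R}) :
  (forall c, f c%:MP = g c%:MP) -> (forall i, f 'X_i = g 'X_i) -> f =1 g.
Proof.
move=> hc hx p; elim/mpolyind: p => [|c m p _ _ IH]; first by rewrite !rmorph0.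
rewrite !rmorphD IH -mul_mpolyC !rmorphM hc; congr (_ * _ + _).
rewrite mpolyXE_id !rmorph_prod; apply: eq_bigr => i _.
by rewrite !rmorphXn hx.
Qed.

Lemma tnth_rcons_lift n (y : n.-tuple F) t i : tnth [tuple of rcons y t] (lift ord_max i) = tnth y i.
Proof. by rewrite !(tnth_nth 0) lift_max_val /= nth_rcons size_tuple ltn_ord. Qed.

Lemma tnth_rcons_max n (y : n.-tuple F) t : tnth [tuple of rcons y t] ord_max = t.
Proof. by rewrite (tnth_nth 0) /= nth_rcons size_tuple ltnn eqxx. Qed.

Lemma mmap_muni n (y : n.-tuple F) t (p : {mpoly K[n.+1]}) :
  mmap iota (tnth [tuple of rcons y t]) p =
  (map_poly (mmap iota (tnth y)) (muni p)).[t].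
Proof.
pose g : {rmorphism {mpoly K[n.+1]} -> F} :=
  (horner_eval t \o (map_poly (mmap iota (tnth y)) \o @muni n K)).
apply: (@mpoly_morph_ext _ _ (mmap iota (tnth [tuple of rcons y t])) g) => [c|i] /=.
  by rewrite /horner_eval mmapC muniC map_polyC hornerC /= mmapC.
rewrite /horner_eval mmapX mmap1U; case: (unliftP ord_max i) => [m ->|->].
  by rewrite muni_lift map_polyC hornerC /= mmapX mmap1U tnth_rcons_lift.
by rewrite muni_max map_polyX hornerX tnth_rcons_max.
Qed.

Lemma muni_bij n : exists h : {poly {mpoly K[n]}} -> {mpoly K[n.+1]},
  cancel (@muni n K) h /\ cancel h (@muni n K).
Proof.
pose h : {rmorphism {poly {mpoly K[n]}} -> {mpoly K[n.+1]}} :=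
  (horner_eval ('X_ord_max : {mpoly K[n.+1]}) \o map_poly (@mwiden n K)).
have mw (i : 'I_n) : mwiden ('X_i : {mpoly K[n]}) = 'X_(lift ord_max i).
  rewrite mwidenX mnmwiden1; congr 'X_ _; by apply: val_inj; rewrite /= /bump leqNgt ltn_ord.
have hX : h 'X = 'X_ord_max by rewrite /h /= /horner_eval map_polyX hornerX.
have hC q : h q%:P = mwiden q by rewrite /h /= /horner_eval map_polyC hornerC.
exists h; split.
  apply: (@mpoly_morph_ext _ _ (h \o @muni n K) idfun) => [c|i] /=.
    by rewrite muniC -[RHS]mwidenC -hC.
  case: (unliftP ord_max i) => [m ->|->]; first by rewrite muni_lift -mw -hC.
  by rewrite muni_max; apply: hX.
have mh (q : {mpoly K[n]}) : muni (mwiden q) = q%:P.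
  apply: (@mpoly_morph_ext _ _ (@muni n K \o @mwiden n K) (@polyC {mpoly K[n]})) => [c|i] /=.
    by rewrite mwidenC muniC.
  by rewrite mw muni_lift.
elim/poly_ind => [|q c IH]; first by rewrite !rmorph0.
have -> : h (q * 'X + c%:P) = h q * 'X_ord_max + mwiden c by rewrite rmorphD rmorphM hX hC.
by rewrite muniD muniM IH mh muni_max.
Qed.

Lemma seq_indep_rcons l t :
  seq_indep no_gen (rcons l t) <-> seq_indep no_gen l /\ ~ alg_over (in_list l) t.
Proof.
rewrite -cats1; split=> [/seq_indep_cat[h1 [h2 _]]|[h1 h2]].
  by split=> // h; apply: h2; apply/(alg_over_eq _ (with_no_gen l)).
apply/seq_indep_cat; split=> //; split=> // h; apply: h2.
exact/(alg_over_eq _ (with_no_gen l)).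
Qed.

(** Induction on the number of variables: [muni] rewrites a relation as a polynomial in the last
    variable, whose coefficients vanish by transcendence and then by induction. *)
Lemma seq_indep_mpoly n (y : n.-tuple F) : seq_indep no_gen y ->
  forall p : {mpoly K[n]}, mmap iota (tnth y) p = 0 -> p = 0.
Proof.
elim: n y => [|n IH] y.
  move=> _ p; have -> : p = (p@_0)%:MP.
    by apply/mpolyP => m; rewrite mcoeffC; have -> : m = 0%MM by [apply/mnmP => -[]]; rewrite eqxx mulr1.
  by rewrite mmapC => /eqP; rewrite fmorph_eq0 => /eqP ->; rewrite mpolyC0.
case/tupleP: y => a y0.
have [y [t ->]] : exists (y : n.-tuple F) t, [tuple of a :: y0] = [tuple of rcons y t].
  exists [tuple of belast a y0], (last a y0); apply: val_inj; exact: lastI.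
move=> /seq_indep_rcons[iy nt] p; rewrite mmap_muni => e.
have [h [muniK _]] := muni_bij n.
suff m0 : muni p = 0 by rewrite -(muniK p) m0 -(muniK 0) muni0.
apply: NNPP => /eqP mn0; apply: nt.
apply: (@alg_overP _ (map_poly (mmap iota (tnth y)) (muni p))) => [||]; last exact/eqP.
  apply: contra_neq mn0 => e0; apply/polyP => i; rewrite coef0; apply: IH iy _ _.
  by have := congr1 (fun q : {poly F} => q`_i) e0; rewrite coef_map coef0.
move=> i; rewrite coef_map /= /mmap.
elim/big_ind: _ => [|f g|m _]; [exact: adjoin0|exact: adjoin_add|].
apply: adjoin_mul; first exact: adjoin_base.
rewrite /mmap1; elim/big_ind: _ => [|f g|j _]; [exact: adjoin1|exact: adjoin_mul|].
by apply: adjoin_exp; apply: adjoin_gen; apply: mem_tnth.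
Qed.

Lemma alg_indep_seq_indep S l : algebraically_independent iota S -> uniq l ->
  (forall f, f \in l -> S f) -> seq_indep no_gen l.
Proof.
move=> iS; elim/last_ind: l => // l t IH; rewrite rcons_uniq => /andP[tl ul] hS.
apply/seq_indep_rcons; split; first by apply: IH => // f fl; apply: hS; rewrite mem_rcons inE fl orbT.
case=> p p0 rp; pose y := in_tuple l.
pose ev := mmap iota (tnth y).
have clear n : exists (d : {mpoly K[size l]}) (P : nat -> {mpoly K[size l]}), ev d != 0 /\
    forall i, (i < n)%N -> sf_val _ p`_i * ev d = ev (P i).
  elim: n => [|n [d [P [d0 IHn]]]].
    by exists 1, (fun=> 0); rewrite /ev rmorph1 oner_neq0.
  have [a [b [b0 e]]] := @adjoin_mmap _ y _ (sf_valP p`_n).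
  exists (d * b), (fun i => if i == n then a * d else P i * b).
  have evM q q' : ev (q * q') = ev q * ev q' by rewrite /ev rmorphM.
  split; first by rewrite evM mulf_neq0.
  move=> i; rewrite ltnS leq_eqVlt; case: eqP => [-> _|_ /= /IHn h]; last by rewrite !evM mulrA h.
  rewrite e !evM -/(ev a) -/(ev b); move: b0; rewrite -/(ev b) => b0; field.
  exact: b0.
have [d [P [d0 hP]]] := clear (size p).
have [h [_ hK]] := muni_bij (size l).
pose Q : {poly {mpoly K[size l]}} := \poly_(i < size p) P i.
have e : mmap iota (tnth [tuple of rcons y t]) (h Q) = 0.
  rewrite mmap_muni hK.
  have -> : map_poly ev Q = ev d *: map_poly (sf_val _) p.
    apply/polyP => i; rewrite coefZ !coef_map coef_poly.
    case: ltnP => hi; first by rewrite mulrC; apply/esym/hP.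
    rewrite [p`_i]nth_default //.
    by rewrite !raddf0 mulr0.
  by rewrite hornerZ (eqP rp) mulr0.
have u1 : uniq [tuple of rcons y t] by rewrite /= rcons_uniq tl ul.
have S1 i : S (tnth [tuple of rcons y t] i) by apply: hS; apply: mem_tnth.
have hQ0 := iS _ _ u1 S1 _ e.
have Q0 : Q = 0 by rewrite -(hK Q) hQ0 muni0.
case/negP: p0; apply/eqP/polyP => i; rewrite coef0.
case: (ltnP i (size p)) => hi; last by rewrite nth_default.
apply: (fmorph_inj (sf_val _)); rewrite rmorph0; apply: (mulIf d0); rewrite mul0r hP //.
have := congr1 (fun q : {poly {mpoly K[size l]}} => ev q`_i) Q0; rewrite coef_poly hi coef0 => ->.
by rewrite /ev rmorph0.
Qed.

Lemma purely_transcendental_generators xs ys (L : F -> Prop) : seq_indep no_gen xs ->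
  (size ys <= size xs)%N -> (forall f, f \in xs -> alg_over (in_list ys) f) ->
  (forall f, L f <-> adj (in_list ys) f) -> purely_transcendental iota L.
Proof.
move=> ix sy hx hL; exists (in_list ys) => // n y uy hy.
apply: seq_indep_mpoly.
(* The definition of algebraic independence tests every duplicate-free tuple of generators, so y is
   completed to a list with the same members as [ys], and independence is read off its initial
   segment. *)
pose zs := y ++ [seq z <- undup ys | z \notin y].
have eqz z : (z \in zs) = (z \in ys).
  rewrite mem_cat mem_filter mem_undup; case: (boolP (z \in y)) => //= /tnthP[i ->].
  by rewrite [RHS]hy.
have sz : (size zs <= size ys)%N.
  rewrite uniq_leq_size //; last by move=> z; rewrite eqz.
  rewrite cat_uniq uy filter_uniq ?undup_uniq // andbT /=.
  by apply/hasPn => z; rewrite mem_filter => /andP[].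
have : seq_indep no_gen zs.
  apply: generating_seq_indep ix (leq_trans sz sy) _ => f /hx.
  by apply: alg_over_sub => g gy; right; rewrite eqz.
by case/seq_indep_cat.
Qed.
End Adjunction.

(** * Norm descent on a conic *)

Section ConicRing.
Variables (E : fieldType) (A C : E).

(** The pair (p, q) stands for p(v) + q(v) w in the coordinate ring E[v, w] of the affine conic w^2
    = A v^2 + C. *)
Definition conic_ring := ({poly E} * {poly E})%type.
Implicit Types b z : conic_ring.

Definition conic_poly : {poly E} := A *: 'X^2 + C%:P.
Local Notation cm := conic_poly.

Definition bmul b z : conic_ring :=
  (b.1 * z.1 + cm * b.2 * z.2, b.1 * z.2 + b.2 * z.1).
Definition bconj b : conic_ring := (b.1, - b.2).
Definition bnorm b : {poly E} := b.1 ^+ 2 - cm * b.2 ^+ 2.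
Definition bev (R : fieldType) (f : {rmorphism E -> R}) (v w : R) b : R :=
  (map_poly f b.1).[v] + (map_poly f b.2).[v] * w.
(** Pole order at most n at infinity, with v and w both of order one; such elements form a space of
    dimension 2 n + 1. *)
Definition bdeg_le n b := (size b.1 <= n.+1)%N && (size b.2 <= n)%N.

Lemma bnormM b z : bnorm (bmul b z) = bnorm b * bnorm z.
Proof. rewrite /bnorm /bmul /=; ring. Qed.

Lemma map_conic_poly (R : fieldType) (f : {rmorphism E -> R}) :
  map_poly f cm = f A *: 'X^2 + (f C)%:P.
Proof. by rewrite rmorphD /= map_polyZ /= map_polyXn map_polyC. Qed.

Section Eval.
Variables (R : fieldType) (f : {rmorphism E -> R}) (v w : R).
Hypothesis hw : w ^+ 2 = f A * v ^+ 2 + f C.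

Lemma horner_conic_poly : (map_poly f cm).[v] = w ^+ 2.
Proof. by rewrite map_conic_poly hornerD hornerZ hornerXn hornerC hw. Qed.

Lemma bevM b z : bev f v w (bmul b z) = bev f v w b * bev f v w z.
Proof.
rewrite /bev /= !rmorphD !rmorphM /= !hornerE horner_conic_poly; ring.
Qed.

Lemma bevD b z : bev f v w (b + z) = bev f v w b + bev f v w z.
Proof. rewrite /bev /= !rmorphD /= !hornerD; ring. Qed.

Lemma bevB b z : bev f v w (b - z) = bev f v w b - bev f v w z.
Proof. rewrite /bev /= !rmorphB /= !hornerE; ring. Qed.

Lemma bevN b : bev f v w (- b) = - bev f v w b.
Proof. rewrite /bev /= !rmorphN /= !hornerN; ring. Qed.

Lemma bevZ e b : bev f v w (e *: b) = f e * bev f v w b.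
Proof. rewrite /bev /= !linearZ /= !hornerE; ring. Qed.

Lemma bev_norm b : (map_poly f (bnorm b)).[v] = bev f v w b * bev f v w (bconj b).
Proof.
rewrite /bev /bnorm /= rmorphB /= rmorphXn /= rmorphM /= rmorphXn /= rmorphN /= !(hornerD, hornerN, hornerM, horner_exp).
rewrite horner_conic_poly; ring.
Qed.
End Eval.

Lemma size_conic_poly : (size cm <= 3)%N.
Proof.
rewrite (leq_trans (size_polyD _ _)) // geq_max (leq_trans (size_scale_leq _ _)) ?size_polyXn //.
by rewrite (leq_trans (size_polyC_leq1 _)).
Qed.

Lemma bdeg_leM n k b z : bdeg_le n b -> bdeg_le k z -> bdeg_le (n + k) (bmul b z).
Proof.
move=> /andP[h1 h2] /andP[h3 h4]; have h5 := size_conic_poly; apply/andP; split.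
  rewrite (leq_trans (size_polyD _ _)) // geq_max; apply/andP; split.
    by rewrite (leq_trans (size_polyMleq _ _)) //; lia.
  case: (eqVneq b.2 0) => [->|b20]; first by rewrite mulr0 mul0r size_poly0.
  case: (eqVneq z.2 0) => [->|z20]; first by rewrite mulr0 size_poly0.
  have : (0 < size b.2)%N by rewrite size_poly_gt0.
  have : (0 < size z.2)%N by rewrite size_poly_gt0.
  have := size_polyMleq (cm * b.2) z.2; have := size_polyMleq cm b.2; lia.
rewrite (leq_trans (size_polyD _ _)) // geq_max; apply/andP; split.
  have := size_polyMleq b.1 z.2; lia.
have := size_polyMleq b.2 z.1; lia.
Qed.

Lemma bdeg_leD n b z : bdeg_le n b -> bdeg_le n z -> bdeg_le n (b + z).
Proof.
move=> /andP[h1 h2] /andP[h3 h4]; apply/andP; split;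
  by rewrite (leq_trans (size_polyD _ _)) // geq_max ?h1 ?h2 ?h3 ?h4.
Qed.

Lemma bdeg_leZ n e b : bdeg_le n b -> bdeg_le n (e *: b).
Proof.
by move=> /andP[h1 h2]; apply/andP; split; rewrite (leq_trans (size_scale_leq _ _)).
Qed.

Lemma bdeg_leB n b z : bdeg_le n b -> bdeg_le n z -> bdeg_le n (b - z).
Proof. by move=> h1 h2; rewrite -scaleN1r; apply: bdeg_leD => //; apply: bdeg_leZ. Qed.

Lemma size_bnorm_le n b : bdeg_le n b -> (size (bnorm b) <= (2 * n).+1)%N.
Proof.
move=> h; have hc : bdeg_le n (bconj b) by rewrite /bdeg_le /= size_polyN.
have := bdeg_leM h hc => /andP[]; rewrite /bmul /= => + _.
have -> : b.1 * b.1 + cm * b.2 * - b.2 = bnorm b by rewrite /bnorm; ring.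
by rewrite mul2n addnn.
Qed.

Hypothesis A_nonsquare : forall e : E, e ^+ 2 != A.

Lemma A_neq0 : A != 0.
Proof. by apply/eqP => h; have := A_nonsquare 0; rewrite h expr0n eqxx. Qed.

Lemma size_conicE : size cm = 3%N.
Proof.
rewrite size_polyDl size_scale ?A_neq0 ?size_polyXn //.
by rewrite (leq_ltn_trans (size_polyC_leq1 _)).
Qed.

Lemma lead_conicE : lead_coef cm = A.
Proof.
rewrite lead_coefE size_conicE /= /conic_poly.
by rewrite coefD coefZ coefXn coefC mulr1 addr0.
Qed.

Lemma bnorm_eq0 b : bnorm b = 0 -> b = 0.
Proof.
case: b => p q; rewrite /bnorm /= => /eqP; rewrite subr_eq0 => /eqP e.
case: (eqVneq q 0) e => [->|q0].
  by rewrite expr0n mulr0 => /eqP; rewrite expf_eq0 => /eqP ->.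
move/(congr1 lead_coef); rewrite lead_coef_exp lead_coefM lead_conicE lead_coef_exp => e.
have := A_nonsquare (lead_coef p / lead_coef q).
by rewrite expr_div_n e mulfK ?eqxx // expf_neq0 // lead_coef_eq0.
Qed.

Section Point.
Variables (k : fieldExtType E) (v w : k).
Hypothesis hw : w ^+ 2 = in_alg k A * v ^+ 2 + in_alg k C.
Local Notation ev := (bev (in_alg k) v w).
Local Notation kp := <<<<1; v>>; w>>%AS.

Lemma minimal_poly_over_base :
  exists p : {poly E}, size p = (adjoin_degree 1%AS v).+1 /\
    forall q, ((map_poly (in_alg k) q).[v] == 0) = (p %| q).
Proof.
have /polyOver1P[p hp] := minPolyOver 1%AS v.
exists p; split; first by rewrite -(size_map_poly (in_alg k)) -hp size_minPoly.
move=> q; apply/idP/idP => [h|].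
  rewrite -(dvdp_map (in_alg k)) -hp; apply: minPoly_dvdp => //.
  by apply/polyOver1P; exists q.
rewrite -(dvdp_map (in_alg k)) -hp => /dvdpP[y ->].
by rewrite hornerM (eqP (root_minPoly _ _)) mulr0.
Qed.

Lemma adjoin_degree_sqrt (K' : {subfield k}) (z : k) :
  z ^+ 2 \in K' -> z \notin K' -> adjoin_degree K' z = 2%N.
Proof.
move=> h hn; apply/eqP; rewrite eqn_leq; apply/andP; split.
  pose q : {poly k} := 'X^2 - (z ^+ 2)%:P.
  have : (size (minPoly K' z) <= size q)%N.
    apply: dvdp_leq; first by rewrite -size_poly_eq0 size_XnsubC.
    apply: minPoly_dvdp.
      by apply: rpredB; [exact: rpredX (polyOverX _) | rewrite polyOverC].
    by rewrite /root !hornerE subrr.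
  by rewrite size_minPoly size_XnsubC.
rewrite ltnNge; apply: contra hn => h1; rewrite -adjoin_deg_eq1 eqn_leq h1.
by have := size_minPoly K' z; have := root_minPoly K' z; case: (adjoin_degree _ _) => // /root_size_gt1 h2 h3; have := h2 _; rewrite h3 -size_poly_eq0 h3 => /(_ isT).
Qed.

(** The norm of P vanishes at the point and its degree is at most the degree of the point, so P can
    have no other zero and therefore divides every z vanishing there. *)
Lemma point_ideal_principal P z : P != 0 -> ev P = 0 -> ev z = 0 ->
  (size (bnorm P) <= (\dim kp).+1)%N -> exists z', z = bmul P z'.
Proof.
move=> P0 evP evz sP; have [p [sp hp]] := minimal_poly_over_base.
have nP0 : bnorm P != 0 by apply: contra_neq P0 => /bnorm_eq0.
have dim1 : \dim <<1; v>> = (size p).-1 by rewrite dim_Fadjoin sp dimv1 muln1.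
case: (boolP (w \in <<1; v>>%VS)) => [win|wnin].
  have dimk : \dim kp = (size p).-1.
    by rewrite dim_Fadjoin; have /eqP -> : adjoin_degree <<1; v>>%AS w == 1%N; rewrite ?adjoin_deg_eq1 ?mul1n.
  have pdvd : p %| bnorm P by rewrite -hp (bev_norm hw) evP mul0r.
  have dvP : bnorm P %| p.
    have sp0 : (0 < size p)%N by rewrite sp.
    rewrite dimk prednK // in sP.
    have : p %= bnorm P by rewrite -(dvdp_size_eqp pdvd) eqn_leq sP dvdp_leq.
    by case/andP.
  move: evP evz; rewrite /bev => evP evz.
  (* These are the two coordinates of z times the conjugate of P. They vanish at the point, so p
     divides them, and p is the norm of P up to a constant. *)
  have h1 : p %| z.1 * P.1 - cm * z.2 * P.2.
    rewrite -hp rmorphB !rmorphM /= !hornerE (horner_conic_poly hw).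
    by move/eqP: evP; move/eqP: evz; rewrite !addr_eq0 => /eqP -> /eqP ->; apply/eqP; ring.
  have h2 : p %| z.2 * P.1 - z.1 * P.2.
    rewrite -hp rmorphB !rmorphM /= !hornerE.
    by move/eqP: evP; move/eqP: evz; rewrite !addr_eq0 => /eqP -> /eqP ->; apply/eqP; ring.
  have /dvdpP[q1 e1] := dvdp_trans dvP h1; have /dvdpP[q2 e2] := dvdp_trans dvP h2.
  exists (q1, q2); case: z evz h1 h2 e1 e2 => z1 z2 /= _ _ _ e1 e2.
  rewrite /bmul /=; congr (_, _); apply: (mulIf nP0).
    transitivity (P.1 * (z1 * P.1 - cm * z2 * P.2) + cm * P.2 * (z2 * P.1 - z1 * P.2)).
      by rewrite /bnorm; ring.
    by rewrite e1 e2; ring.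
  transitivity (P.1 * (z2 * P.1 - z1 * P.2) + P.2 * (z1 * P.1 - cm * z2 * P.2)).
    by rewrite /bnorm; ring.
  by rewrite e1 e2; ring.
have w2in : w ^+ 2 \in <<1; v>>%VS.
  by rewrite hw rpredD ?rpredM ?rpredX ?memv_adjoin ?rpredZ ?rpred1.
have dimk : \dim kp = (2 * (size p).-1)%N by rewrite dim_Fadjoin adjoin_degree_sqrt // dim1.
(* Here 1 and w are independent over E(v), so both coordinates of y vanish at v. *)
have hz y : ev y = 0 -> (p %| y.1) && (p %| y.2).
  move=> evy; have inv q : (map_poly (in_alg k) q).[v] \in <<1; v>>%VS.
    by apply/Fadjoin_polyP; exists (map_poly (in_alg k) q) => //; apply/polyOver1P; exists q.
  have y2 : (map_poly (in_alg k) y.2).[v] = 0.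
    apply/eqP; apply: contraNT wnin => y20.
    have -> : w = - (map_poly (in_alg k) y.1).[v] / (map_poly (in_alg k) y.2).[v].
      by move/eqP: evy; rewrite /bev addrC addr_eq0 => /eqP <-; rewrite mulrC mulKf.
    by rewrite rpredM ?rpredN ?rpredV ?inv.
  by rewrite -!hp y2 eqxx andbT; move: evy; rewrite /bev y2 mul0r addr0 => ->.
have /andP[/dvdpP[P1 e1] /dvdpP[P2 e2]] := hz P evP.
have /andP[/dvdpP[z1 e3] /dvdpP[z2 e4]] := hz z evz.
have nPE : bnorm P = bnorm (P1, P2) * (p * p) by rewrite /bnorm /= e1 e2; ring.
have p0 : p != 0 by rewrite -size_poly_eq0 sp.
have n0 : bnorm (P1, P2) != 0 by apply: contra_neq nP0 => h; rewrite nPE h mul0r.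
have /size_poly1P[c c0 hc] : size (bnorm (P1, P2)) == 1%N.
  rewrite eqn_leq size_poly_gt0 n0 andbT.
  have sp0 : (0 < size p)%N by rewrite sp.
  move: sP; rewrite nPE dimk !size_mul ?mulf_neq0 //.
  by move: (size (bnorm _)) (size p) sp0 => n1 n2; lia.
have cc : c^-1%:P * c%:P = 1 :> {poly E} by rewrite -polyCM mulVf.
(* By degrees, the cofactor (P1, P2) of p in P has the constant norm c, so it is a unit whose
   inverse is its conjugate divided by c. *)
exists (c^-1 *: bmul (z1, z2) (bconj (P1, P2))).
have hc' : P1 ^+ 2 - cm * P2 ^+ 2 = c%:P by rewrite -hc.
case: z evz e3 e4 => y1 y2 /= _ -> ->; rewrite /bmul /= e1 e2 -!mul_polyC; congr (_, _).
  rewrite -{1}[z1]mul1r -cc -hc'; ring.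
rewrite -{1}[z2]mul1r -cc -hc'; ring.
Qed.

Section Parity.
Variable K' : {subfield k}.
Hypothesis K'_aniso : forall x y z : k, x \in K' -> y \in K' -> z \in K' ->
  x ^+ 2 = in_alg k A * y ^+ 2 + in_alg k C * z ^+ 2 -> y = 0 /\ z = 0.

(** Springer's argument: after reduction of R modulo p, the degree of R^2 - (A X^2 + C) is even and
    small, so the cofactor of an odd-degree divisor has again odd degree, but a smaller one. *)
Lemma no_odd_divisor n p R : p \is a polyOver K' -> R \is a polyOver K' ->
  size p = n.+1 -> odd n -> ~~ (p %| R ^+ 2 - map_poly (in_alg k) cm).
Proof.
elim/ltn_ind: n p R => n IH p R; wlog sR : R / (size R <= n)%N.
  move=> hwlog pK RK sp on; apply/negP => hp.
  have p0 : p != 0 by rewrite -size_poly_eq0 sp.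
  have := hwlog (R %% p) _ pK (modp_polyOver RK pK) sp on; rewrite -ltnS -sp ltn_modp.
  move/(_ p0)/negP; apply.
  have -> : (R %% p) ^+ 2 - map_poly (in_alg k) cm =
     R ^+ 2 - map_poly (in_alg k) cm - p * ((R %/ p) * (R + R %% p)).
    by move: (R %/ p) (R %% p) (divp_eq R p) => q r ->; ring.
  by rewrite dvdp_sub // dvdp_mulr.
move=> pK RK sp on; apply/negP => hp.
set T := R ^+ 2 - _ in hp.
have TK : T \is a polyOver K'.
  rewrite rpredB ?rpredX // map_conic_poly rpredD ?polyOverC ?polyOverZ ?rpredX ?polyOverX //;
  by rewrite rpredZ ?rpred1.
have sizeT : odd (size T) /\ (size T <= maxn (2 * n).-1 3)%N.
  have sm : (size (map_poly (in_alg k) cm) = 3)%N by rewrite size_map_poly size_conicE.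
  case: (leqP (size R) 2) => sR2.
    have /eqP sT : size T == 3%N.
      rewrite eqn_leq; apply/andP; split.
        rewrite (leq_trans (size_polyD _ _)) // geq_max size_polyN sm leqnn andbT.
        by rewrite (leq_trans (size_polyMleq _ _)) //; lia.
      rewrite ltnNge; apply/negP => sT.
      have : T`_2 = 0 by move/leq_sizeP: sT => ->.
      have R2 : R`_2 = 0 by move/leq_sizeP: sR2 => ->.
      rewrite /T coefB map_conic_poly coefD coefZ coefXn coefC /= mulr1 addr0.
      have -> : (R ^+ 2)`_2 = R`_1 ^+ 2.
        by rewrite expr2 coefM !big_ord_recl big_ord0 /= R2 mulr0 mul0r add0r !addr0 expr2.
      move/eqP; rewrite subr_eq0 => /eqP e.
      (* If the leading terms cancelled, A would be the square of the leading coefficient of R,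
         which is a point at infinity. *)
      have [] := K'_aniso (polyOverP RK 1) (rpred1 _) (rpred0 _).
        by rewrite e expr0n mulr0 addr0 expr1n mulr1.
      by move/eqP; rewrite oner_eq0.
    by rewrite sT; split => //; rewrite leq_maxr.
  have R0 : R != 0 by rewrite -size_poly_gt0 (leq_trans _ sR2).
  have sR2' : (size (R ^+ 2) = (2 * size R).-1)%N by rewrite expr2 size_mul // addnn -mul2n.
  have -> : size T = size (R ^+ 2).
    by rewrite size_polyDl // size_polyN sm sR2'; lia.
  rewrite sR2'; move: (size R) sR sR2 => d dn d2.
  have -> : ((2 * d).-1 = (2 * d.-1).+1)%N by lia.
  by split; [rewrite oddS oddM | lia].
case: sizeT => oT sT; have T0 : T != 0 by case: eqP oT => // ->; rewrite size_poly0.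
have /dvdpP[q Tq] := hp.
have [q0 p0] : q != 0 /\ p != 0 by apply/andP; rewrite -negb_or -mulf_eq0 -Tq.
have sTE : (size T = (size q + n)%N) by rewrite Tq size_mul // sp addnS.
have qK : q \is a polyOver K'.
  have -> : q = T %/ p by rewrite Tq mulpK.
  exact: divp_polyOver.
have n_gt0 : (0 < n)%N by case: (n) on.
(* Degree one is treated apart, since the cofactor may then have degree one as well; the root of p
   gives a point of the conic over K'. *)
case: (eqVneq n 1%N) => [n1|n1].
  rewrite n1 in sp.
  have p1 : p`_1 != 0 by move: p0; rewrite -lead_coef_eq0 lead_coefE sp.
  have r0 : root p (- p`_0 / p`_1).
    rewrite /root horner_coef sp !big_ord_recl big_ord0 /= expr0 expr1 addr0 mulr1.
    by rewrite mulrCA divff // mulr1 subrr.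
  set r := - p`_0 / p`_1 in r0.
  have rK : r \in K' by rewrite rpredM ?rpredN ?rpredV //; apply/polyOverP.
  have : T.[r] = 0 by rewrite Tq hornerM (eqP r0) mulr0.
  move/eqP; rewrite /T hornerD hornerN map_conic_poly hornerD hornerZ hornerXn hornerC horner_exp subr_eq0 => /eqP e.
  have [] := K'_aniso (rpred_horner RK rK) rK (rpred1 _).
    by rewrite e expr1n mulr1.
  by move=> _ /eqP; rewrite oner_eq0.
have [m sq] : exists m, size q = m.+1 by exists (size q).-1; rewrite prednK // size_poly_gt0.
have om : odd m by move: oT; rewrite sTE sq addSn /= oddD on; case: (odd m).
have n3 : (2 < n)%N by case: (n) on n_gt0 n1 => [|[|[|]]].
have mn : (m < n)%N by move: sT; rewrite sTE sq; lia.
have := IH m mn q R qK RK sq om; rewrite -/T Tq dvdp_mulIl //.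
Qed.

(** Springer's theorem for the conic. Either w is quadratic over K'(v), or w = R(v) and the minimal
    polynomial of v divides R^2 - (A X^2 + C), so that its degree is even. *)
Lemma dim_point_even : (K' <= kp)%VS -> (2 * \dim K' %| \dim kp)%N.
Proof.
move=> sub.
have kE : kp = <<<<K'; v>>; w>>%AS.
  apply/eqP; rewrite -val_eqE /= eqEsubv; apply/andP; split.
    apply/FadjoinP; split; last exact: memv_adjoin.
    apply/FadjoinP; split; first exact: sub1v.
    by apply: (subvP (subv_adjoin _ _)); apply: memv_adjoin.
  apply/FadjoinP; split; last exact: memv_adjoin.
  apply/FadjoinP; split => //.
  by apply: (subvP (subv_adjoin _ _)); apply: memv_adjoin.
rewrite kE dim_Fadjoin; have w2in : w ^+ 2 \in <<K'; v>>%VS.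
  by rewrite hw rpredD ?rpredM ?rpredX ?memv_adjoin ?rpredZ ?rpred1.
case: (boolP (w \in <<K'; v>>%VS)) => [win|wnin]; last first.
  by rewrite adjoin_degree_sqrt // dim_Fadjoin dvdn_mul // dvdn_mull.
have /eqP -> : adjoin_degree <<K'; v>>%AS w == 1%N by rewrite adjoin_deg_eq1.
rewrite mul1n dim_Fadjoin dvdn_mul // dvdn2.
apply/negP => od.
have [R RK wE] := Fadjoin_polyP win.
have := no_odd_divisor (minPolyOver K' v) RK (size_minPoly _ _) od.
move/negP; apply; apply: minPoly_dvdp.
  rewrite rpredB ?rpredX // map_conic_poly rpredD ?polyOverC ?polyOverZ ?rpredX ?polyOverX //;
  by rewrite rpredZ ?rpred1.
by rewrite /root hornerD hornerN (horner_conic_poly hw) horner_exp -wE subrr.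
Qed.
End Parity.

(** A dimension count in the role of Riemann-Roch: r functions of degree at most n have r (2 n + 1)
    coefficients, more than the dimension of the residue field in which the combination takes its
    value. *)
Lemma small_relation r (e : 'I_r -> k) n : (forall l, e l \in kp) ->
  (\dim kp < r * (2 * n).+1)%N ->
  exists b : 'I_r -> conic_ring, [/\ exists l, b l != 0, forall l, bdeg_le n (b l)
    & \sum_l ev (b l) * e l = 0].
Proof.
move=> ein dk.
have {}dk : (\dim kp < r * (n.+1 + n))%N by have -> : (n.+1 + n = (2 * n).+1)%N by lia.
pose phi (l : 'I_r) (i : 'I_(n.+1 + n)) : k :=
  (* The first n + 1 columns hold the coefficients of powers of v, the last n those of powers of v
     times w. *)
  match split i with inl j => v ^+ j * e l | inr j => v ^+ j * w * e l end.
pose F (M : 'M[E]_(r, n.+1 + n)) : k := \sum_l \sum_i M l i *: phi l i.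
have linF : linear F.
  move=> a M N; rewrite /F scaler_sumr -big_split; apply: eq_bigr => l _ /=.
  rewrite scaler_sumr -big_split; apply: eq_bigr => i _ /=.
  by rewrite !mxE scalerDl scalerA.
pose FL : {linear 'M[E]_(r, n.+1 + n) -> k} :=
  HB.pack F (GRing.isLinear.Build _ _ _ _ F linF).
have vin : v \in kp by apply: (subvP (subv_adjoin _ _)); apply: memv_adjoin.
have win : w \in kp by apply: memv_adjoin.
have imF : (linfun FL @: fullv <= kp)%VS.
  apply/subvP => y /memv_imgP[M _ ->]; rewrite lfunE /= /F.
  apply: rpred_sum => l _; apply: rpred_sum => i _; apply: rpredZ.
  by rewrite /phi; case: (split i) => j; rewrite ?rpredM ?rpredX.
have : lker (linfun FL) != 0%VS.
  have := limg_ker_dim (linfun FL) fullv; rewrite capfv dimvf.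
  have -> : dim 'M[E]_(r, n.+1 + n) = (r * (n.+1 + n))%N by rewrite dim_matrix.
  rewrite -dimv_eq0; move: dk (dimvS imF).
  move: (\dim kp) (\dim (limg _)) (\dim (lker _)) => d1 d2 [|d3] // h1 h2 h3.
  by move: (leq_ltn_trans h2 h1); rewrite -h3 add0n ltnn.
rewrite -vpick0; set M := vpick _ => M0.
have /eqP : linfun FL M == 0 by rewrite -memv_ker memv_pick.
rewrite lfunE /= /F => FM.
exists (fun l => (rVpoly (lsubmx (row l M)), rVpoly (rsubmx (row l M)))); split.
- case: (pickP (fun l => row l M != 0)) => [l hl|h].
    exists l; apply: contra hl => /eqP[h1 h2]; rewrite -[row l M]hsubmxK.
    by rewrite -[lsubmx _]rVpolyK -[rsubmx _]rVpolyK h1 h2 !linear0 row_mx0.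
  case/eqP: M0; apply/row_matrixP => l; rewrite linear0; apply/eqP.
  by have := h l; case: eqP.
- by move=> l; rewrite /bdeg_le /= !size_poly.
- rewrite -[RHS]FM; apply: eq_bigr => l _; rewrite /bev /=.
  have hor m (u : 'rV[E]_m) : (map_poly (in_alg k) (rVpoly u)).[v] = \sum_(i < m) u 0 i *: v ^+ i.
    rewrite (@horner_coef_wide _ m); last by rewrite size_map_poly size_poly.
    by apply: eq_bigr => i _; rewrite coef_map coef_rVpoly_ord /= mulr_algl.
  rewrite !hor big_split_ord mulrDl !mulr_suml; congr (_ + _); apply: eq_bigr => i _.
    by rewrite /phi (unsplitK (inl i)) !mxE -scalerAl.
  by rewrite /phi (unsplitK (inr i)) !mxE -!scalerAl.
Qed.
End Point.
End ConicRing.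

Lemma exists_irreducible_factor (E : fieldType) (p : {poly E}) :
  (1 < size p)%N -> exists2 q, irreducible_poly q & q %| p.
Proof.
have [n] := ubnP (size p); elim: n p => // n IH p sp p1.
have [irr|nirr] := classic (irreducible_poly p); first by exists p.
have [q [q1 qp nqp]] : exists q : {poly E}, [/\ size q != 1%N, q %| p & ~ q %= p].
  apply: NNPP => h; apply: nirr; split=> // q q1 qp; apply: NNPP => h'.
  by apply: h; exists q.
have p0 : p != 0 by rewrite -size_poly_gt0 ltnW.
have q0 : q != 0 by apply: contraNneq p0 => h; move: qp; rewrite h dvd0p.
have sq : (size q < size p)%N.
  rewrite ltn_neqAle dvdp_leq // andbT; apply/negP => /eqP h; apply: nqp.
  by rewrite -dvdp_size_eqp // h.
have [||r ir rq] := IH q; first exact: leq_trans sq sp.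
  by move: q0 q1; rewrite -size_poly_gt0; case: (size q) => [|[]].
by exists r => //; apply: dvdp_trans qp.
Qed.

Lemma coefM_top (R : nzRingType) (p q : {poly R}) n m :
  (size p <= n.+1)%N -> (size q <= m.+1)%N -> (p * q)`_(n + m) = p`_n * q`_m.
Proof.
move=> sp sq; rewrite coefM.
have nlt : (n < (n + m).+1)%N by lia.
rewrite (bigD1 (Ordinal nlt)) //= big1 ?addr0; first by rewrite addKn.
move=> i /eqP ni; have {}ni : nat_of_ord i != n by apply/eqP => h; apply: ni; apply: val_inj.
case: (ltnP i n) => hi; last first.
  by rewrite [p`_i]nth_default ?mul0r // (leq_trans sp) // ltn_neqAle eq_sym ni.
rewrite [q`__]nth_default ?mulr0 // (leq_trans sq) //.
by move: hi; move: (nat_of_ord i) => t; lia.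
Qed.

Lemma mem_quadratic_adjoin (E : fieldType) (k : fieldExtType E) (z : E) (xi e : k) :
  xi ^+ 2 = in_alg k z -> e \in <<1; xi>>%VS ->
  exists c0 c1, e = in_alg k c0 + in_alg k c1 * xi.
Proof.
move=> hxi /Fadjoin_polyP[p /polyOver1P[q ->] ->].
elim/poly_ind: q => [|q c [c0 [c1 IH]]].
  by exists 0, 0; rewrite rmorph0 horner0 !rmorph0 mul0r addr0.
have hz : (in_alg k : {rmorphism E -> k}) z = xi ^+ 2 by rewrite hxi.
exists (c1 * z + c), c0.
have -> : in_alg k (c1 * z + c) = in_alg k c1 * xi ^+ 2 + in_alg k c.
  by rewrite rmorphD rmorphM hz.
rewrite rmorphD rmorphM /= map_polyX map_polyC hornerD hornerM hornerX hornerC IH /=; ring.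
Qed.

(** The two equations are the coordinates of (a0 + a1 t)^2 = x (b0 + b1 t)^2 with t^2 = A, and the
    hypotheses keep x from becoming a square after adjoining t. A factored identity avoids the
    extension. *)
Lemma biquadratic_relation (F : fieldType) (A x a0 a1 b0 b1 : F) :
  (forall f, f ^+ 2 != x) -> (forall f, f ^+ 2 != A * x) ->
  a0 * a1 = x * (b0 * b1) -> a0 ^+ 2 + A * a1 ^+ 2 = x * (b0 ^+ 2 + A * b1 ^+ 2) ->
  [/\ a0 = 0, a1 = 0, b0 = 0 & b1 = 0].
Proof.
move=> hx hAx e1 e2.
have x0 : x != 0 by apply/eqP => h; have := hx 0; rewrite h expr0n eqxx.
have sq (z y t : F) : (forall f, f ^+ 2 != z) -> y ^+ 2 = z * t ^+ 2 -> y = 0 /\ t = 0.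
  move=> hz e; case: (eqVneq t 0) => [t0|t0].
    split=> //; apply/eqP; move: e; rewrite t0 !expr2 !mulr0 => /eqP.
    by rewrite mulf_eq0 orbb.
  by have := hz (y / t); rewrite expr_div_n e mulfK ?eqxx // expf_neq0.
case: (eqVneq a1 0) => [a10|a10].
  move: e1 e2; rewrite a10 mulr0 expr0n mulr0 addr0 => /esym/eqP.
  rewrite !mulf_eq0 (negPf x0) /= => /orP[]/eqP -> e2.
    have [] := @sq (A * x) a0 b1 hAx; first by rewrite e2; ring.
    by move=> -> ->.
  have [] := @sq x a0 b0 hx; first by rewrite e2; ring.
  by move=> -> ->.
have : (x * b0 ^+ 2 - A * a1 ^+ 2) * (x * b1 ^+ 2 - a1 ^+ 2) = 0.
  have -> : (x * b0 ^+ 2 - A * a1 ^+ 2) * (x * b1 ^+ 2 - a1 ^+ 2) =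
    (x * (b0 * b1)) ^+ 2 + A * a1 ^+ 2 * a1 ^+ 2 - a1 ^+ 2 * (x * (b0 ^+ 2 + A * b1 ^+ 2)) by ring.
  by rewrite -e1 -e2; ring.
move/eqP; rewrite mulf_eq0 !subr_eq0 => /orP[]/eqP e3.
  have [] := @sq (A * x) (A * a1) b0 hAx; first by rewrite -mulrA e3; ring.
  move=> /eqP; rewrite mulf_eq0 (negPf a10) orbF => /eqP A0.
  by have := hAx 0; rewrite A0 mul0r expr0n eqxx.
by have [] := @sq x a1 b1 hx (esym e3); move/eqP; rewrite (negPf a10).
Qed.

(** * Closed points whose ideals are generated by norms, and the descent along them *)

Section Descent.
Variables (E F : fieldType) (j : {rmorphism E -> F}) (A C : E) (v w : F).
Variable x : 'I_4 -> E.
Hypothesis two_neq0 : (2%:R : E) != 0.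
Hypothesis hw : w ^+ 2 = j A * v ^+ 2 + j C.
Hypothesis A_nonsquare : forall e : E, e ^+ 2 != A.
Hypothesis Ax_nonsquare : forall i (e : E), e ^+ 2 != A * x i.
Hypothesis x_nonsquare : forall i (f : F), f ^+ 2 != j (x i).
Hypothesis xx_nonsquare : forall i l, i != l -> forall f : F, f ^+ 2 != j (x i * x l).
Local Notation B := (conic_ring E).
Local Notation "b ** z" := (bmul A C b z) (at level 40).
Local Notation bv := (bev j v w).
Hypothesis bv_inj : forall b, bv b = 0 -> b = 0.
Hypothesis aniso : forall (k : fieldExtType E) (xi eta : k) i l, i != l ->
  xi ^+ 2 = in_alg k (x i) -> eta ^+ 2 = in_alg k (x l) ->
  forall a b c : k, a \in <<<<1; xi>>; eta>>%VS -> b \in <<<<1; xi>>; eta>>%VS ->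
  c \in <<<<1; xi>>; eta>>%VS ->
  a ^+ 2 = in_alg k A * b ^+ 2 + in_alg k C * c ^+ 2 -> b = 0 /\ c = 0.

Lemma x_nonsquareE i (e : E) : e ^+ 2 != x i.
Proof.
by apply/eqP => h; have := x_nonsquare i (j e); rewrite -rmorphXn h eqxx.
Qed.

Lemma xx_nonsquareE i l (e : E) : i != l -> e ^+ 2 != x i * x l.
Proof.
move=> il; apply/eqP => h; have := xx_nonsquare il (j e).
by rewrite -rmorphXn h eqxx.
Qed.

(** Adjoining the root of one more x l leads back to the biquadratic hypothesis. *)
Lemma aniso_quadratic (k : fieldExtType E) (xi : k) i :
  xi ^+ 2 = in_alg k (x i) ->
  forall a b c : k, a \in <<1; xi>>%VS -> b \in <<1; xi>>%VS -> c \in <<1; xi>>%VS ->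
  a ^+ 2 = in_alg k A * b ^+ 2 + in_alg k C * c ^+ 2 -> b = 0 /\ c = 0.
Proof.
move=> hxi a b c ha hb hc e.
have [l il] : exists l, i != l.
  by case: (eqVneq i ord0) => [->|h]; [exists ord_max | exists ord0].
have [k' [f [eta [fE heta]]]] := sqrt_step (in_alg k (x l)).
have fin y : y \in <<1; xi>>%VS -> f y \in <<<<1; f xi>>; eta>>%VS.
  move=> /(mem_quadratic_adjoin hxi)[c0 [c1 ->]]; apply: (subvP (subv_adjoin _ _)).
  rewrite rmorphD rmorphM /= !fE rpredD ?rpredM ?memv_adjoin //;
  by rewrite rpredZ ?rpred1.
have [|||fb0 fc0] := aniso il _ _ (fin _ ha) (fin _ hb) (fin _ hc).
- by rewrite -rmorphXn hxi /= fE.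
- by rewrite heta /= fE.
- by rewrite -!rmorphXn e rmorphD !rmorphM /= !fE.
by split; apply: (fmorph_inj f); rewrite rmorph0.
Qed.

Lemma aniso_base (k : fieldExtType E) :
  forall a b c : k, a \in 1%VS -> b \in 1%VS -> c \in 1%VS ->
  a ^+ 2 = in_alg k A * b ^+ 2 + in_alg k C * c ^+ 2 -> b = 0 /\ c = 0.
Proof.
move=> a b c ha hb hc e.
have [k' [f [xi [fE hxi]]]] := sqrt_step (in_alg k (x ord0)).
have fin y : y \in 1%VS -> f y \in <<1; xi>>%VS.
  by move=> /vlineP[c0 ->]; rewrite fE rpredZ ?rpred1.
have [||fb0 fc0] := aniso_quadratic (i := ord0) _ (fin _ ha) (fin _ hb) (fin _ hc).
- by rewrite hxi /= fE.
- by rewrite -!rmorphXn e rmorphD !rmorphM /= !fE.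
by split; apply: (fmorph_inj f); rewrite rmorph0.
Qed.

Lemma quadratic_notin_base (k : fieldExtType E) (xi : k) i :
  xi ^+ 2 = in_alg k (x i) -> xi \notin 1%AS.
Proof.
move=> hxi; apply/negP => /vlineP[c h].
have := x_nonsquareE i c; rewrite -(inj_eq (fmorph_inj (in_alg k))) rmorphXn.
by rewrite /= -h hxi eqxx.
Qed.

Lemma dim_quadratic (k : fieldExtType E) (xi : k) i :
  xi ^+ 2 = in_alg k (x i) -> \dim <<1; xi>> = 2%N.
Proof.
move=> hxi; rewrite dim_Fadjoin dimv1 muln1 adjoin_degree_sqrt //.
  by rewrite hxi rpredZ ?rpred1.
exact: quadratic_notin_base hxi.
Qed.

Lemma dim_biquadratic (k : fieldExtType E) (xi eta : k) i l : i != l ->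
  xi ^+ 2 = in_alg k (x i) -> eta ^+ 2 = in_alg k (x l) ->
  \dim <<<<1; xi>>; eta>> = 4%N.
Proof.
move=> il hxi heta; rewrite dim_Fadjoin (dim_quadratic hxi) adjoin_degree_sqrt //.
  by rewrite heta rpredZ ?rpred1.
apply/negP => /(mem_quadratic_adjoin hxi)[c0 [c1 h]].
pose ia : {rmorphism E -> k} := in_alg k.
have e : ia (2%:R * c0 * c1) * xi = ia (x l - c0 ^+ 2 - c1 ^+ 2 * x i).
  have hz : ia (x i) = xi ^+ 2 by rewrite hxi.
  have hy : ia (x l) = eta ^+ 2 by rewrite heta.
  have h' : eta = ia c0 + ia c1 * xi by [].
  rewrite !(rmorphB, rmorphXn, rmorphM, rmorph_nat) hz hy h'; ring.
have /eqP : 2%:R * c0 * c1 = 0.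
  apply/eqP; apply: contraNT (quadratic_notin_base hxi) => nz.
  have -> : xi = ia ((2%:R * c0 * c1)^-1 * (x l - c0 ^+ 2 - c1 ^+ 2 * x i)).
    by rewrite rmorphM -e fmorphV mulKf // fmorph_eq0.
  by rewrite rpredZ ?rpred1.
rewrite !mulf_eq0 (negPf two_neq0) orFb => /orP[]/eqP hc; move: e.
  rewrite hc mulr0 mul0r rmorph0 mul0r => /esym/eqP; rewrite fmorph_eq0 expr2 mulr0 subr0.
  rewrite subr_eq0 => /eqP h'.
  have := @xx_nonsquareE i l (c1 * x i) il; rewrite h' => /eqP[]; ring.
rewrite hc mulr0 rmorph0 mul0r => /esym/eqP; rewrite fmorph_eq0 [0 ^+ 2]expr2 mulr0 mul0r subr0.
rewrite subr_eq0 => /eqP h'.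
by have := x_nonsquareE l c0; rewrite h' eqxx.
Qed.

Definition pnorm (z : E) (b c : B) : B := b ** b - z *: (c ** c).

Lemma bev_pnorm (R : fieldType) (f : {rmorphism E -> R}) v0 w0 z b c :
  w0 ^+ 2 = f A * v0 ^+ 2 + f C ->
  bev f v0 w0 (pnorm z b c) = bev f v0 w0 b ^+ 2 - f z * bev f v0 w0 c ^+ 2.
Proof. by move=> h; rewrite /pnorm bevB bevZ !(bevM h) !expr2. Qed.

Lemma bvP b c : bv b = bv c -> b = c.
Proof.
move=> h; apply/eqP; rewrite -subr_eq0; apply/eqP; apply: bv_inj.
by rewrite bevB h subrr.
Qed.

Lemma bv_eq0 b : (bv b == 0) = (b == 0).
Proof.
apply/eqP/eqP => [/bv_inj //|->].
by rewrite /bev /= !rmorph0 !horner0 mul0r addr0.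
Qed.

Lemma pnorm_eq0 i b c : pnorm (x i) b c = 0 -> b = 0 /\ c = 0.
Proof.
move=> /eqP; rewrite -bv_eq0 (bev_pnorm _ _ _ hw) subr_eq0 => /eqP h.
case: (eqVneq c 0) => [c0|c0].
  split=> //; apply/eqP; rewrite -bv_eq0; move: h.
  by rewrite c0 {2}/bev /= !rmorph0 !horner0 mul0r addr0 expr0n mulr0 => /eqP; rewrite expf_eq0.
have := x_nonsquare i (bv b / bv c).
by rewrite expr_div_n h mulfK ?eqxx // expf_neq0 // bv_eq0.
Qed.

Section AtPoint.
Variables (k : fieldExtType E) (v0 w0 : k).
Hypothesis hw0 : w0 ^+ 2 = in_alg k A * v0 ^+ 2 + in_alg k C.
Local Notation ev := (bev (in_alg k) v0 w0).
Local Notation kp := <<<<1; v0>>; w0>>%AS.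

Definition point_generator P :=
  [/\ P != 0, ev P = 0 & forall z, ev z = 0 -> exists z', z = P ** z'].

Lemma mem_ev b : ev b \in kp.
Proof.
have inv q : (map_poly (in_alg k) q).[v0] \in kp.
  apply: (subvP (subv_adjoin _ _)).
  by apply/Fadjoin_polyP; exists (map_poly (in_alg k) q) => //; apply/polyOver1P; exists q.
by rewrite rpredD ?rpredM ?inv ?memv_adjoin.
Qed.

Lemma point_generatorP P n : P != 0 -> ev P = 0 -> bdeg_le n P ->
  (2 * n <= \dim kp)%N -> point_generator P.
Proof.
move=> P0 evP dP hn; split=> // z evz.
apply: (point_ideal_principal A_nonsquare hw0) => //.
by apply: leq_trans (size_bnorm_le A C dP) _.
Qed.

(** The point has even degree 2 n, and the functions of degree at most n have dimension 2 n + 1, so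
    one of them vanishes there. *)
Lemma generator0 : exists P, point_generator P.
Proof.
have /dvdnP[n hn] := dim_point_even A_nonsquare hw0 (@aniso_base k) (sub1v _).
rewrite dimv1 muln1 in hn.
have [] := @small_relation E k v0 w0 1 (fun=> 1) n.
- by move=> _; apply: rpred1.
- by rewrite hn mul1n; lia.
move=> b [[l bl0] db]; rewrite big_ord1 mulr1 => evb; exists (b ord0).
apply: (@point_generatorP _ n) => //; first by rewrite (ord1 l) in bl0.
by rewrite hn mulnC.
Qed.

(** The point has degree 4 n. A relation r1 + xi r2 = 0 at the point with r1, r2 of degree at most n
    exists since 2 (2 n + 1) > 4 n, and the norm of r1 + r2 sqrt(x i) has degree at most 2 n, just
    small enough to generate. *)
Lemma generator1 xi i : xi \in kp -> xi ^+ 2 = in_alg k (x i) ->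
  exists r1 r2, point_generator (pnorm (x i) r1 r2) /\ ev r1 = - xi * ev r2.
Proof.
move=> xin hxi.
have sub : (<<1; xi>>%AS <= kp)%VS by apply/FadjoinP; split; rewrite ?sub1v.
have /dvdnP[n hn] := dim_point_even A_nonsquare hw0 (aniso_quadratic hxi) sub.
rewrite (dim_quadratic hxi) in hn.
pose e (l : 'I_2) := if l == ord0 then 1 else xi.
have [] := @small_relation E k v0 w0 2 e n.
- by move=> l; rewrite /e; case: ifP; rewrite ?rpred1.
- by rewrite hn; lia.
move=> b [[l bl0] db]; rewrite big_ord_recl big_ord1 /e /= mulr1.
set b1 := b _; set b2 := b _ => evb.
have evb1 : ev b1 = - xi * ev b2 by move/eqP: evb; rewrite addr_eq0 => /eqP ->; ring.
exists b1, b2; split=> //; apply: (@point_generatorP _ (n + n)).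
- apply: contraNneq bl0 => /pnorm_eq0[h1 h2].
  by move: l; apply/forallP; apply/forallP => l; case: (unliftP ord0 l) => [m ->|->]; rewrite ?(ord1 m) -?/b1 -?/b2 ?h1 ?h2.
- have hz : (in_alg k : {rmorphism E -> k}) (x i) = xi ^+ 2 by rewrite hxi.
  by rewrite (bev_pnorm _ _ _ hw0) evb1 hz; ring.
- by rewrite bdeg_leB ?bdeg_leZ ?bdeg_leM ?db.
- by rewrite hn; lia.
Qed.

(** The point has degree 8 n, and the full norm of a relation in 1, xi, eta, xi eta has degree at
    most 4 n. Taken in two steps through either quadratic subfield, this single element is a norm of
    both types. *)
Lemma generator2 xi eta i l : i != l -> xi \in kp -> eta \in kp ->
  xi ^+ 2 = in_alg k (x i) -> eta ^+ 2 = in_alg k (x l) ->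
  exists a1 a2 c1 c2, [/\ point_generator (pnorm (x i) a1 a2),
    pnorm (x i) a1 a2 = pnorm (x l) c1 c2,
    ev a1 = - xi * ev a2 & ev c1 = - eta * ev c2].
Proof.
move=> il xin etain hxi heta.
have hz : (in_alg k : {rmorphism E -> k}) (x i) = xi ^+ 2 by rewrite hxi.
have hy : (in_alg k : {rmorphism E -> k}) (x l) = eta ^+ 2 by rewrite heta.
have sub : (<<<<1; xi>>; eta>>%AS <= kp)%VS.
  by apply/FadjoinP; split=> //; apply/FadjoinP; split; rewrite ?sub1v.
have /dvdnP[n hn] := dim_point_even A_nonsquare hw0 (aniso il hxi heta) sub.
rewrite (dim_biquadratic il hxi heta) in hn.
pose e (m : 'I_4) : k := nth 0 [:: 1; xi; eta; xi * eta] m.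
have [] := @small_relation E k v0 w0 4 e n.
- by move=> [[|[|[|[|m]]]] hm]; rewrite /e /= ?rpredM ?rpred1.
- by rewrite hn; lia.
move=> b [bn0 db].
rewrite !big_ord_recl big_ord0 /e /= mulr1 addr0.
set r1 := b _; set r2 := b _; set r3 := b _; set r4 := b _ => evb.
set X := x i; set Y := x l.
have br : r1 = 0 -> r2 = 0 -> r3 = 0 -> r4 = 0 -> False.
  move=> h1 h2 h3 h4; case: bn0 => m /eqP[].
  case: (unliftP ord0 m) => [m1 ->|-> //].
  case: (unliftP ord0 m1) => [m2 ->|-> //].
  case: (unliftP ord0 m2) => [m3 ->|-> //].
  by rewrite (ord1 m3).
(* With X = x i and Y = x l, a1 + a2 sqrt X and c1 + c2 sqrt Y are the norms of r1 + r2 sqrt X + r3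
   sqrt Y + r4 sqrt (X Y) to the two quadratic subfields. *)
pose a1 := r1 ** r1 + X *: (r2 ** r2) - Y *: (r3 ** r3) - (X * Y) *: (r4 ** r4).
pose a2 := 2%:R *: (r1 ** r2 - Y *: (r3 ** r4)).
pose c1 := r1 ** r1 - X *: (r2 ** r2) + Y *: (r3 ** r3) - (X * Y) *: (r4 ** r4).
pose c2 := 2%:R *: (r1 ** r3 - X *: (r2 ** r4)).
have evE (R : fieldType) (f : {rmorphism E -> R}) v1 w1 (hw1 : w1 ^+ 2 = f A * v1 ^+ 2 + f C) :
  let g := bev f v1 w1 in
  [/\ g a1 = g r1 ^+ 2 + f X * g r2 ^+ 2 - f Y * g r3 ^+ 2 - f X * f Y * g r4 ^+ 2,
      g a2 = 2%:R * (g r1 * g r2 - f Y * (g r3 * g r4)),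
      g c1 = g r1 ^+ 2 - f X * g r2 ^+ 2 + f Y * g r3 ^+ 2 - f X * f Y * g r4 ^+ 2
    & g c2 = 2%:R * (g r1 * g r3 - f X * (g r2 * g r4))].
  move=> g; rewrite /g; split; rewrite !(bevD, bevN, bevZ, bevM hw1) ?rmorph_nat ?rmorphM; ring.
have [va1 va2 vc1 vc2] := evE _ _ _ _ hw; have [ea1 ea2 ec1 ec2] := evE _ _ _ _ hw0.
have r1E : ev r1 = - (ev r2 * xi + ev r3 * eta + ev r4 * (xi * eta)).
  by move/eqP: evb; rewrite addr_eq0 addrA => /eqP.
exists a1, a2, c1, c2; split.
- apply: (@point_generatorP _ (n + n + (n + n))).
  + apply/eqP => /pnorm_eq0[a10 a20].
    have j2 : (2%:R : F) != 0 by rewrite -(rmorph_nat j) fmorph_eq0.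
    have b00 : bv 0 = 0 by apply/eqP; rewrite bv_eq0.
    have [/eqP h1 /eqP h2 /eqP h3 /eqP h4] : [/\ bv r1 = 0, bv r2 = 0, bv r3 = 0 & bv r4 = 0].
      apply: (@biquadratic_relation F (j X) (j Y)).
      + exact: x_nonsquare.
      + by move=> f; rewrite -rmorphM xx_nonsquare.
      + have := congr1 bv a20; rewrite va2 b00 => /eqP.
        by rewrite mulf_eq0 (negPf j2) /= subr_eq0 => /eqP.
      + have := congr1 bv a10; rewrite va1 b00 => /eqP; rewrite -subr_eq0 subr0 => /eqP h.
        by apply/eqP; rewrite -subr_eq0 -h; apply/eqP; ring.
    by rewrite !bv_eq0 in h1 h2 h3 h4; exact: br (eqP h1) (eqP h2) (eqP h3) (eqP h4).
  + by rewrite (bev_pnorm _ _ _ hw0) ea1 ea2 hz hy r1E; ring.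
  + have dm b' c' : bdeg_le n b' -> bdeg_le n c' -> bdeg_le (n + n) (b' ** c') by apply: bdeg_leM.
    have da1 : bdeg_le (n + n) a1.
      by do ?[by apply: dm; apply: db | apply: bdeg_leZ | apply: bdeg_leB | apply: bdeg_leD].
    have da2 : bdeg_le (n + n) a2.
      by do ?[by apply: dm; apply: db | apply: bdeg_leZ | apply: bdeg_leB | apply: bdeg_leD].
    by apply: bdeg_leB; last apply: bdeg_leZ; apply: bdeg_leM.
  + by rewrite hn; lia.
- apply: bvP; rewrite !(bev_pnorm _ _ _ hw) va1 va2 vc1 vc2 -/X -/Y; ring.
- rewrite ea1 ea2 hz hy r1E; ring.
- rewrite ec1 ec2 hz hy r1E; ring.
Qed.

(** The product of f1 + f2 sqrt z with r1 - r2 sqrt z has both components zero at the point, so they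
    are divisible by the generator D = r1^2 - z r2^2; taking norms and cancelling one D leaves the
    claim. *)
Lemma divide_by_generator z r1 r2 f1 f2 (xi : k) :
  xi ^+ 2 = in_alg k z -> point_generator (pnorm z r1 r2) ->
  ev r1 = - xi * ev r2 -> ev f1 = - xi * ev f2 ->
  exists h1 h2, bv f1 ^+ 2 - j z * bv f2 ^+ 2 =
    bv (pnorm z r1 r2) * (bv h1 ^+ 2 - j z * bv h2 ^+ 2).
Proof.
move=> hxi [P0 _ gen] er ef.
have hz : (in_alg k : {rmorphism E -> k}) z = xi ^+ 2 by rewrite hxi.
have [|h1 e1] := gen (f1 ** r1 - z *: (f2 ** r2)).
  by rewrite bevB bevZ !(bevM hw0) er ef hz; ring.
have [|h2 e2] := gen (f2 ** r1 - f1 ** r2).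
  by rewrite bevB !(bevM hw0) er ef; ring.
exists h1, h2.
have {}P0 : bv (pnorm z r1 r2) != 0 by rewrite bv_eq0.
have e3 := congr1 bv e1; have e4 := congr1 bv e2.
rewrite bevB bevZ !(bevM hw) in e3; rewrite bevB !(bevM hw) in e4.
apply: (mulIf P0); move: e3 e4; rewrite (bev_pnorm _ _ _ hw).
set R1 := bv r1; set R2 := bv r2; set F1 := bv f1; set F2 := bv f2.
set H1 := bv h1; set H2 := bv h2; set Z := j z => e3 e4.
transitivity ((F1 * R1 - Z * (F2 * R2)) ^+ 2 - Z * (F2 * R1 - F1 * R2) ^+ 2); first by ring.
rewrite e3 e4.
ring.
Qed.
End AtPoint.

(** A root of an irreducible factor of the norm of g is a zero of g or of its conjugate; in the
    second case the sign of w is changed. *)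
Lemma exists_point g : (1 < size (bnorm A C g))%N ->
  exists (k : fieldExtType E) (v0 w0 : k),
    w0 ^+ 2 = in_alg k A * v0 ^+ 2 + in_alg k C /\ bev (in_alg k) v0 w0 g = 0.
Proof.
move=> /exists_irreducible_factor[p irr pg].
have [k1 _ [v1 rv1 _]] := irredp_FAdjoin irr.
have [k [f [w0 [fE hw0]]]] := sqrt_step (in_alg k1 A * v1 ^+ 2 + in_alg k1 C).
have hw1 : w0 ^+ 2 = in_alg k A * (f v1) ^+ 2 + in_alg k C.
  by rewrite hw0 rmorphD rmorphM rmorphXn /= !fE.
have : (map_poly (in_alg k) (bnorm A C g)).[f v1] = 0.
  have -> : map_poly (in_alg k) (bnorm A C g) = map_poly f (map_poly (in_alg k1) (bnorm A C g)).
    by apply/polyP => i; rewrite !coef_map /= fE.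
  rewrite horner_map; move/dvdpP: pg => [q ->]; rewrite rmorphM hornerM.
  by rewrite (eqP rv1) mulr0 rmorph0.
rewrite (bev_norm hw1) => /eqP; rewrite mulf_eq0 => /orP[]/eqP h.
  by exists k, (f v1), w0.
exists k, (f v1), (- w0); split; first by rewrite sqrrN.
by move: h; rewrite /bev /= rmorphN hornerN mulNr mulrN.
Qed.

Lemma bnorm_mul_lt (k : fieldExtType E) (v0 w0 : k) P g g' :
  w0 ^+ 2 = in_alg k A * v0 ^+ 2 + in_alg k C ->
  P != 0 -> bev (in_alg k) v0 w0 P = 0 -> g != 0 -> g = P ** g' ->
  g' != 0 /\ (size (bnorm A C g') < size (bnorm A C g))%N.
Proof.
move=> hw0 P0 evP g0 gE.
have nz b : b != 0 -> bnorm A C b != 0 by apply: contra_neq => /(bnorm_eq0 A_nonsquare).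
have g'0 : g' != 0.
  by apply: contra_neq g0 => h; rewrite gE h /bmul /= !mulr0 addr0.
split=> //; rewrite gE bnormM size_mul ?nz //.
have s1 : (1 < size (bnorm A C P))%N.
  rewrite -(size_map_poly (in_alg k)); apply: (@root_size_gt1 _ v0).
    by rewrite map_poly_eq0 nz.
  by rewrite /root (bev_norm hw0) evP mul0r.
have : (0 < size (bnorm A C g'))%N by rewrite size_poly_gt0 nz.
by move: s1; move: (size _) (size _) => n1 n2; lia.
Qed.

Lemma bdeg_le_drop n (b : B) : bdeg_le n.+1 b -> b.1`_n.+1 = 0 -> b.2`_n = 0 -> bdeg_le n b.
Proof.
move=> /andP[h1 h2] e1 e2; apply/andP; split; apply/leq_sizeP => i.
  rewrite leq_eqVlt => /orP[/eqP <- //|hi]; apply/leq_sizeP: hi; exact: h1.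
rewrite leq_eqVlt => /orP[/eqP <- //|hi]; apply/leq_sizeP: hi; exact: h2.
Qed.

Lemma bdeg_le_exists (b : B) : exists n, bdeg_le n b.
Proof. by exists (maxn (size b.1) (size b.2)); rewrite /bdeg_le; lia. Qed.

Lemma coef_conic2 : (conic_poly A C)`_2 = A.
Proof. by rewrite /conic_poly coefD coefZ coefXn coefC mulr1 addr0. Qed.

Lemma bmul_top1 n m b c : bdeg_le n.+1 b -> bdeg_le m.+1 c ->
  (b ** c).1`_(n.+1 + m.+1) = b.1`_n.+1 * c.1`_m.+1 + A * (b.2`_n * c.2`_m).
Proof.
move=> /andP[h1 h2] /andP[h3 h4]; rewrite /bmul /= coefD coefM_top //; congr (_ + _).
have s2 : (size (b.2 * c.2)%R <= (n + m).+1)%N by have := size_polyMleq b.2 c.2; lia.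
rewrite -mulrA (_ : (n.+1 + m.+1 = 2 + (n + m))%N); last by lia.
by rewrite coefM_top ?size_conic_poly // coefM_top // coef_conic2.
Qed.

Lemma bmul_top2 n m b c : bdeg_le n.+1 b -> bdeg_le m.+1 c ->
  (b ** c).2`_(n + m).+1 = b.1`_n.+1 * c.2`_m + b.2`_n * c.1`_m.+1.
Proof.
move=> /andP[h1 h2] /andP[h3 h4]; rewrite /bmul /= coefD -coefM_top // -coefM_top //.
by rewrite addSn addnS.
Qed.

(** The conic has no rational point at infinity, as A is not a square; so leading terms never cancel
    in a norm. *)
Lemma bnorm_const b : (size (bnorm A C b) <= 1)%N -> bdeg_le 0 b.
Proof.
move=> sb; have [n] := bdeg_le_exists b; elim: n => // n IH hn; apply: IH.
have hc : bdeg_le n.+1 (bconj b) by case/andP: hn => h1 h2; rewrite /bdeg_le /= size_polyN h1.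
have : (bnorm A C b)`_(n.+1 + n.+1) = 0 by move/leq_sizeP: sb => ->.
have -> : bnorm A C b = (b ** bconj b).1 by rewrite /bnorm /bmul /=; ring.
rewrite (bmul_top1 hn hc) /= coefN => e.
have e' : b.1`_n.+1 ^+ 2 = A * b.2`_n ^+ 2 by apply/eqP; rewrite -subr_eq0; apply/eqP; rewrite -[RHS]e; ring.
case: (eqVneq (b.2`_n) 0) => [h|h].
  apply: bdeg_le_drop => //; apply/eqP; move: e'; rewrite h !expr2 !mulr0 => /eqP.
  by rewrite mulf_eq0 orbb.
have := A_nonsquare (b.1`_n.+1 / b.2`_n).
by rewrite expr_div_n e' mulfK ?eqxx // expf_neq0.
Qed.

(** The same at infinity over E(sqrt A), where x i remains a nonsquare; this is
    [biquadratic_relation] for the leading coefficients. *)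
Lemma pnorm_const i b c : bdeg_le 0 (pnorm (x i) b c) -> bdeg_le 0 b /\ bdeg_le 0 c.
Proof.
move=> hN; have [n hb hc] : exists2 n, bdeg_le n b & bdeg_le n c.
  have [n /andP[h1 h2]] := bdeg_le_exists b; have [m /andP[h3 h4]] := bdeg_le_exists c.
  by exists (maxn n m); rewrite /bdeg_le; lia.
elim: n hb hc => // n IH hb hc.
case/andP: hN => /leq_sizeP hN1 /leq_sizeP hN2.
have e1 : (pnorm (x i) b c).1`_(n.+1 + n.+1) = 0 by apply: hN1; lia.
have e2 : (pnorm (x i) b c).2`_(n + n).+1 = 0 by apply: hN2.
rewrite /pnorm /= coefB coefZ !bmul_top1 // in e1.
rewrite /pnorm /= coefB coefZ !bmul_top2 // in e2.
have [] := @biquadratic_relation E A (x i) (b.1`_n.+1) (b.2`_n) (c.1`_n.+1) (c.2`_n).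
- exact: x_nonsquareE.
- exact: Ax_nonsquare.
- apply: (mulfI two_neq0); apply/eqP; rewrite -subr_eq0; apply/eqP; rewrite -[RHS]e2; ring.
- apply/eqP; rewrite -subr_eq0; apply/eqP; rewrite -[RHS]e1; ring.
by move=> b1 b2 c1 c2; apply: IH; apply: bdeg_le_drop.
Qed.

Lemma bdeg_le0E b : bdeg_le 0 b -> bv b = j b.1`_0.
Proof.
case/andP => /size1_polyC h1; rewrite leqn0 size_poly_eq0 => /eqP h.
by rewrite /bev h rmorph0 horner0 mul0r addr0 {1}h1 map_polyC hornerC.
Qed.

(** Induction on the degree of the norm of g. At a closed point where g vanishes, g^2 is divisible
    by D^2 for a generator D of its ideal, and D^2 is split off the right-hand side without changing
    the types of the factors. *)
Lemma conic_norm_descent (s : E) (g : B) (P Q : 'I_4 -> B) : s != 0 -> g != 0 ->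
  j s * bv g ^+ 2 = \prod_i (bv (P i) ^+ 2 - j (x i) * bv (Q i) ^+ 2) ->
  exists (g0 : E) (p q : 'I_4 -> E), g0 != 0 /\
    s * g0 ^+ 2 = \prod_i (p i ^+ 2 - x i * q i ^+ 2).
Proof.
move=> s0; have [n] := ubnP (size (bnorm A C g)).
elim: n g P Q => // n IH g P Q sg g0 e.
pose N4 (P0 Q0 : 'I_4 -> B) i := pnorm (x i) (P0 i) (Q0 i).
pose NN := N4 P Q.
pose i1 : 'I_4 := lift ord0 ord0; pose i2 : 'I_4 := lift ord0 (lift ord0 ord0).
pose i3 : 'I_4 := lift ord0 (lift ord0 (lift ord0 ord0)).
pose pr4 (M : 'I_4 -> B) := M ord0 ** (M i1 ** (M i2 ** M i3)).
pose pr := pr4 NN.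
have prE M (R : fieldType) (f : {rmorphism E -> R}) v1 w1 (h : w1 ^+ 2 = f A * v1 ^+ 2 + f C) :
    bev f v1 w1 (pr4 M) = \prod_i bev f v1 w1 (M i).
  by rewrite /pr4 !(bevM h) !big_ord_recl big_ord0 mulr1.
have eB : s *: (g ** g) = pr.
  apply: bvP; rewrite bevZ (bevM hw) -expr2 e (prE _ _ _ _ _ hw).
  by apply: eq_bigr => i _; rewrite /NN (bev_pnorm _ _ _ hw).
(* If the norm of g is constant, then so are g, the four norms and all P i and Q i, and the relation
   already lies in E. *)
case: (leqP (size (bnorm A C g)) 1) => [sg1|sg1].
  have gc := bnorm_const sg1.
  have nz b : b != 0 -> bnorm A C b != 0 by apply: contra_neq => /(bnorm_eq0 A_nonsquare).
  have NNc i : bdeg_le 0 (NN i).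
    apply: bnorm_const.
    have dv : bnorm A C (NN i) %| bnorm A C pr.
      rewrite /pr /pr4 !bnormM.
      case: (unliftP ord0 i) => [m1 ->|->]; last by rewrite dvdp_mulIl.
      rewrite dvdp_mull //; case: (unliftP ord0 m1) => [m2 ->|->]; last by rewrite dvdp_mulIl.
      rewrite dvdp_mull //; case: (unliftP ord0 m2) => [m3 ->|->]; last by rewrite dvdp_mulIl.
      by rewrite (ord1 m3) dvdp_mulIr.
    have prn : bnorm A C pr = (s ^+ 2) *: (bnorm A C g * bnorm A C g).
      by rewrite -eB -bnormM /bnorm /= -!mul_polyC polyCM; ring.
    have g1 : size (bnorm A C g) = 1%N by apply/eqP; rewrite eqn_leq sg1 size_poly_gt0 nz.
    have spr : (size (bnorm A C pr) <= 1)%N.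
      by rewrite prn (leq_trans (size_scale_leq _ _)) // size_mul ?nz // g1.
    apply: leq_trans spr; apply: dvdp_leq => //.
    by rewrite prn scaler_eq0 expf_eq0 (negPf s0) mulf_eq0 orbb nz.
  exists (g.1`_0), (fun i => (P i).1`_0), (fun i => (Q i).1`_0); split.
    by rewrite -(fmorph_eq0 j) -(bdeg_le0E gc) bv_eq0.
  apply: (fmorph_inj j); rewrite rmorphM rmorphXn -(bdeg_le0E gc) e rmorph_prod.
  apply: eq_bigr => i _; have [h1 h2] := pnorm_const (NNc i).
  by rewrite (bdeg_le0E h1) (bdeg_le0E h2) !(rmorphB, rmorphXn, rmorphM).
have [k [v0 [w0 [hw0 evg]]]] := exists_point sg1.
pose ev := bev (in_alg k) v0 w0.
have evN i : ev (NN i) = ev (P i) ^+ 2 - in_alg k (x i) * ev (Q i) ^+ 2.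
  exact: bev_pnorm.
(* One step of the descent: divide [g] by a generator of the ideal of the point. *)
have finish D P' Q' : point_generator v0 w0 D ->
    \prod_i (bv (P i) ^+ 2 - j (x i) * bv (Q i) ^+ 2) =
    bv D ^+ 2 * \prod_i (bv (P' i) ^+ 2 - j (x i) * bv (Q' i) ^+ 2) ->
    exists (g0 : E) (p q : 'I_4 -> E), g0 != 0 /\
      s * g0 ^+ 2 = \prod_i (p i ^+ 2 - x i * q i ^+ 2).
  move=> [D0 evD genD] eD; have [g' gE] := genD g evg.
  have [g'0 sg'] := bnorm_mul_lt hw0 D0 evD g0 gE.
  apply: (IH g' P' Q') => //; first by apply: leq_trans sg' _; rewrite -ltnS.
  have vD0 : bv D ^+ 2 != 0 by rewrite expf_neq0 ?bv_eq0.
  by apply: (mulfI vD0); rewrite -eD -e gE (bevM hw); ring.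
have upd i (c d : B) : exists P' Q' : 'I_4 -> B,
    [/\ P' i = c, Q' i = d & forall l, l != i -> P' l = P l /\ Q' l = Q l].
  exists (fun l => if l == i then c else P l), (fun l => if l == i then d else Q l).
  by rewrite !eqxx; split=> // l /negPf ->.
have prod_ev : \prod_i ev (NN i) = 0.
  rewrite -(prE NN _ _ _ _ hw0) -[pr4 NN]/pr -eB bevZ (bevM hw0).
  by have -> : bev (in_alg k) v0 w0 g = 0 by []; rewrite !mulr0.
have [i /eqP evi] : exists i, ev (NN i) == 0.
  by move/eqP: prod_ev; rewrite prodf_seq_eq0 => /hasP[i _ /andP[_ h]]; exists i.
have rootQ l : ev (NN l) = 0 -> ev (Q l) = 0 -> ev (P l) = 0.
  move=> h hQ; move: h; rewrite evN hQ [0 ^+ 2]expr2 !mulr0 subr0 => /eqP.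
  by rewrite expf_eq0 => /eqP.
(* If some P l and Q l vanish together, both are divisible by D and factor l gives up D^2 at
   once. *)
have [[l [hl1 hl2]]|ncom] := classic (exists l, ev (P l) = 0 /\ ev (Q l) = 0).
  have [D gD] := generator0 hw0; have [D0 evD gen] := gD.
  have [P1 eP] := gen _ hl1; have [Q1 eQ] := gen _ hl2.
  have [P' [Q' [h1 h2 h3]]] := upd l P1 Q1.
  apply: (finish D P' Q') => //.
  rewrite (bigD1 l) //= [X in _ = _ * X](bigD1 l) //= h1 h2 eP eQ !(bevM hw).
  rewrite [X in _ * X = _](eq_bigr (fun m => bv (P' m) ^+ 2 - j (x m) * bv (Q' m) ^+ 2)); first by ring.
  by move=> m /h3[-> ->].
(* Without a common zero, the quotient of P l and Q l gives a square root of x l in the residue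
   field. *)
have rt l : ev (NN l) = 0 -> exists xi, [/\ xi \in <<<<1; v0>>; w0>>%VS,
    xi ^+ 2 = in_alg k (x l) & ev (P l) = - xi * ev (Q l)].
  move=> h; have Q0 : ev (Q l) != 0.
    by apply/eqP => hQ; apply: ncom; exists l; split=> //; apply: rootQ.
  exists (- ev (P l) / ev (Q l)); split.
  - by rewrite rpredM ?rpredN ?rpredV ?mem_ev.
  - move: h; rewrite evN => /eqP; rewrite subr_eq0 => /eqP h.
    by rewrite expr_div_n sqrrN h mulfK // expf_neq0.
  - by field.
have [xi [xin hxi hP]] := rt i evi.
(* If two factors vanish, D is chosen as a norm of both types and each factor gives up one D. *)
have [[l [li evl]]|uniq_i] := classic (exists l, l != i /\ ev (NN l) = 0).
  have [eta [etain heta hPl]] := rt l evl.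
  have il : i != l by rewrite eq_sym.
  have [a1 [a2 [c1 [c2 [gD eD ea ec]]]]] := generator2 hw0 il xin etain hxi heta.
  have [p1 [q1 e1]] := divide_by_generator hw0 hxi gD ea hP.
  have gD' := gD; rewrite eD in gD'.
  have [p2 [q2 e2]] := divide_by_generator hw0 heta gD' ec hPl.
  pose P' m := if m == i then p1 else if m == l then p2 else P m.
  pose Q' m := if m == i then q1 else if m == l then q2 else Q m.
  apply: (finish _ P' Q' gD).
  rewrite (bigD1 i) //= (bigD1 l) //= [X in _ = _ * X](bigD1 i) //= [X in _ = _ * (_ * X)](bigD1 l) //=.
  rewrite /P' /Q' !eqxx (negPf li) e1 e2 -eD.
  rewrite [X in _ * (_ * X) = _](eq_bigr (fun m => bv (P' m) ^+ 2 - j (x m) * bv (Q' m) ^+ 2)); first by rewrite /P' /Q'; ring.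
  by move=> m /andP[/negPf h1 /negPf h2]; rewrite /P' /Q' h1 h2.
(* If only factor i vanishes, it gives up one D. The surplus D on the left then makes the quotient
   vanish at the point again, so a second D comes off. *)
have [r1 [r2 [gD ea]]] := generator1 hw0 xin hxi.
have [p1 [q1 e1]] := divide_by_generator hw0 hxi gD ea hP.
set D := pnorm (x i) r1 r2 in gD e1.
have [D0 evD genD] := gD; have [g' gE] := genD g evg.
have vD0 : bv D != 0 by rewrite bv_eq0.
have [P' [Q' [h1 h2 h3]]] := upd i p1 q1.
have e3 : j s * (bv D * bv g' ^+ 2) = \prod_m (bv (P' m) ^+ 2 - j (x m) * bv (Q' m) ^+ 2).
  apply: (mulfI vD0); move: e; rewrite (bigD1 i) //= e1 gE (bevM hw) => e.
  rewrite (bigD1 i) //= h1 h2 mulrA; transitivity (j s * (bv D * bv g') ^+ 2); first by ring.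
  rewrite e -mulrA; congr (_ * (_ * _)); apply: eq_bigr => m mi.
  by have [-> ->] := h3 m mi.
have e4 : s *: (D ** (g' ** g')) = pr4 (N4 P' Q').
  apply: bvP; rewrite (prE (N4 P' Q') _ _ _ _ hw) bevZ !(bevM hw) -expr2 e3.
  by apply: eq_bigr => m _; rewrite /N4 (bev_pnorm _ _ _ hw).
have : ev (N4 P' Q' i) = 0.
  have := congr1 ev e4; rewrite /ev bevZ (bevM hw0) evD mul0r mulr0 (prE _ _ _ _ _ hw0).
  move=> /esym/eqP; rewrite (bigD1 i) //= mulf_eq0 => /orP[/eqP //|].
  rewrite prodf_seq_eq0 => /hasP[m _ /andP[mi /eqP evm]]; case: uniq_i; exists m; split=> //.
  by move: evm; rewrite /ev /NN /N4; have [-> ->] := h3 m mi.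
rewrite /N4 h1 h2 /ev (bev_pnorm _ _ _ hw0).
have hz : (in_alg k : {rmorphism E -> k}) (x i) = xi ^+ 2 by rewrite hxi.
rewrite hz -exprMn => /eqP; rewrite subr_eq0 eqf_sqr => hpq.
(* The quotient vanishes with the root xi or - xi; a change of sign of q1 keeps its norm and selects
   the root for which D was built. *)
have [q2 [eq2 evq2]] : exists q2, bv q2 ^+ 2 = bv q1 ^+ 2 /\ ev p1 = - xi * ev q2.
  case/orP: hpq => /eqP h; last by exists q1; rewrite mulNr.
  by exists (- q1); rewrite bevN sqrrN /ev bevN mulNr mulrN opprK.
have [p3 [q3 e5]] := divide_by_generator hw0 hxi gD ea evq2.
have [P'' [Q'' [h1' h2' h3']]] := upd i p3 q3.
apply: (finish D P'' Q'') => //.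
rewrite (bigD1 i) //= [X in _ = _ * X](bigD1 i) //= h1' h2' e1 -eq2 e5.
rewrite [X in _ * X = _](eq_bigr (fun m => bv (P'' m) ^+ 2 - j (x m) * bv (Q'' m) ^+ 2)); first by ring.
by move=> m /h3'[-> ->].
Qed.
End Descent.

(** * Products of norms in rational function fields *)

Section NormProducts.
Variables (k : fieldType) (x : 'I_4 -> k).

(** The factor [g ^+ 2] makes this a property of square classes; it is multiplicative and holds for
    every nonzero square. *)
Definition norm_product (f : k) : Prop := f != 0 /\
  exists (g : k) (p q : 'I_4 -> k), g != 0 /\
    f * g ^+ 2 = \prod_i (p i ^+ 2 - x i * q i ^+ 2).

Lemma norm_productM f f' : norm_product f -> norm_product f' -> norm_product (f * f').
Proof.
move=> [f0 [g [p [q [g0 e]]]]] [f0' [g' [p' [q' [g0' e']]]]]; split; first exact: mulf_neq0.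
exists (g * g'), (fun i => p i * p' i + x i * (q i * q' i)), (fun i => p i * q' i + q i * p' i).
split; first exact: mulf_neq0.
transitivity (f * g ^+ 2 * (f' * g' ^+ 2)); first by ring.
by rewrite e e' -big_split; apply: eq_bigr => i _ /=; ring.
Qed.

Lemma norm_product_sqr f : f != 0 -> norm_product (f ^+ 2).
Proof.
move=> f0; split; first exact: expf_neq0.
exists f^-1, (fun=> 1), (fun=> 0); split; first by rewrite invr_eq0.
rewrite -exprMn divff // expr1n big1 // => i _; ring.
Qed.

Lemma norm_product_norm i (p q : k) : p ^+ 2 - x i * q ^+ 2 != 0 ->
  norm_product (p ^+ 2 - x i * q ^+ 2).
Proof.
move=> n0; split=> //; exists 1, (fun l => if l == i then p else 1), (fun l => if l == i then q else 0).
split; first exact: oner_neq0.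
rewrite expr1n mulr1 (bigD1 i) //= eqxx big1 ?mulr1 // => l /negPf ->; ring.
Qed.

Lemma norm_product_div f g : norm_product (f * g) -> norm_product g -> norm_product f.
Proof.
move=> h1 h2; have [h0 _] := h2.
have -> : f = f * g * g * (g^-1) ^+ 2 by field.
by apply: norm_productM; [apply: norm_productM | apply: norm_product_sqr; rewrite invr_eq0].
Qed.
End NormProducts.

Lemma norm_product_morph (k k' : fieldType) (h : {rmorphism k -> k'}) x f :
  norm_product x f -> norm_product (h \o x) (h f).
Proof.
move=> [f0 [g [p [q [g0 e]]]]]; split; first by rewrite fmorph_eq0.
exists (h g), (h \o p), (h \o q); rewrite fmorph_eq0; split=> //.
rewrite -rmorphXn -rmorphM e rmorph_prod; apply: eq_bigr => i _.
by rewrite !(rmorphB, rmorphXn, rmorphM).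
Qed.

(** * Norms and valuations in the field of fractions of k[X] *)

Section FractionField.
Variables (k Fr : fieldType) (tf : {rmorphism {poly k} -> Fr}).
Local Notation R := {poly k}.
Local Notation cst := (tf \o polyC).
Hypothesis tf_inj : forall p, tf p = 0 -> p = 0.
Hypothesis tf_frac : forall f, exists n d, d != 0 /\ f = tf n / tf d.

Lemma tf_eq0 p : (tf p == 0) = (p == 0).
Proof. by apply/eqP/eqP => [/tf_inj //|->]; rewrite rmorph0. Qed.

Lemma tf_eq p q : tf p = tf q -> p = q.
Proof.
by move=> h; apply/eqP; rewrite -subr_eq0; apply/eqP/tf_inj; rewrite rmorphB h subrr.
Qed.

Lemma common_denominator (s : seq Fr) :
  exists D : R, D != 0 /\ forall f, f \in s -> exists A : R, f = tf A / tf D.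
Proof.
elim: s => [|f s [D [D0 IH]]]; first by exists 1; rewrite oner_neq0.
have [n [d [d0 ->]]] := tf_frac f; exists (D * d); split; first exact: mulf_neq0.
have tD : tf D != 0 by rewrite tf_eq0.
have td : tf d != 0 by rewrite tf_eq0.
move=> g; rewrite inE => /orP[/eqP ->|/IH[A ->]].
  by exists (n * D); rewrite !rmorphM; field; rewrite tD td.
by exists (A * d); rewrite !rmorphM; field; rewrite tD td.
Qed.

Section DivisorsAreNorms.
Variable x : k.
Hypotheses (x0 : x != 0) (two_neq0 : (2%:R : k) != 0).

(* If x is a square modulo p, then (r^2 - x) / p has smaller degree and the same property. *)
Lemma divisor_norm (p r : R) : p != 0 -> p %| r ^+ 2 - x%:P ->
  exists (e : k) (P Q : Fr), [/\ e != 0, P ^+ 2 - cst x * Q ^+ 2 != 0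
    & cst e * tf p = P ^+ 2 - cst x * Q ^+ 2].
Proof.
have [n] := ubnP (size p); elim: n p r => // n IH p r sp p0 pr.
have tp0 : tf p != 0 by rewrite tf_eq0.
have cE e : cst e = tf e%:P by [].
case: (leqP (size p) 1) => [s1|s2].
  have pE := size1_polyC s1; set c := p`_0 in pE.
  have c0 : c != 0 by apply: contra_neq p0 => h; rewrite pE h polyC0.
  have e1 : cst c^-1 * tf p = 1.
    by rewrite pE -cE -rmorphM mulVf // rmorph1.
  have e2 : 1 ^+ 2 - cst x * 0 ^+ 2 = 1 :> Fr by ring.
  by exists c^-1, 1, 0; rewrite e1 e2 invr_eq0 c0 oner_neq0.
pose r' := r %% p.
have pr' : p %| r' ^+ 2 - x%:P.
  have -> : r' ^+ 2 - x%:P = r ^+ 2 - x%:P - p * ((r %/ p) * (r + r')).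
    by rewrite /r'; move: (r %/ p) (r %% p) (divp_eq r p) => q y ->; ring.
  by rewrite dvdp_sub // dvdp_mulr.
(* If x is the square of r', the norm form splits and represents p by ((p + 1) / 2)^2 - x ((p - 1) /
   (2 r'))^2. *)
case: (eqVneq (r' ^+ 2 - x%:P) 0) => [e|T0].
  have cx : cst x = tf r' ^+ 2.
    by rewrite cE -rmorphXn; congr (tf _); apply/eqP; rewrite eq_sym -subr_eq0 e.
  have tr0 : tf r' != 0.
    apply: contra_neq x0 => h; have hx : cst x = 0 by rewrite cx h expr2 mul0r.
    by apply/eqP; move/eqP: hx; rewrite fmorph_eq0.
  have t2 : (2%:R : Fr) != 0 by rewrite -(rmorph_nat cst) fmorph_eq0.
  exists 1, ((tf p + 1) / 2%:R), ((tf p - 1) / (2%:R * tf r')).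
  have eq : ((tf p + 1) / 2%:R) ^+ 2 - cst x * ((tf p - 1) / (2%:R * tf r')) ^+ 2 = tf p.
    by rewrite cx; field; rewrite tr0 t2.
  by rewrite eq oner_neq0 tp0 rmorph1 mul1r.
have /dvdpP[q Tq] := pr'; have q0 : q != 0 by apply: contra_neq T0 => h; rewrite Tq h mul0r.
have sq : (size q < size p)%N.
  have s3 : (size r' < size p)%N by rewrite ltn_modp.
  have s4 : (size (r' ^+ 2 - x%:P)%R <= maxn (2 * (size p).-1).-1 1)%N.
    rewrite (leq_trans (size_polyD _ _)) // size_polyN geq_max; apply/andP; split.
      rewrite expr2 (leq_trans (size_polyMleq _ _)) //.
      by move: (size r') (size p) s2 s3 => y z; lia.
    by rewrite (leq_trans (size_polyC_leq1 _)) // leq_maxr.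
  move: s4; rewrite Tq size_mul //; move: (size q) (size p) s2 => y z; lia.
have [|||e [P [Q [e0 N0 eN]]]] := IH q r'; rewrite ?(leq_trans sq) //.
  by rewrite Tq dvdp_mulIl.
set N := P ^+ 2 - _ in N0 eN.
have eT : tf p * tf q = tf r' ^+ 2 - cst x.
  by rewrite -rmorphM mulrC -Tq cE rmorphB rmorphXn.
have ce0 : cst e != 0 by rewrite fmorph_eq0.
have tq : tf q = (cst e)^-1 * N by rewrite -eN mulKf.
(* Norms are multiplicative: p is the norm r'^2 - x divided by q, and q is a norm up to the constant
   e by induction. *)
have eq : (tf r' * P + cst x * Q) / N * ((tf r' * P + cst x * Q) / N)
   - cst x * ((tf r' * Q + P) / N) ^+ 2 = cst e^-1 * tf p.
  transitivity ((tf r' ^+ 2 - cst x) / N).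
    by move: N0; rewrite /N => N0; field.
  by rewrite -eT tq fmorphV; field; rewrite ce0.
exists e^-1, ((tf r' * P + cst x * Q) / N), ((tf r' * Q + P) / N).
by rewrite -expr2 in eq; rewrite eq invr_eq0 e0 mulf_neq0 // fmorph_eq0 invr_eq0.
Qed.
End DivisorsAreNorms.

Lemma irreducible_multiplicity (p s : R) : irreducible_poly p -> s != 0 ->
  exists m s', s = p ^+ m * s' /\ ~~ (p %| s').
Proof.
move=> [p1 _]; have [n] := ubnP (size s); elim: n s => // n IH s sn s0.
case: (boolP (p %| s)) => [/dvdpP[q e]|h]; last by exists 0%N, s; rewrite expr0 mul1r.
have q0 : q != 0 by apply: contra_neq s0 => h; rewrite e h mul0r.
have p0 : p != 0 by rewrite -size_poly_gt0 ltnW.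
have [||m [s' [e' hs']]] := IH q => //.
  by move: sn; rewrite e size_mul //; move: (size q) (size p) p1 => y z; lia.
by exists m.+1, s'; rewrite e e' exprS; split=> //; ring.
Qed.

Lemma irreducible_dvdpM (p a b : R) : irreducible_poly p -> p %| a * b -> (p %| a) || (p %| b).
Proof.
move=> irr h; case: (boolP (p %| a)) => //= na.
have cop : coprimep p a.
  case: irr => _ irr; apply: contraR na => /irr/(_ (dvdp_gcdl p a))/andP[_ h'].
  exact: dvdp_trans h' (dvdp_gcdr p a).
by rewrite Gauss_dvdpr in h.
Qed.

Section Factor.
Variable x : 'I_4 -> k.
Hypotheses (x0 : forall i, x i != 0) (two_neq0 : (2%:R : k) != 0).

(** Irreducible factors of even multiplicity contribute squares and those of odd multiplicity
    contribute norms by [divisor_norm], each up to a constant. *)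
Lemma norm_product_poly (s : R) : s != 0 ->
  (forall p m s', irreducible_poly p -> s = p ^+ m * s' -> ~~ (p %| s') -> odd m ->
     exists i r, p %| r ^+ 2 - (x i)%:P) ->
  exists2 e : k, e != 0 & norm_product (cst \o x) (cst e * tf s).
Proof.
have [n] := ubnP (size s); elim: n s => // n IH s sn s0 hs.
have ce (e : k) : e != 0 -> cst e != 0 by rewrite fmorph_eq0.
case: (leqP (size s) 1) => [s1|s2].
  have pE := size1_polyC s1; set c := s`_0 in pE.
  have c0 : c != 0 by apply: contra_neq s0 => h; rewrite pE h polyC0.
  exists c; rewrite // pE -[tf c%:P]/(cst c) -expr2; apply: norm_product_sqr; exact: ce.
have [p irr ps] := exists_irreducible_factor s2.
have [m [s' [e ns']]] := irreducible_multiplicity irr s0.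
have p0 : p != 0 by case: irr => h _; rewrite -size_poly_gt0 ltnW.
have s'0 : s' != 0 by apply: contra_neq s0 => h; rewrite e h mulr0.
have tp0 : tf p != 0 by rewrite tf_eq0.
have es : tf s = tf p ^+ m * tf s' by rewrite e rmorphM rmorphXn.
have m0 : (0 < m)%N.
  by case: m {es} e => // e; move: ns'; rewrite -(mul1r s') -(expr0 p) -e ps.
have [||e' e'0 ne'] := IH s' _ s'0.
- have : (1 < size (p ^+ m))%N.
    by rewrite -(prednK m0) exprS size_mul ?expf_neq0 //; case: irr => h _; have : (0 < size (p ^+ m.-1))%N; [rewrite size_poly_gt0 expf_neq0 | move: (size _) (size _) h => y z; lia].
  by move: sn; rewrite e size_mul ?expf_neq0 //; move: (size _) (size _) => y z; lia.
(* An irreducible p' of odd multiplicity in s' has the same multiplicity in s: if it divided a power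
   of p, it would be associate to p, which does not divide s'. *)
- move=> p' m' s'' irr' e'' ns'' om; apply: (hs p' m' (p ^+ m * s'')) => //.
    by rewrite e e''; ring.
  apply/negP => /(irreducible_dvdpM irr'); rewrite (negPf ns'') orbF => h.
  have pp : p' %| p.
    elim: (m) h => [|l IHl]; first by rewrite expr0 dvdp1; case: irr' => h1 _ /eqP h2; rewrite h2 in h1.
    by rewrite exprS => /(irreducible_dvdpM irr')/orP[].
  have : p' %= p by case: irr => _; apply => //; case: irr' => h1 _; rewrite neq_ltn h1 orbT.
  case/andP => _ pp'; case/negP: ns'; rewrite e''; apply: dvdp_trans pp' _.
  by case: m' {e''} om => // l _; rewrite exprS -mulrA dvdp_mulIl.
have sqp l : norm_product (cst \o x) (tf p ^+ (2 * l)).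
  by rewrite mulnC exprM; apply: norm_product_sqr; rewrite expf_neq0.
case: (boolP (odd m)) => om.
  have [i [r pr]] := hs p m s' irr e ns' om.
  have [e1 [P [Q [e10 N0 eN]]]] := divisor_norm (x0 i) two_neq0 p0 pr.
  exists (e1 * e'); first exact: mulf_neq0.
  have -> : cst (e1 * e') * tf s = (cst e1 * tf p) * (cst e' * tf s') * tf p ^+ (2 * m./2).
    rewrite es rmorphM -{1}(odd_double_half m) om add1n exprS -muln2 mulnC.
    by ring.
  apply: norm_productM => //; apply: norm_productM => //.
  by rewrite eN; apply: (@norm_product_norm _ (cst \o x) i).
exists e' => //.
have -> : cst e' * tf s = (cst e' * tf s') * tf p ^+ (2 * m./2).
  rewrite es -{1}(odd_double_half m) (negPf om) add0n -muln2 mulnC.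
  by ring.
exact: norm_productM.
Qed.
End Factor.

Section Leading.
Variables (p : R) (L : fieldExtType k) (th : L).
Hypothesis p_irr : irreducible_poly p.
Hypothesis p_root : root (map_poly (in_alg L) p) th.
Local Notation ev := (fun q : R => (map_poly (in_alg L) q).[th]).

Lemma evM (q q' : R) : ev (q * q') = ev q * ev q'.
Proof. by rewrite /= rmorphM hornerM. Qed.

Lemma evD (q q' : R) : ev (q + q') = ev q + ev q'.
Proof. by rewrite /= rmorphD hornerD. Qed.

Lemma ev_eq0 (q : R) : (ev q == 0) = (p %| q).
Proof.
apply/idP/idP => [h|/dvdpP[y ->]]; last by rewrite evM (eqP p_root) mulr0.
apply: contraLR h => nq.
have cop : coprimep p q.
  case: p_irr => _ irr; apply: contraR nq => /irr/(_ (dvdp_gcdl p q))/andP[_ h'].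
  exact: dvdp_trans h' (dvdp_gcdr p q).
have [[y z] /= e] := Bezout_eq1_coprimepP _ _ cop.
have := congr1 (fun q : R => ev q) e; rewrite evD !evM (eqP p_root) mulr0 add0r /= rmorph1 hornerC => e'.
by apply/eqP => h; have := oner_neq0 L; rewrite -e' h mulr0 eqxx.
Qed.

(** The p-adic valuation n of f together with the residue z of f / p^n; as a relation it needs no
    convention at 0. *)
Definition leading (f : Fr) (n : int) (z : L) : Prop :=
  exists A B : R, [/\ ev A != 0, ev B != 0, f = tf p ^ n * (tf A / tf B) & z = ev A / ev B].

Lemma p_neq0 : p != 0.
Proof. by case: p_irr => h _; rewrite -size_poly_gt0 ltnW. Qed.

Lemma tp_neq0 : tf p != 0.
Proof. by rewrite tf_eq0 p_neq0. Qed.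

Lemma tf_ev_neq0 (q : R) : ev q != 0 -> tf q != 0.
Proof. by rewrite tf_eq0; apply: contra_neq => ->; rewrite /= rmorph0 horner0. Qed.

Lemma leading_neq0 f n z : leading f n z -> f != 0 /\ z != 0.
Proof.
move=> [A [B [A0 B0 -> ->]]]; have tA := tf_ev_neq0 A0; have tB := tf_ev_neq0 B0.
by rewrite !mulf_neq0 ?invr_eq0 // expfz_neq0 // tp_neq0.
Qed.

Lemma leading_exists f : f != 0 -> exists n z, leading f n z.
Proof.
have [a [b [b0 ->]]] := tf_frac f; rewrite mulf_eq0 invr_eq0 !tf_eq0 (negPf b0) orbF => a0.
have [m [a' [ea na]]] := irreducible_multiplicity p_irr a0.
have [l [b' [eb nb]]] := irreducible_multiplicity p_irr b0.
rewrite -ev_eq0 in na; rewrite -ev_eq0 in nb.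
exists (m%:Z - l%:Z), (ev a' / ev b'), a', b'; split=> //.
rewrite ea eb !rmorphM !rmorphXn expfzDr ?tp_neq0 // -exprnP -exprnN.
by have tb := tf_ev_neq0 nb; field; rewrite tb /= expf_neq0 // tp_neq0.
Qed.

Lemma leading_mul f g n m y z : leading f n y -> leading g m z -> leading (f * g) (n + m) (y * z).
Proof.
move=> [A [B [A0 B0 -> ->]]] [A' [B' [A0' B0' -> ->]]]; exists (A * A'), (B * B').
rewrite !evM !mulf_neq0 //; split=> //; last by rewrite mulf_div.
rewrite expfzDr ?tp_neq0 // !rmorphM; move: (tf p ^ n) (tf p ^ m) => t1 t2.
by have h1 := tf_ev_neq0 B0; have h2 := tf_ev_neq0 B0'; field; rewrite h1 h2.
Qed.

Lemma leading_uniq_le f n m y z : leading f n y -> leading f m z -> (n <= m)%R -> n = m /\ y = z.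
Proof.
move=> [A [B [A0 B0 e1 ->]]] [A' [B' [A0' B0' e2 ->]]] nm.
have [d dE] : exists d : nat, m = n + d%:Z by exists `|m - n|%N; lia.
have tB := tf_ev_neq0 B0; have tB' := tf_ev_neq0 B0'.
have e : A * B' = p ^+ d * (A' * B).
  apply: tf_eq; rewrite !rmorphM rmorphXn.
  have pn : tf p ^ n != 0 by rewrite expfz_neq0 // tp_neq0.
  apply: (mulfI pn); move: e1; rewrite e2 dE expfzDr ?tp_neq0 // -exprnP => e1.
  transitivity (tf p ^ n * (tf A / tf B) * (tf B * tf B')); first by field.
  by rewrite -e1; field.
have e' := congr1 (fun q : R => ev q) e; rewrite !evM in e'.
case: d dE e e' => [dE e e'|d dE e e'].
  split; first by rewrite dE addr0.
  move: e'; rewrite expr0 /= rmorph1 hornerC mul1r => e'.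
  by apply/eqP; rewrite eqr_div //; apply/eqP.
move: e'; rewrite exprS evM (eqP p_root) !mul0r => /eqP.
by rewrite mulf_eq0 (negPf A0) (negPf B0').
Qed.

Lemma leading_uniq f n m y z : leading f n y -> leading f m z -> n = m /\ y = z.
Proof.
move=> h1 h2; case: (lerP n m) => h; first exact: leading_uniq_le h1 h2 h.
by have [] := leading_uniq_le h2 h1 (ltW h); move=> -> ->.
Qed.

Lemma leading_add f g n m y z : leading f n y -> leading g m z -> (n < m)%R -> leading (f + g) n y.
Proof.
move=> [A [B [A0 B0 -> ->]]] [A' [B' [A0' B0' -> _]]] nm.
have [d dE] : exists d : nat, m = n + d.+1%:Z by exists `|m - n|%N.-1; lia.
exists (A * B' + p ^+ d.+1 * (A' * B)), (B * B').
have e : ev (A * B' + p ^+ d.+1 * (A' * B)) = ev A * ev B'.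
  by rewrite evD !evM exprS evM (eqP p_root) !mul0r addr0.
rewrite e !evM !mulf_neq0 //; split=> //; last by field; rewrite B0 B0'.
rewrite dE expfzDr ?tp_neq0 // -exprnP rmorphD !rmorphM !rmorphXn.
move: (tf p ^ n) => t; have h1 := tf_ev_neq0 B0; have h2 := tf_ev_neq0 B0'.
by field; rewrite h1 h2.
Qed.

Lemma leading_const (c : k) : c != 0 -> leading (cst c) 0 (in_alg L c).
Proof.
move=> c0; exists c%:P, 1; split.
- by rewrite map_polyC hornerC fmorph_eq0.
- by rewrite rmorph1 hornerC oner_neq0.
- by rewrite expr0z mul1r rmorph1 divr1.
- by rewrite map_polyC rmorph1 !hornerC divr1.
Qed.

(* If S has odd valuation, then each factor e + u^2 S either
   has valuation 0 and residue e or has odd valuation and residue that of S, up to squares. *)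
Lemma leading_term S n s u e : leading S n s -> (exists t, n = 2 * t + 1) -> e != 0 ->
  exists l y, leading (u ^+ 2 * S + cst e) l y /\
   ((l = 0 /\ y = in_alg L e) \/ ((exists t, l = 2 * t + 1) /\ exists2 h, h != 0 & y = s * h ^+ 2)).
Proof.
move=> lS [t nE] e0; have le := leading_const e0.
case: (eqVneq u 0) => [->|u0].
  by exists 0, (in_alg L e); rewrite expr2 !mul0r add0r; split=> //; left.
have [m [z lu]] := leading_exists u0.
have luS := leading_mul (leading_mul lu lu) lS; rewrite -expr2 in luS.
have [_ z0] := leading_neq0 lu.
case: (ltrP (m + m + n) 0) => h.
  exists (m + m + n), (z * z * s); split; first exact: leading_add luS le h.
  right; split; first by exists (m + t); lia.
  by exists z => //; rewrite expr2 mulrC.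
exists 0, (in_alg L e); split; last by left.
rewrite addrC; apply: leading_add le luS _; lia.
Qed.

Lemma odd_valuation_square (a b c : k) (S u v w : Fr) n s :
  a != 0 -> b != 0 -> c != 0 ->
  w ^+ 2 = (S + cst a) * (u ^+ 2 * S + cst b) * (v ^+ 2 * S + cst c) ->
  leading S n s -> (exists t, n = 2 * t + 1) ->
  exists2 x, x \in [:: a; b; c; a * b * c] & exists z : L, z ^+ 2 = in_alg L x.
Proof.
move=> a0 b0 c0 e lS on; have [_ s0] := leading_neq0 lS.
have [l1 [y1 [h1 c1]]] := leading_term 1 lS on a0.
have [l2 [y2 [h2 c2]]] := leading_term u lS on b0.
have [l3 [y3 [h3 c3]]] := leading_term v lS on c0.
rewrite expr1n mul1r in h1.
have h := leading_mul (leading_mul h1 h2) h3; rewrite -e in h.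
have w0 : w != 0 by have [] := leading_neq0 h; rewrite expf_eq0.
have [m [z lw]] := leading_exists w0.
have [e1 e2] := leading_uniq (leading_mul lw lw) h.
have done1 x y : x \in [:: a; b; c; a * b * c] -> y != 0 -> z * z = in_alg L x * y ^+ 2 ->
    exists2 x, x \in [:: a; b; c; a * b * c] & exists z : L, z ^+ 2 = in_alg L x.
  by move=> xin y0 ez; exists x => //; exists (z / y); rewrite expr_div_n expr2 ez mulfK // expf_neq0.
(* Parity, through [lia], discards the cases with an odd number of factors of odd valuation. In the
   remaining ones the residue s of S occurs twice or not at all. *)
case: c1 => [[l10 y1E]|[[t1 l1E] [g1 g10 y1E]]]; case: c2 => [[l20 y2E]|[[t2 l2E] [g2 g20 y2E]]];
  case: c3 => [[l30 y3E]|[[t3 l3E] [g3 g30 y3E]]]; try (exfalso; lia).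
- apply: (done1 (a * b * c) 1); rewrite ?inE ?eqxx ?orbT ?oner_neq0 //.
  by rewrite e2 y1E y2E y3E !rmorphM expr1n mulr1.
- apply: (done1 a (s * g2 * g3)); rewrite ?inE ?eqxx ?orbT ?mulf_neq0 //.
  by rewrite e2 y1E y2E y3E; ring.
- apply: (done1 b (s * g1 * g3)); rewrite ?inE ?eqxx ?orbT ?mulf_neq0 //.
  by rewrite e2 y1E y2E y3E; ring.
- apply: (done1 c (s * g1 * g2)); rewrite ?inE ?eqxx ?orbT ?mulf_neq0 //.
  by rewrite e2 y1E y2E y3E; ring.
Qed.
End Leading.
End FractionField.

(** * The class of a solution S in a purely transcendental field *)

Section SolutionClass.
Variables (K : fieldType) (a b c : K).
Hypotheses (a0 : a != 0) (b0 : b != 0) (c0 : c != 0) (two_neq0 : (2%:R : K) != 0).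
Hypothesis K_infinite : forall n, exists2 s : seq K, uniq s & size s = n.

Definition norm_types (i : 'I_4) : K := nth 0 [:: a; b; c; a * b * c] i.

(** The point is that d comes from K: with d in k the choice d = S would always do, and over K
    itself this is how the induction starts. *)
Definition class_is_constant (k : fieldType) (j : {rmorphism K -> k}) : Prop :=
  forall S u v w : k, S != 0 ->
  w ^+ 2 = (S + j a) * (u ^+ 2 * S + j b) * (v ^+ 2 * S + j c) ->
  exists2 d : K, d != 0 & norm_product (j \o norm_types) (j d * S).

Lemma norm_types_neq0 i : norm_types i != 0.
Proof. by case: i => -[|[|[|[|i]]]] hi //=; rewrite ?mulf_neq0. Qed.

Lemma class_is_constant_base : class_is_constant idfun.
Proof. by move=> S u v w S0 _; exists S; rewrite //= -expr2; apply: norm_product_sqr. Qed.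

Lemma exists_nonroot (k : fieldType) (j : {rmorphism K -> k}) (q : {poly k}) :
  q != 0 -> exists t, q.[t] != 0.
Proof.
move=> q0; have [s us ss] := K_infinite (size q); apply: NNPP => h.
have := @max_poly_roots _ q (map j s) q0; rewrite size_map ss ltnn.
have -> : uniq (map j s) by rewrite map_inj_uniq //; apply: fmorph_inj.
have -> // : all (root q) (map j s).
  by apply/allP => t _; apply/negPn/negP => ht; apply: h; exists t.
by move/(_ isT isT).
Qed.

Section Step.
Variables (k Fr : fieldType) (j : {rmorphism K -> k}) (tf : {rmorphism {poly k} -> Fr}).
Hypothesis tf_inj : forall p, tf p = 0 -> p = 0.
Hypothesis tf_frac : forall f, exists n d, d != 0 /\ f = tf n / tf d.
Local Notation cst := (tf \o polyC).
Local Notation xk := (j \o norm_types).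

(** The first half of the step: S becomes a product of norms up to a constant of k, because the
    irreducible factors of odd multiplicity in S make some x i a square in their residue field. *)
Lemma class_constant_over_base (S u v w : Fr) : S != 0 ->
  w ^+ 2 = (S + cst (j a)) * (u ^+ 2 * S + cst (j b)) * (v ^+ 2 * S + cst (j c)) ->
  exists2 d : k, d != 0 & norm_product (cst \o xk) (cst d * S).
Proof.
move=> S0 e; have [N [D [D0 SE]]] := tf_frac S.
have tD : tf D != 0 by rewrite (tf_eq0 tf_inj).
have N0 : N != 0 by apply: contra_neq S0 => h; rewrite SE h rmorph0 mul0r.
have j0 (y : K) : y != 0 -> j y != 0 by rewrite fmorph_eq0.
have [||||d d0 nd] := @norm_product_poly _ _ _ tf_inj xk _ _ (N * D).
- by move=> i; apply/j0/norm_types_neq0.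
- by rewrite -(rmorph_nat j) j0.
- exact: mulf_neq0.
- move=> p m s' irr es ns' om.
  have [L _ [th rt full]] := irredp_FAdjoin irr.
  have [n [s lS]] := leading_exists tf_inj tf_frac irr rt S0.
  (* The polynomial N D is S D^2, so its multiplicity m at p has the parity of the valuation of
     S. *)
  have on : exists t, n = 2 * t + 1.
    have lD := leading_exists tf_inj tf_frac irr rt tD; have [l [y lD']] := lD.
    have h1 := leading_mul tf_inj irr (leading_mul tf_inj irr lS lD') lD'.
    have e1 : S * tf D * tf D = tf (N * D) by rewrite SE divfK // rmorphM.
    rewrite e1 es in h1.
    have h2 : leading tf p th (tf (p ^+ m * s')) m%:Z (map_poly (in_alg L) s').[th].
      exists s', 1; rewrite rmorph1 hornerC oner_neq0 (ev_eq0 irr rt) ns'; split=> //.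
        by rewrite rmorphM rmorphXn -exprnP rmorph1 divr1.
      by rewrite divr1.
    have [e2 _] := leading_uniq tf_inj irr rt h1 h2.
    by exists (m./2%:Z - l); move: (odd_double_half m); rewrite om; lia.
  have [y yin [z hz]] := odd_valuation_square tf_inj tf_frac irr rt (j0 _ a0) (j0 _ b0) (j0 _ c0) e lS on.
  have [i hi] : exists i, y = xk i.
    move: yin; rewrite !inE => /or4P[]/eqP ->; [exists (inord 0)|exists (inord 1)|exists (inord 2)|exists (inord 3)];
    by rewrite /= /norm_types inordK // ?rmorphM.
  have : z \in <<1; th>>%VS by rewrite full memvf.
  case/Fadjoin_polyP => q /polyOver1P[r ->] zE.
  exists i, r; rewrite -(ev_eq0 irr rt) rmorphB rmorphXn /= map_polyC hornerD hornerN horner_exp hornerC.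
  by rewrite -zE hz hi subrr.
exists d => //; apply: (norm_product_div (g := tf D ^+ 2)); last exact: norm_product_sqr.
by move: nd; rewrite rmorphM SE; congr norm_product; rewrite /=; field.
Qed.

(** The variable is specialized to a value t in k. The value of S is a solution over k, hence of
    class d1 from K, and it is also of class d by specializing the norm relation; so d and d1 agree
    up to norms and d1 serves for S. *)
Lemma class_is_constant_step : class_is_constant j -> class_is_constant (cst \o j).
Proof.
move=> Pk S u v w S0 e.
have [d d0 [dS0 [g [p [q [g0 eN]]]]]] := class_constant_over_base S0 e.
have [D [D0 hD]] := common_denominator tf_inj tf_frac
  ([:: S; u; v; w; g] ++ codom p ++ codom q).
have [S' SE] := hD S (mem_head _ _).
have [u' uE] : exists A, u = tf A / tf D by apply: hD; rewrite !inE eqxx orbT.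
have [v' vE] : exists A, v = tf A / tf D by apply: hD; rewrite !inE eqxx !orbT.
have [w' wE] : exists A, w = tf A / tf D by apply: hD; rewrite !inE eqxx !orbT.
have [g' gE] : exists A, g = tf A / tf D by apply: hD; rewrite !inE eqxx !orbT.
have [p' pE] : exists p' : 'I_4 -> {poly k}, forall i, p i = tf (p' i) / tf D.
  have h i : exists A, p i = tf A / tf D by apply: hD; rewrite !mem_cat codom_f orbT.
  exists (fun i => proj1_sig (ClassicalEpsilon.constructive_indefinite_description _ (h i))) => i.
  by case: (ClassicalEpsilon.constructive_indefinite_description _ (h i)).
have [q' qE] : exists q' : 'I_4 -> {poly k}, forall i, q i = tf (q' i) / tf D.
  have h i : exists A, q i = tf A / tf D by apply: hD; rewrite !mem_cat codom_f !orbT.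
  exists (fun i => proj1_sig (ClassicalEpsilon.constructive_indefinite_description _ (h i))) => i.
  by case: (ClassicalEpsilon.constructive_indefinite_description _ (h i)).
have tD : tf D != 0 by rewrite (tf_eq0 tf_inj).
have nz f A : f != 0 -> f = tf A / tf D -> A != 0.
  by move=> f0 fE; apply: contra_neq f0 => h; rewrite fE h rmorph0 mul0r.
have S'0 := nz _ _ S0 SE; have g'0 := nz _ _ g0 gE.
have [t ht] : exists t, (D * S' * g').[t] != 0.
  by apply: (exists_nonroot j); rewrite !mulf_neq0.
rewrite !hornerM !mulf_eq0 !negb_or in ht; case/andP: ht => /andP[Dt St] gt.
(* The equation multiplied by D^7: the three factors on the right take D, D^3 and D^3. *)
have e1 : w' ^+ 2 * D ^+ 5 = (S' + (j a)%:P * D) * (u' ^+ 2 * S' + (j b)%:P * D ^+ 3)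
    * (v' ^+ 2 * S' + (j c)%:P * D ^+ 3).
  apply: (tf_eq tf_inj); rewrite !(rmorphM, rmorphD, rmorphXn).
  have := e; rewrite /= SE uE vE wE => e'.
  transitivity ((tf w' / tf D) ^+ 2 * tf D ^+ 7); first by field.
  by rewrite e'; field.
(* The relation multiplied by D^8, a factor D^2 for each of the four norms. *)
have e2 : d%:P * S' * g' ^+ 2 * D ^+ 5 = \prod_i (p' i ^+ 2 - (xk i)%:P * q' i ^+ 2).
  apply: (tf_eq tf_inj); rewrite rmorph_prod.
  have -> : \prod_i tf (p' i ^+ 2 - (xk i)%:P * q' i ^+ 2) =
     \prod_i ((p i ^+ 2 - cst (xk i) * q i ^+ 2) * tf D ^+ 2).
    apply: eq_bigr => i _; rewrite pE qE !(rmorphB, rmorphM, rmorphXn) /=; by field.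
  rewrite big_split /= -eN prodr_const card_ord SE gE !(rmorphM, rmorphXn) /=; by field.
pose h (A : {poly k}) := A.[t] / D.[t].
have [||d1 d10 nd1] := Pk (h S') (h u') (h v') (h w').
- by rewrite mulf_neq0 // invr_eq0.
- have := congr1 (horner^~ t) e1; rewrite !(hornerM, hornerD, horner_exp, hornerC) /h => e1'.
  transitivity (w'.[t] ^+ 2 * D.[t] ^+ 5 / D.[t] ^+ 7); first by field.
  by rewrite e1'; field.
exists d1 => //.
have nd : norm_product xk (d * h S').
  split; first by rewrite !mulf_neq0 ?invr_eq0.
  exists (h g'), (fun i => h (p' i)), (fun i => h (q' i)); split; first by rewrite mulf_neq0 ?invr_eq0.
  have := congr1 (horner^~ t) e2; rewrite horner_prod !(hornerM, horner_exp, hornerC) => e2'.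
  have -> : \prod_i (h (p' i) ^+ 2 - xk i * h (q' i) ^+ 2) =
      \prod_i ((p' i ^+ 2 - (xk i)%:P * q' i ^+ 2).[t] * (D.[t]^-1) ^+ 2).
    apply: eq_bigr => i _; rewrite /h !(hornerD, hornerN, hornerM, horner_exp, hornerC); by field.
  rewrite big_split /= -e2' prodr_const card_ord /h; by field.
have ndd : norm_product xk (j d1 * d).
  apply: (norm_product_div (g := h S' ^+ 2)); last by apply: norm_product_sqr; rewrite mulf_neq0 ?invr_eq0.
  have := norm_productM nd1 nd; congr norm_product; ring.
have ncd := norm_product_morph cst ndd.
apply: (norm_product_div (g := cst d ^+ 2)); last by apply: norm_product_sqr; rewrite fmorph_eq0.
have nS : norm_product (cst \o xk) (cst d * S) by split=> //; exists g, p, q.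
have := norm_productM ncd nS; congr norm_product; rewrite rmorphM /=; ring.
Qed.
End Step.
End SolutionClass.

(** In a finite field every nonzero square has at most two roots, so there are at most twice as many
    units as nonzero squares, whereas the cosets of 1, a and b are disjoint. *)
Lemma infinite_of_square_classes (K : fieldType) (a b : K) :
  (forall e, e ^+ 2 != a) -> (forall e, e ^+ 2 != b) -> (forall e, e ^+ 2 != a * b) ->
  forall n, exists2 s : seq K, uniq s & size s = n.
Proof.
move=> na nb nab; apply: NNPP => nfin.
have [e0 he0] : exists e0 : seq K, forall z, z \in e0.
  have [n hn] : exists n, forall s : seq K, uniq s -> (size s < n)%N.
    apply: NNPP => h; apply: nfin => n; apply: NNPP => h'; apply: h.
    exists n => s us; rewrite ltnNge; apply/negP => hs; apply: h'.
    by exists (take n s); rewrite ?take_uniq // size_takel.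
  apply: NNPP => h.
  suff [s us /(congr1 (leq n))] : exists2 s : seq K, uniq s & size s = n.
    by rewrite leqnn leqNgt hn.
  elim: (n) => [|m [s us ss]]; first by exists [::].
  have [z zs] : exists z, z \notin s.
    by apply: NNPP => h'; apply: h; exists s => z; apply/negPn/negP => zs; apply: h'; exists z.
  by exists (z :: s); rewrite /= ?zs ?us ?ss.
have a0 : a != 0 by apply/eqP => h; have := na 0; rewrite h expr2 mul0r eqxx.
have b0 : b != 0 by apply/eqP => h; have := nb 0; rewrite h expr2 mul0r eqxx.
pose U := [seq z <- undup e0 | z != 0].
have uU : uniq U by rewrite filter_uniq ?undup_uniq.
have memU z : (z \in U) = (z != 0) by rewrite mem_filter mem_undup he0 andbT.
pose sq := undup [seq z ^+ 2 | z <- U].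
have memsq z : reflect (exists2 y, y != 0 & z = y ^+ 2) (z \in sq).
  rewrite mem_undup; apply: (iffP mapP) => -[y h ->]; exists y => //; rewrite ?memU // -memU //.
pose cos t := [seq t * z | z <- sq].
have ucos t : t != 0 -> uniq (cos t).
  by move=> t0; rewrite map_inj_uniq ?undup_uniq //; apply: mulfI.
have scos t : size (cos t) = size sq by rewrite size_map.
have memcos t z : z \in cos t -> exists2 y, y != 0 & z = t * y ^+ 2.
  by move=> /mapP[z' /memsq[y y0 ->] ->]; exists y.
have u3 : uniq (sq ++ cos a ++ cos b).
  rewrite !cat_uniq undup_uniq !ucos // andbT /=; apply/andP; split.
    apply/hasPn => z; rewrite mem_cat => /orP[]/memcos[y y0 ->]; apply/negP => /memsq[t t0 e].
      by have := na (t / y); rewrite expr_div_n -e mulfK ?eqxx // expf_neq0.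
    by have := nb (t / y); rewrite expr_div_n -e mulfK ?eqxx // expf_neq0.
  apply/hasPn => z /memcos[y y0 ->]; apply/negP => /memcos[t t0 e].
  have /eqP[] := nab (a * t / y).
  transitivity (a * (a * t ^+ 2) / y ^+ 2); first by field.
  by rewrite -e; field.
have s3 : (size (sq ++ cos a ++ cos b) <= size U)%N.
  apply: uniq_leq_size => // z; rewrite !mem_cat memU => /or3P[/memsq[y y0 ->]|/memcos[y y0 ->]|/memcos[y y0 ->]];
  by rewrite ?mulf_neq0 ?expf_neq0.
have [r hr] : exists r : K -> K, forall z, z \in sq -> r z ^+ 2 = z.
  have h z : exists y, z \in sq -> y ^+ 2 = z.
    by case: (boolP (z \in sq)) => [/memsq[y _ ->]|_]; [exists y|exists 0].
  exists (fun z => proj1_sig (constructive_indefinite_description _ (h z))) => z zs.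
  by case: constructive_indefinite_description => /= y; apply.
have s2 : (size U <= size ([seq r z | z <- sq] ++ [seq - r z | z <- sq]))%N.
  apply: uniq_leq_size => // z; rewrite memU => z0.
  have zs : z ^+ 2 \in sq by apply/memsq; exists z.
  have /eqP := hr _ zs; rewrite eqf_sqr mem_cat => /orP[]/eqP h; apply/orP; [left|right]; apply/mapP;
  by exists (z ^+ 2); rewrite // h ?opprK.
have s1 : (0 < size sq)%N.
  have : 1 \in sq by apply/memsq; exists 1; rewrite ?oner_neq0 ?expr1n.
  by case: (sq).
move: s3 s2; rewrite !size_cat !size_map; move: (size sq) (size U) s1 => y z; lia.
Qed.

(** Kummer theory by hand. In t = P + Q eta the cross term 2 P Q must vanish, which reduces the
    question to E(xi), and there the same argument applies. *)
Lemma square_in_biquadratic (E : fieldType) (k : fieldExtType E) (x y z : E) (xi eta t : k) :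
  (2%:R : E) != 0 -> xi ^+ 2 = in_alg k x -> eta ^+ 2 = in_alg k y ->
  t \in <<<<1; xi>>; eta>>%VS -> t ^+ 2 = in_alg k z ->
  (forall e, e ^+ 2 != z) -> (forall e, e ^+ 2 != z * x) -> (forall e, e ^+ 2 != z * y) ->
  (forall e, e ^+ 2 != z * x * y) -> False.
Proof.
move=> two0 hxi heta tin ht nz nzx nzy nzxy.
pose ia : {rmorphism E -> k} := in_alg k.
have k2 : (2%:R : k) != 0 by rewrite -(rmorph_nat ia) fmorph_eq0.
have hx : ia x = xi ^+ 2 by rewrite hxi.
have hy : ia y = eta ^+ 2 by rewrite heta.
have hz : ia z = t ^+ 2 by rewrite ht.
have quad s z' : (forall e, e ^+ 2 != z') -> (forall e, e ^+ 2 != z' * x) ->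
    s \in <<1; xi>>%VS -> s ^+ 2 = ia z' -> False.
  move=> n1 n2 sin hs; have [c0 [c1 sE]] := mem_quadratic_adjoin hxi sin.
  have {}sE : s = ia c0 + ia c1 * xi by [].
  have e : ia (2%:R * c0 * c1) * xi = ia (z' - c0 ^+ 2 - c1 ^+ 2 * x).
    by rewrite !(rmorphB, rmorphXn, rmorphM, rmorph_nat) -hs hx sE; ring.
  case: (eqVneq (c0 * c1) 0) => [/eqP|n0].
    rewrite mulf_eq0 => /orP[]/eqP h; move: hs; rewrite sE h ?rmorph0 ?add0r ?mul0r ?addr0.
      rewrite exprMn -hx -rmorphXn -rmorphM => /fmorph_inj h'.
      have := n2 (c1 * x); rewrite -h' => /eqP[]; ring.
    by rewrite -rmorphXn => /fmorph_inj h'; have := n1 c0; rewrite h' eqxx.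
  have m0 : 2%:R * c0 * c1 != 0 by rewrite -mulrA mulf_neq0.
  have xiE : xi = ia ((z' - c0 ^+ 2 - c1 ^+ 2 * x) / (2%:R * c0 * c1)).
    by rewrite fmorph_div -e mulrC mulKf // fmorph_eq0.
  have := n1 (c0 + c1 * ((z' - c0 ^+ 2 - c1 ^+ 2 * x) / (2%:R * c0 * c1))).
  by rewrite -(inj_eq (fmorph_inj ia)) rmorphXn rmorphD rmorphM -xiE -sE hs eqxx.
have [p pK tE] := Fadjoin_polyP tin.
have [P [Q [Pin Qin {}tE]]] : exists P Q, [/\ P \in <<1; xi>>%VS, Q \in <<1; xi>>%VS & t = P + Q * eta].
  rewrite tE; elim/poly_ind: p pK {tE} => [_|p c IH pK].
    by exists 0, 0; rewrite horner0 mul0r addr0 rpred0.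
  have pK' : p \is a polyOver <<1; xi>>%VS.
    by apply/polyOverP => i; have := polyOverP pK i.+1; rewrite coefD coefMX coefC /= addr0.
  have cin : c \in <<1; xi>>%VS.
    by have := polyOverP pK 0; rewrite coefD coefMX coefC /= add0r.
  have [P [Q [Pin Qin e]]] := IH pK'.
  exists (Q * ia y + c), P; split => //.
    by rewrite rpredD ?rpredM // rpredZ ?rpred1.
  by rewrite hornerD hornerM hornerX hornerC e hy; ring.
case: (boolP (eta \in <<1; xi>>%VS)) => [ein|nein].
  apply: (quad t z nz nzx) => //.
  by rewrite tE rpredD // rpredM.
have e : 2%:R * P * Q * eta = ia z - P ^+ 2 - ia y * Q ^+ 2 by rewrite hz hy tE; ring.
have /eqP : P * Q = 0.
  apply/eqP; apply: contraNT nein => n0.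
  have -> : eta = (ia z - P ^+ 2 - ia y * Q ^+ 2) / (2%:R * P * Q).
    by rewrite -e mulrC mulKf // -mulrA mulf_neq0.
  rewrite rpredM ?rpredV ?rpredB ?rpredM ?rpredX ?rpredZ ?rpred1 //.
  by rewrite rpred_nat.
rewrite mulf_eq0 => /orP[]/eqP h; move: hz; rewrite tE h ?add0r ?mul0r ?addr0 => hz.
  apply: (quad (Q * ia y) (z * y)) => //.
  - by move=> e'; rewrite -mulrA [y * x]mulrC mulrA.
  - by rewrite rpredM ?rpredZ ?rpred1.
  - by rewrite rmorphM hz hy; ring.
exact: (quad P z nz nzx).
Qed.

(** Infinite descent at X = r. The factor X - r divides W; then r V(r)^2 + c T(r)^2 = 0, which
    forces V(r) = T(r) = 0 as -r c is not a square, and all three polynomials can be divided by X -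
    r. *)
Lemma conic_pencil_anisotropic (k : fieldType) (r c : k) (h W V T : {poly k}) :
  c != 0 -> (forall t, t ^+ 2 != - r * c) -> h.[r] != 0 ->
  W ^+ 2 = ('X - r%:P) * h * ('X * V ^+ 2 + c%:P * T ^+ 2) -> V = 0 /\ T = 0.
Proof.
move=> c0 nrc hr; have [n] := ubnP (size V + size T).
elim: n W V T => // n IH W V T sn e.
have X0 : 'X - r%:P != 0 by rewrite polyXsubC_eq0.
have dv (q : {poly k}) : q.[r] = 0 -> exists q', q = ('X - r%:P) * q'.
  by move=> h0; have /factor_theorem[q' ->] : root q r; [apply/eqP | exists q'; rewrite mulrC].
have Wr : W.[r] = 0.
  have := congr1 (horner^~ r) e; rewrite horner_exp !hornerM hornerXsubC subrr !mul0r => /eqP.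
  by rewrite expf_eq0 => /eqP.
have [W1 W1E] := dv _ Wr.
have e1 : ('X - r%:P) * W1 ^+ 2 = h * ('X * V ^+ 2 + c%:P * T ^+ 2).
  by apply: (mulfI X0); rewrite [RHS]mulrA -e W1E; ring.
have e2 : r * V.[r] ^+ 2 + c * T.[r] ^+ 2 = 0.
  have := congr1 (horner^~ r) e1; rewrite !hornerM hornerXsubC subrr !mul0r => /esym/eqP.
  by rewrite mulf_eq0 (negPf hr) /= hornerD !hornerM hornerX hornerC -!expr2 => /eqP.
have Vr : V.[r] = 0.
  apply/eqP/negPn/negP => V0; have := nrc (c * T.[r] / V.[r]).
  move/eqP; apply.
  have e3 : c * T.[r] ^+ 2 = - r * V.[r] ^+ 2 by apply/eqP; rewrite -subr_eq0 -e2; apply/eqP; ring.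
  rewrite expr_div_n exprMn expr2 -mulrA e3; field; exact: V0.
have Tr : T.[r] = 0.
  by move/eqP: e2; rewrite Vr expr2 mulr0 mulr0 add0r mulf_eq0 (negPf c0) expf_eq0 => /eqP.
have [V1 VE] := dv _ Vr; have [T1 TE] := dv _ Tr.
case: (eqVneq (V, T) (0, 0)) => [[-> ->] //|VT].
have [||V10 T10] := IH W1 V1 T1.
- have sz (q q' : {poly k}) : q = ('X - r%:P) * q' -> q != 0 -> (size q' < size q)%N.
    move=> -> q0; have q'0 : q' != 0 by apply: contra_neq q0 => ->; rewrite mulr0.
    by rewrite size_mul // size_XsubC add2n.
  have sle (q q' : {poly k}) : q = ('X - r%:P) * q' -> (size q' <= size q)%N.
    case: (eqVneq q 0) => [-> /esym/eqP|q0 /sz/(_ q0)/ltnW //].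
    by rewrite mulf_eq0 (negPf X0) => /eqP ->.
  have h1 := sle _ _ VE; have h2 := sle _ _ TE.
  case: (eqVneq V 0) => [V0|V0].
    have T0 : T != 0 by apply: contra_neq VT => ->; rewrite V0.
    by have h3 := sz _ _ TE T0; move: (size V) (size V1) (size T) (size T1) h1 h2 h3 sn => *; lia.
  by have h3 := sz _ _ VE V0; move: (size V) (size V1) (size T) (size T1) h1 h2 h3 sn => *; lia.
- by apply: (mulfI X0); rewrite e1 VE TE; ring.
by rewrite VE TE V10 T10 mulr0.
Qed.

(** * Purely transcendental fields as iterated fraction fields *)

Section Towers.
Variables (K F : fieldType) (iota : {rmorphism K -> F}).

Lemma adjoin_finite (T : F -> Prop) f : adjoin iota T f ->
  exists l : seq F, (forall g, g \in l -> T g) /\ adjoin iota (in_list l) f.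
Proof.
have mono l1 l2 g : {subset l1 <= l2} -> adjoin iota (in_list l1) g -> adjoin iota (in_list l2) g.
  by move=> h; apply: adjoin_sub => y /h yl; apply: adjoin_gen.
have cat2 g g' : (exists l, (forall g, g \in l -> T g) /\ adjoin iota (in_list l) g) ->
    (exists l, (forall g, g \in l -> T g) /\ adjoin iota (in_list l) g') ->
    exists l, (forall g, g \in l -> T g) /\ (adjoin iota (in_list l) g /\ adjoin iota (in_list l) g').
  move=> [l1 [h1 h2]] [l2 [h3 h4]]; exists (l1 ++ l2); split.
    by move=> y; rewrite mem_cat => /orP[/h1|/h3].
  by split; [apply: mono h2 | apply: mono h4] => y hy; rewrite mem_cat hy ?orbT.
elim=> [k|g Tg|g g' _ h1 _ h2|g _ [l [h1 h2]]|g g' _ h1 _ h2|g _ [l [h1 h2]]].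
- by exists [::]; split=> //; apply: adjoin_base.
- exists [:: g]; split; first by move=> y; rewrite inE => /eqP ->.
  by apply: adjoin_gen; rewrite /in_list inE.
- by have [l [h3 [h4 h5]]] := cat2 _ _ h1 h2; exists l; split=> //; apply: adjoin_add.
- by exists l; split=> //; apply: adjoin_opp.
- by have [l [h3 [h4 h5]]] := cat2 _ _ h1 h2; exists l; split=> //; apply: adjoin_mul.
- by exists l; split=> //; apply: adjoin_inv.
Qed.

Lemma adjoin_finite_seq (T : F -> Prop) (s : seq F) : (forall f, f \in s -> adjoin iota T f) ->
  exists l : seq F, [/\ uniq l, forall g, g \in l -> T g & forall f, f \in s -> adjoin iota (in_list l) f].
Proof.
elim: s => [|f s IH] hs; first by exists [::].
have [g gs|l [ul lT hl]] := IH; first by apply: hs; rewrite inE gs orbT.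
have [l' [lT' hl']] := adjoin_finite (hs f (mem_head _ _)).
exists (undup (l ++ l')); rewrite undup_uniq; split=> //.
  by move=> g; rewrite mem_undup mem_cat => /orP[/lT|/lT'].
move=> g; rewrite inE => /orP[/eqP ->|/hl]; [apply: adjoin_sub hl'|apply: adjoin_sub] => y hy;
by apply: adjoin_gen; rewrite /in_list in hy *; rewrite mem_undup mem_cat hy ?orbT.
Qed.

Section Extend.
Variables (k : fieldType) (phi : {rmorphism k -> F}) (t : F).
Hypothesis t_trans : forall p : {poly k}, (map_poly phi p).[t] = 0 -> p = 0.

Lemma extend_fraction : exists psi : {rmorphism {fraction {poly k}} -> F},
  forall p, psi (FracField.tofrac p) = (map_poly phi p).[t].
Proof.
pose ev : {rmorphism {poly k} -> F} := (horner_eval t \o map_poly phi).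
exact: (@frac_ext_exists _ _ ev t_trans).
Qed.
End Extend.

Definition tf_of (k : fieldType) : {rmorphism {poly k} -> {fraction {poly k}}} := @FracField.tofrac _.

Lemma tf_of_inj k p : tf_of k p = 0 -> p = 0.
Proof. by move/eqP; rewrite /tf_of tofrac_eq0 => /eqP. Qed.

Lemma transcendental_over l (k : fieldType) (phi : {rmorphism k -> F}) t :
  (forall z, adjoin iota (in_list l) (phi z)) -> ~ alg_over iota (in_list l) t ->
  forall p : {poly k}, (map_poly phi p).[t] = 0 -> p = 0.
Proof.
move=> h nt p e; apply: NNPP => /eqP p0; apply: nt.
apply: (@alg_overP _ _ _ _ (map_poly phi p)); first by rewrite map_poly_eq0.
  by move=> i; rewrite coef_map; apply: h.
exact/eqP.
Qed.

Lemma extend_tower l t (k : fieldType) (phi : {rmorphism k -> F})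
    (psi : {rmorphism {fraction {poly k}} -> F}) :
  (forall f, adjoin iota (in_list l) f <-> exists z, phi z = f) ->
  (forall p, psi (tf_of k p) = (map_poly phi p).[t]) ->
  forall f, adjoin iota (in_list (rcons l t)) f <-> exists z, psi z = f.
Proof.
move=> im hpsi f.
have psiC c : psi (tf_of k c%:P) = phi c by rewrite hpsi map_polyC hornerC.
have psiX : psi (tf_of k 'X) = t by rewrite hpsi map_polyX hornerX.
have sub g : adjoin iota (in_list l) g -> adjoin iota (in_list (rcons l t)) g.
  by apply: adjoin_sub => y yl; apply: adjoin_gen; rewrite /in_list in yl *; rewrite mem_rcons inE yl orbT.
split.
  elim=> [c|g|g g' _ [z <-] _ [z' <-]|g _ [z <-]|g g' _ [z <-] _ [z' <-]|g _ [z <-]].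
  - have /im[z hz] := adjoin_base iota (in_list l) c.
    by exists (tf_of k z%:P); rewrite psiC.
  - rewrite /in_list mem_rcons inE => /orP[/eqP ->|gl]; first by exists (tf_of k 'X).
    have /im[z hz] := @adjoin_gen _ _ iota (in_list l) g gl.
    by exists (tf_of k z%:P); rewrite psiC.
  - by exists (z + z'); rewrite rmorphD.
  - by exists (- z); rewrite rmorphN.
  - by exists (z * z'); rewrite rmorphM.
  - by exists z^-1; rewrite fmorphV.
have pin p : adjoin iota (in_list (rcons l t)) (psi (tf_of k p)).
  rewrite hpsi; elim/poly_ind: p => [|p c IH]; first by rewrite rmorph0 horner0; apply: adjoin0.
  rewrite rmorphD rmorphM /= map_polyX map_polyC hornerD hornerM hornerX hornerC.
  apply: adjoin_add; first apply: adjoin_mul => //.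
    by apply: adjoin_gen; rewrite /in_list mem_rcons inE eqxx.
  by apply: sub; apply/im; exists c.
move=> [z <-]; have [n [d [_ ->]]] := fracP z; rewrite fmorph_div.
by apply: adjoin_div; apply: pin.
Qed.

Lemma adjoin_no_generator f : adjoin iota (in_list [::]) f <-> exists z, iota z = f.
Proof.
split; last by move=> [z <-]; apply: adjoin_base.
elim=> [c|g //|g g' _ [z <-] _ [z' <-]|g _ [z <-]|g g' _ [z <-] _ [z' <-]|g _ [z <-]].
- by exists c.
- by exists (z + z'); rewrite rmorphD.
- by exists (- z); rewrite rmorphN.
- by exists (z * z'); rewrite rmorphM.
- by exists z^-1; rewrite fmorphV.
Qed.

(** K(l) is rebuilt as an abstract tower of fraction fields, with one use of
    [class_is_constant_step] for each member of l; phi embeds the tower into F with image K(l). *)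
Lemma class_tower (a b c : K) l : a != 0 -> b != 0 -> c != 0 -> (2%:R : K) != 0 ->
  (forall n, exists2 s : seq K, uniq s & size s = n) -> seq_indep iota (@no_gen F) l ->
  exists (k : fieldType) (j : {rmorphism K -> k}) (phi : {rmorphism k -> F}),
    [/\ phi \o j =1 iota, forall f, adjoin iota (in_list l) f <-> exists z, phi z = f
      & class_is_constant a b c j].
Proof.
move=> a0 b0 c0 two0 inf; elim/last_ind: l => [_|l t IH /seq_indep_rcons[/IH]].
  exists K, idfun, iota; split=> //; first exact: adjoin_no_generator.
  exact: class_is_constant_base.
move=> [k [j [phi [h1 h2 h3]]]] nt.
have tr := @transcendental_over l k phi t (fun z => proj2 (h2 _) (ex_intro _ z erefl)) nt.
have [psi hpsi] := extend_fraction tr.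
exists {fraction {poly k}}, ((tf_of k \o polyC) \o j), psi; split.
- by move=> z /=; rewrite hpsi map_polyC hornerC -[RHS]h1.
- exact: extend_tower h2 hpsi.
- apply: class_is_constant_step => //; first exact: (@tf_of_inj k).
  exact: fracP.
Qed.
End Towers.

(** An even [size] means an odd degree, while the square of a fraction has even degree. *)
Lemma odd_degree_nonsquare (k Fr : fieldType) (tf : {rmorphism {poly k} -> Fr})
    (q : {poly k}) (f : Fr) :
  (forall p, tf p = 0 -> p = 0) -> (forall f, exists n d, d != 0 /\ f = tf n / tf d) ->
  q != 0 -> ~~ odd (size q) -> f ^+ 2 != tf q.
Proof.
move=> inj fr q0 oq; apply/eqP => e; have [n [d [d0 fE]]] := fr f.
have td : tf d != 0 by rewrite (tf_eq0 inj).
have e' : n ^+ 2 = d ^+ 2 * q.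
  apply: (tf_eq inj); rewrite !(rmorphXn, rmorphM) -e fE expr_div_n mulrC divfK //.
  exact: expf_neq0.
have n0 : n != 0.
  by apply: contra_neq (mulf_neq0 (expf_neq0 2 d0) q0) => h; rewrite -e' h expr2 mul0r.
have := congr1 (fun p : {poly k} => odd (size p)) e'; rewrite !expr2 !size_mul ?mulf_neq0 //.
have : (0 < size d)%N by rewrite size_poly_gt0.
have : (0 < size n)%N by rewrite size_poly_gt0.
have : (0 < size q)%N by rewrite size_poly_gt0.
by move: oq; move: (size n) (size d) (size q) => x y z; lia.
Qed.

(** The leading terms of P^2 and x Q^2 cannot cancel, so the degree is even and the [size] odd. *)
Lemma size_norm_odd (k : fieldType) (x : k) (P Q : {poly k}) : (forall e, e ^+ 2 != x) ->
  P ^+ 2 - x%:P * Q ^+ 2 != 0 -> odd (size (P ^+ 2 - x%:P * Q ^+ 2)).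
Proof.
move=> nx; have x0 : x != 0 by apply/eqP => h; have := nx 0; rewrite h expr2 mul0r eqxx.
case: (eqVneq Q 0) => [->|Q0]; case: (eqVneq P 0) => [->|P0].
- by rewrite !expr2 !mulr0 subr0 eqxx.
- rewrite [0 ^+ 2]expr2 !mulr0 subr0 expr2 size_mul // => _.
  by rewrite -size_poly_gt0 in P0; move: (size P) P0 => y; lia.
- rewrite [0 ^+ 2]expr2 mulr0 sub0r size_polyN mul_polyC size_scale // expr2 size_mul // => _.
  by rewrite -size_poly_gt0 in Q0; move: (size Q) Q0 => y; lia.
move=> _; have sP : (0 < size P)%N by rewrite size_poly_gt0.
have sQ : (0 < size Q)%N by rewrite size_poly_gt0.
have sP2 : size (P ^+ 2) = (size P + size P).-1 by rewrite expr2 size_mul.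
have sQ2 : size (x%:P * Q ^+ 2) = (size Q + size Q).-1.
  by rewrite mul_polyC size_scale // expr2 size_mul.
case: (ltngtP (size P) (size Q)) => h.
- by rewrite addrC size_polyDl size_polyN ?sP2 ?sQ2; move: (size P) (size Q) sP sQ h => y z; lia.
- by rewrite size_polyDl ?size_polyN ?sP2 ?sQ2; move: (size P) (size Q) sP sQ h => y z; lia.
suff -> : size (P ^+ 2 - x%:P * Q ^+ 2) = (size P + size P).-1 by move: (size P) sP => y; lia.
apply/eqP; rewrite eqn_leq; apply/andP; split.
  by rewrite (leq_trans (size_polyD _ _)) // size_polyN sP2 sQ2 h maxnn.
rewrite leqNgt; apply/negP => hlt.
have : (P ^+ 2 - x%:P * Q ^+ 2)`_(size P).-1.*2 = 0.
  by rewrite nth_default //; move: (size _) (size P) sP hlt => y z; lia.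
rewrite coefB coefCM !expr2 -addnn coefM_top ?prednK // h coefM_top ?prednK //.
rewrite -!/(lead_coef _) -h -/(lead_coef P) => /eqP; rewrite subr_eq0 => /eqP e.
have := nx (lead_coef P / lead_coef Q); rewrite expr_div_n expr2 e -expr2 mulfK ?eqxx //.
by rewrite expf_neq0 // lead_coef_eq0.
Qed.

Lemma mem_biquadratic_adjoin (E : fieldType) (k : fieldExtType E) (x y : E) (xi eta e : k) :
  xi ^+ 2 = in_alg k x -> eta ^+ 2 = in_alg k y -> e \in <<<<1; xi>>; eta>>%VS ->
  exists c0 c1 c2 c3, e = in_alg k c0 + in_alg k c1 * xi + in_alg k c2 * eta + in_alg k c3 * (xi * eta).
Proof.
move=> hxi heta /Fadjoin_polyP[p + ->].
have hx : (in_alg k : {rmorphism E -> k}) x = xi ^+ 2 by rewrite hxi.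
have hy : (in_alg k : {rmorphism E -> k}) y = eta ^+ 2 by rewrite heta.
elim/poly_ind: p => [_|p c IH pK].
  by exists 0, 0, 0, 0; rewrite horner0 !rmorph0 !mul0r !addr0.
have pK' : p \is a polyOver <<1; xi>>%VS.
  by apply/polyOverP => i; have := polyOverP pK i.+1; rewrite coefD coefMX coefC /= addr0.
have cin : c \in <<1; xi>>%VS.
  by have := polyOverP pK 0; rewrite coefD coefMX coefC /= add0r.
have [c0 [c1 [c2 [c3 e1]]]] := IH pK'.
have [d0 [d1 e2]] := mem_quadratic_adjoin hxi cin.
exists (c2 * y + d0), (c3 * y + d1), c0, c1.
have i1 c' d' : in_alg k (c' * y + d') = in_alg k c' * eta ^+ 2 + in_alg k d'.
  by pose ia : {rmorphism E -> k} := in_alg k; rewrite -!/(ia _) rmorphD rmorphM hy.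
by rewrite hornerD hornerM hornerX hornerC e1 e2 !i1; ring.
Qed.

(** At the zero r = -b / u^2 of the second factor, the element -r c to be tested is b c up to the
    square u^2. *)
Lemma pencil_point_square (k : fieldType) (t b u c : k) : u != 0 ->
  t ^+ 2 = - (- b / u ^+ 2) * c -> (t * u) ^+ 2 = b * c.
Proof. by move=> u0 h; rewrite exprMn h; field. Qed.

Lemma pencil_point_neq0 (k : fieldType) (a b u : k) : u != 0 -> b - u ^+ 2 * a != 0 ->
  u ^+ 2 * (- b / u ^+ 2 + a) != 0.
Proof.
move=> u0; apply: contra_neq => h; transitivity (- (u ^+ 2 * (- b / u ^+ 2 + a))); first by field.
by rewrite h oppr0.
Qed.

Lemma pencil_factorization (k : fieldType) (a b u : k) (Y : {poly k}) : u != 0 ->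
  ('X - (- b / u ^+ 2)%:P) * ((u ^+ 2)%:P * ('X + a%:P)) * Y =
  ('X + a%:P) * ((u ^+ 2)%:P * 'X + b%:P) * Y.
Proof.
move=> u0; have e : (u ^+ 2)%:P * (- b / u ^+ 2)%:P = - b%:P.
  by rewrite -polyCM mulrC divfK ?expf_neq0 // polyCN.
transitivity (('X + a%:P) * ((u ^+ 2)%:P * 'X - (u ^+ 2)%:P * (- b / u ^+ 2)%:P) * Y); first by ring.
by rewrite e opprK.
Qed.

Lemma pencil_eval (k k' : fieldType) (h : {rmorphism k -> k'}) (a b c u : k) (W V T : {poly k}) (S : k') :
  (map_poly h (W ^+ 2 - ('X + a%:P) * ((u ^+ 2)%:P * 'X + b%:P) * ('X * V ^+ 2 + c%:P * T ^+ 2))).[S] =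
  (map_poly h W).[S] ^+ 2 - (S + h a) * (h u ^+ 2 * S + h b) *
    (S * (map_poly h V).[S] ^+ 2 + h c * (map_poly h T).[S] ^+ 2).
Proof.
pose ev : {rmorphism {poly k} -> k'} := (horner_eval S \o map_poly h).
have evE q : (map_poly h q).[S] = ev q by [].
have evX : ev 'X = S by rewrite -evE map_polyX hornerX.
have evC e : ev e%:P = h e by rewrite -evE map_polyC hornerC.
by rewrite !evE rmorphB !(rmorphXn ev, rmorphM ev, rmorphD ev) evX !evC rmorphXn.
Qed.

(** * Anisotropy of the conic over biquadratic extensions of k1(S) *)

Section ConicAniso.
Variables (k1 E : fieldType) (tf : {rmorphism {poly k1} -> E}).
Hypothesis tf_inj : forall p, tf p = 0 -> p = 0.
Hypothesis tf_frac : forall f, exists n d, d != 0 /\ f = tf n / tf d.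
Local Notation cst := (tf \o polyC).
Variables (a b c u x y z : k1).
Hypotheses (c0 : c != 0) (u0 : u != 0) (two0 : (2%:R : k1) != 0) (abu : u ^+ 2 * a != b).
Hypothesis z_cases : z = a * c \/ z = b * c.
Hypothesis nz : forall e, e ^+ 2 != cst z.
Hypothesis nzx : forall e, e ^+ 2 != cst (z * x).
Hypothesis nzy : forall e, e ^+ 2 != cst (z * y).
Hypothesis nzxy : forall e, e ^+ 2 != cst (z * x * y).

Definition pencil_factor : {poly k1} := ('X + a%:P) * ((u ^+ 2)%:P * 'X + b%:P).
Local Notation A := (tf (pencil_factor * 'X)).
Local Notation C := (tf (pencil_factor * c%:P)).

Variables (k : fieldExtType E) (xi eta : k).
Hypotheses (hxi : xi ^+ 2 = in_alg k (cst x)) (heta : eta ^+ 2 = in_alg k (cst y)).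

Let io : {rmorphism k1 -> k} := (in_alg k \o cst).
Let G := in_list [:: xi; eta].
Let S : k := in_alg k (tf 'X).
Let val := sf_val io G.

Lemma io_horner (p : {poly k1}) : (map_poly io p).[S] = in_alg k (tf p).
Proof.
elim/poly_ind: p => [|p e IH]; first by rewrite !rmorph0 horner0.
rewrite !rmorphD !rmorphM /= map_polyX map_polyC hornerD hornerM hornerX hornerC IH.
by [].
Qed.

(** The constants k1(xi, eta) are algebraic over k1, and S is transcendental over k1 because
    evaluation at S is the injective [tf]. *)
Lemma S_trans (P : {poly subfield_of io G}) : (map_poly val P).[S] = 0 -> P = 0.
Proof.
move=> e; apply: NNPP => /eqP P0.
have aS : alg_over io G S by exists P => //; apply/eqP.
have al t e0 : t ^+ 2 = io e0 -> alg_over io (in_list [::]) t.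
  move=> ht; apply: (@alg_overP _ _ _ _ ('X^2 - (io e0)%:P)).
  - by rewrite -size_poly_eq0 size_XnsubC.
  - move=> i; rewrite coefB coefXn coefC; apply: adjoin_sub2; first exact: adjoin_nat.
    by case: (i == 0%N); [apply: adjoin_base|apply: adjoin0].
  - by rewrite /root hornerD hornerN hornerXn hornerC ht subrr.
have {}aS : alg_over io (in_list [::]) S.
  apply: alg_over_trans aS => g; rewrite /G /in_list !inE => /orP[]/eqP ->.
    exact: al hxi.
  exact: al heta.
case: aS => p p0 /eqP rp.
have hp i : exists z', io z' = sf_val io (in_list [::]) p`_i.
  by have /adjoin_no_generator[z' hz] := sf_valP p`_i; exists z'.
pose g i := proj1_sig (constructive_indefinite_description _ (hp i)).
have hg i : io (g i) = sf_val io (in_list [::]) p`_i.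
  by rewrite /g; case: constructive_indefinite_description.
pose q := \poly_(i < size p) g i.
have qE : map_poly io q = map_poly (sf_val io (in_list [::])) p.
  apply/polyP => i; rewrite !coef_map coef_poly; case: ltnP => hi; first exact: hg.
  by rewrite [p`_i]nth_default // !raddf0.
move: rp; rewrite -qE io_horner => /eqP; rewrite fmorph_eq0 => /eqP/tf_inj q0.
by case/negP: p0; rewrite -(map_poly_eq0 (sf_val io (in_list [::]))) -qE q0 rmorph0.
Qed.

Lemma G_in_biquadratic t : adjoin io G t -> t \in <<<<1; xi>>; eta>>%VS.
Proof.
elim=> [e|g|g g' _ h1 _ h2|g _ h1|g g' _ h1 _ h2|g _ h1].
- by rewrite rpredZ ?rpred1.
- rewrite /G /in_list !inE => /orP[]/eqP ->; last exact: memv_adjoin.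
  by apply: (subvP (subv_adjoin _ _)); apply: memv_adjoin.
- exact: rpredD.
- by rewrite rpredN.
- exact: rpredM.
- by rewrite rpredV.
Qed.

Lemma nonsquare_in_G (t : subfield_of io G) : val t ^+ 2 != io z.
Proof.
apply/eqP => ht.
apply: (@square_in_biquadratic E k (cst x) (cst y) (cst z) xi eta (val t)) => //.
- by rewrite -(rmorph_nat cst) fmorph_eq0.
- by apply: G_in_biquadratic; apply: sf_valP.
- by move=> e; rewrite -rmorphM nzx.
- by move=> e; rewrite -rmorphM nzy.
- by move=> e; rewrite -!rmorphM nzxy.
Qed.

(** In the basis 1, xi, eta, xi eta and with a common denominator, a zero of the conic becomes a
    relation between polynomials in S over the field of constants k1(xi, eta), hence a polynomial
    identity, to which [conic_pencil_anisotropic] applies. *)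
Lemma conic_aniso (a0 b0 d0 : k) : a0 \in <<<<1; xi>>; eta>>%VS -> b0 \in <<<<1; xi>>; eta>>%VS ->
  d0 \in <<<<1; xi>>; eta>>%VS ->
  a0 ^+ 2 = in_alg k A * b0 ^+ 2 + in_alg k C * d0 ^+ 2 -> b0 = 0 /\ d0 = 0.
Proof.
move=> ha hb hd e.
have [a1 [a2 [a3 [a4 ea]]]] := mem_biquadratic_adjoin hxi heta ha.
have [b1 [b2 [b3 [b4 eb]]]] := mem_biquadratic_adjoin hxi heta hb.
have [d1 [d2 [d3 [d4 ed]]]] := mem_biquadratic_adjoin hxi heta hd.
have [D [D0 hD]] := common_denominator tf_inj tf_frac
  [:: a1; a2; a3; a4; b1; b2; b3; b4; d1; d2; d3; d4].
pose ia : {rmorphism E -> k} := in_alg k.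
have iD0 : ia (tf D) != 0 by rewrite fmorph_eq0 (tf_eq0 tf_inj).
have xG : adjoin io G xi by apply: adjoin_gen; rewrite /G /in_list inE eqxx.
have eG : adjoin io G eta by apply: adjoin_gen; rewrite /G /in_list !inE eqxx orbT.
have rep e0 f1 f2 f3 f4 : e0 = ia f1 + ia f2 * xi + ia f3 * eta + ia f4 * (xi * eta) ->
   (exists q, f1 = tf q / tf D) -> (exists q, f2 = tf q / tf D) ->
   (exists q, f3 = tf q / tf D) -> (exists q, f4 = tf q / tf D) ->
   exists P : {poly subfield_of io G}, e0 = (map_poly val P).[S] / ia (tf D).
  move=> -> [q1 ->] [q2 ->] [q3 ->] [q4 ->].
  have [|P PE] := @lift_poly _ _ io G (map_poly io q1 + xi *: map_poly io q2 +
     eta *: map_poly io q3 + (xi * eta) *: map_poly io q4).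
    move=> i; rewrite !coefD !coefZ !coef_map.
    by do ?[apply: adjoin_add | apply: adjoin_mul | apply: adjoin_base | exact: xG | exact: eG].
  exists P; rewrite /val PE !hornerD !hornerZ !io_horner !fmorph_div.
  by rewrite -/(ia _) -/(ia _) -/(ia _) -/(ia _); field.
have [W WE] : exists P : {poly subfield_of io G}, a0 = (map_poly val P).[S] / ia (tf D).
  by apply: (rep _ _ _ _ _ ea); apply: hD; rewrite !inE eqxx ?orbT.
have [V VE] : exists P : {poly subfield_of io G}, b0 = (map_poly val P).[S] / ia (tf D).
  by apply: (rep _ _ _ _ _ eb); apply: hD; rewrite !inE eqxx ?orbT.
have [T TE] : exists P : {poly subfield_of io G}, d0 = (map_poly val P).[S] / ia (tf D).
  by apply: (rep _ _ _ _ _ ed); apply: hD; rewrite !inE eqxx ?orbT.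
have [ga haG] := sf_exists (adjoin_base io G a); have [gb hbG] := sf_exists (adjoin_base io G b).
have [gc hcG] := sf_exists (adjoin_base io G c); have [gu huG] := sf_exists (adjoin_base io G u).
have fE : ia (tf pencil_factor) = (S + io a) * (io u ^+ 2 * S + io b).
  by rewrite /pencil_factor !(rmorphXn, rmorphM, rmorphD).
have eP : W ^+ 2 = ('X + ga%:P) * ((gu ^+ 2)%:P * 'X + gb%:P) * ('X * V ^+ 2 + gc%:P * T ^+ 2).
  apply/eqP; rewrite -subr_eq0; apply/eqP; apply: S_trans.
  rewrite pencil_eval [val ga]haG [val gb]hbG [val gc]hcG [val gu]huG.
  have eA : in_alg k A = ia (tf pencil_factor) * S by rewrite -[in_alg k A]/(ia _) !rmorphM.
  have eC : in_alg k C = ia (tf pencil_factor) * io c by rewrite -[in_alg k C]/(ia _) !rmorphM.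
  move: e; rewrite eA eC fE WE VE TE; move: (map_poly val W).[S] => w0.
  move: (map_poly val V).[S] (map_poly val T).[S] => v0 t0 e.
  apply/eqP; rewrite subr_eq0; apply/eqP.
  transitivity ((w0 / ia (tf D)) ^+ 2 * ia (tf D) ^+ 2); first by field.
  by rewrite e; field.
have gc0 : gc != 0 by rewrite -(fmorph_eq0 (sf_val io G)) hcG fmorph_eq0.
have gu0 : gu != 0 by rewrite -(fmorph_eq0 (sf_val io G)) huG fmorph_eq0.
have gabu : gb - gu ^+ 2 * ga != 0.
  rewrite -(fmorph_eq0 (sf_val io G)) !(rmorphXn, rmorphB, rmorphM) haG hbG huG.
  by rewrite -rmorphXn -rmorphM -rmorphB fmorph_eq0 subr_eq0 eq_sym.
have [V0 T0] : V = 0 /\ T = 0.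
  (* For z = a c the test is made at S = -a, for z = b c at S = -b / u^2; as u^2 a differs from b,
     the cofactor does not vanish there. *)
  case: z_cases => zE.
    apply: (@conic_pencil_anisotropic _ (- ga) gc ((gu ^+ 2)%:P * 'X + gb%:P) W) => //.
    - move=> t; apply/eqP => ht; have := nonsquare_in_G t; rewrite -(rmorphXn val) ht opprK zE.
      by rewrite (rmorphM val) (rmorphM io) [val ga]haG [val gc]hcG eqxx.
    - by rewrite !hornerE mulrN addrC.
    - by rewrite eP rmorphN opprK.
  apply: (@conic_pencil_anisotropic _ (- gb / gu ^+ 2) gc ((gu ^+ 2)%:P * ('X + ga%:P)) W) => //.
  - move=> t; apply/eqP => ht; have := nonsquare_in_G (t * gu).
    rewrite -(rmorphXn val) (pencil_point_square gu0 ht) zE.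
    by rewrite (rmorphM val) (rmorphM io) [val gb]hbG [val gc]hcG eqxx.
  - by rewrite hornerM hornerC hornerD hornerX hornerC pencil_point_neq0.
  - by rewrite eP -pencil_factorization.
by rewrite VE TE V0 T0 rmorph0 horner0 mul0r.
Qed.
End ConicAniso.

(** * Consequences of rationality for the pencil *)

Section Nonrational.
Variables (K F : fieldType) (iota : {rmorphism K -> F}) (a b c : K) (S u v w : F).
Variable L : F -> Prop.
Hypothesis two0 : (2%:R : K) != 0.
Hypothesis nonsquare : forall i j l : nat, odd i || odd j || odd l ->
  forall f : F, f ^+ 2 != iota (a ^+ i * b ^+ j * c ^+ l).
Hypothesis indep : seq_indep iota (@no_gen F) [:: u; S; v].
Hypothesis hw : w ^+ 2 = (S + iota a) * (u ^+ 2 * S + iota b) * (v ^+ 2 * S + iota c).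
Hypothesis hL : forall f, L f <-> adjoin iota (in_list [:: S; u; v; w]) f.

Lemma nonsquare_neq0 i j l : odd i || odd j || odd l -> a ^+ i * b ^+ j * c ^+ l != 0.
Proof.
move=> h; apply/eqP => e; have := nonsquare h 0.
by rewrite e rmorph0 expr2 mul0r eqxx.
Qed.

Lemma types_exponents i : exists e1 e2 e3, norm_types a b c i = a ^+ e1 * b ^+ e2 * c ^+ e3 /\
   odd (e1 + e2 + e3).
Proof.
case: i => -[|[|[|[|i]]]] hi //.
- by exists 1%N, 0%N, 0%N; rewrite /norm_types /= !expr0 !mulr1.
- by exists 0%N, 1%N, 0%N; rewrite /norm_types /= !expr0 mul1r mulr1.
- by exists 0%N, 0%N, 1%N; rewrite /norm_types /= !expr0 !mul1r.
- by exists 1%N, 1%N, 1%N.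
Qed.

Lemma types_nonsquare i (f : F) : f ^+ 2 != iota (norm_types a b c i).
Proof.
have [e1 [e2 [e3 [-> o]]]] := types_exponents i; apply: nonsquare.
by move: o; rewrite !oddD; case: (odd e1); case: (odd e2); case: (odd e3).
Qed.

(** By [square_in_biquadratic], the first conditions keep z from becoming a square after adjoining
    square roots of the types i and l; the last one makes these two types independent. *)
Definition pair_witness (i l : 'I_4) (z : K) :=
  [/\ z = a * c \/ z = b * c, forall f : F, f ^+ 2 != iota z,
     forall f : F, f ^+ 2 != iota (z * norm_types a b c i),
     forall f : F, f ^+ 2 != iota (z * norm_types a b c l)
   & (forall f : F, f ^+ 2 != iota (z * norm_types a b c i * norm_types a b c l)) /\
     (forall f : F, f ^+ 2 != iota (norm_types a b c i * norm_types a b c l))].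

Lemma exists_pair_witness i l : i != l -> exists z, pair_witness i l z.
Proof.
have ns i1 j1 l1 z : odd i1 || odd j1 || odd l1 -> z = a ^+ i1 * b ^+ j1 * c ^+ l1 ->
  forall f : F, f ^+ 2 != iota z by move=> h -> f; apply: nonsquare.
case: i => -[|[|[|[|i]]]] hi //; case: l => -[|[|[|[|l]]]] hl // _;
  rewrite /pair_witness /norm_types /=.
(* One line for each ordered pair of types; the exponents given to [ns] are those of z, z x_i, z
   x_l, z x_i x_l and x_i x_l. *)
- exists (a * c); split; [by left|apply: (ns 1 0 1)%N|apply: (ns 2 0 1)%N|apply: (ns 1 1 1)%N|split; [apply: (ns 2 1 1)%N|apply: (ns 1 1 0)%N]]; rewrite //; ring.
- exists (b * c); split; [by right|apply: (ns 0 1 1)%N|apply: (ns 1 1 1)%N|apply: (ns 0 1 2)%N|split; [apply: (ns 1 1 2)%N|apply: (ns 1 0 1)%N]]; rewrite //; ring.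
- exists (a * c); split; [by left|apply: (ns 1 0 1)%N|apply: (ns 2 0 1)%N|apply: (ns 2 1 2)%N|split; [apply: (ns 3 1 2)%N|apply: (ns 2 1 1)%N]]; rewrite //; ring.
- exists (a * c); split; [by left|apply: (ns 1 0 1)%N|apply: (ns 1 1 1)%N|apply: (ns 2 0 1)%N|split; [apply: (ns 2 1 1)%N|apply: (ns 1 1 0)%N]]; rewrite //; ring.
- exists (a * c); split; [by left|apply: (ns 1 0 1)%N|apply: (ns 1 1 1)%N|apply: (ns 1 0 2)%N|split; [apply: (ns 1 1 2)%N|apply: (ns 0 1 1)%N]]; rewrite //; ring.
- exists (b * c); split; [by right|apply: (ns 0 1 1)%N|apply: (ns 0 2 1)%N|apply: (ns 1 2 2)%N|split; [apply: (ns 1 3 2)%N|apply: (ns 1 2 1)%N]]; rewrite //; ring.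
- exists (b * c); split; [by right|apply: (ns 0 1 1)%N|apply: (ns 0 1 2)%N|apply: (ns 1 1 1)%N|split; [apply: (ns 1 1 2)%N|apply: (ns 1 0 1)%N]]; rewrite //; ring.
- exists (a * c); split; [by left|apply: (ns 1 0 1)%N|apply: (ns 1 0 2)%N|apply: (ns 1 1 1)%N|split; [apply: (ns 1 1 2)%N|apply: (ns 0 1 1)%N]]; rewrite //; ring.
- exists (a * c); split; [by left|apply: (ns 1 0 1)%N|apply: (ns 1 0 2)%N|apply: (ns 2 1 2)%N|split; [apply: (ns 2 1 3)%N|apply: (ns 1 1 2)%N]]; rewrite //; ring.
- exists (a * c); split; [by left|apply: (ns 1 0 1)%N|apply: (ns 2 1 2)%N|apply: (ns 2 0 1)%N|split; [apply: (ns 3 1 2)%N|apply: (ns 2 1 1)%N]]; rewrite //; ring.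
- exists (b * c); split; [by right|apply: (ns 0 1 1)%N|apply: (ns 1 2 2)%N|apply: (ns 0 2 1)%N|split; [apply: (ns 1 3 2)%N|apply: (ns 1 2 1)%N]]; rewrite //; ring.
- exists (a * c); split; [by left|apply: (ns 1 0 1)%N|apply: (ns 2 1 2)%N|apply: (ns 1 0 2)%N|split; [apply: (ns 2 1 3)%N|apply: (ns 1 1 2)%N]]; rewrite //; ring.
Qed.

(** Finitely many members of a transcendence basis suffice to express S, u, v and w, and over these
    [class_tower] applies. *)
Lemma adjoin_rational_norms : purely_transcendental iota L ->
  exists d : K, d != 0 /\ exists (g : F) (p q : 'I_4 -> F),
  [/\ g != 0, L g, forall i, L (p i) /\ L (q i)
    & iota d * S * g ^+ 2 = \prod_i (p i ^+ 2 - iota (norm_types a b c i) * q i ^+ 2)].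
Proof.
case=> T iT hT.
have nz i1 j1 l1 : odd i1 || odd j1 || odd l1 -> a ^+ i1 * b ^+ j1 * c ^+ l1 != 0 by apply: nonsquare_neq0.
have a0 : a != 0 by have := nz 1%N 0%N 0%N isT; rewrite !expr0 !mulr1.
have b0 : b != 0 by have := nz 0%N 1%N 0%N isT; rewrite !expr0 mul1r mulr1.
have c0 : c != 0 by have := nz 0%N 0%N 1%N isT; rewrite !expr0 !mul1r.
have nsK z : (forall f : F, f ^+ 2 != iota z) -> forall e : K, e ^+ 2 != z.
  by move=> h e; apply/eqP => he; have := h (iota e); rewrite -rmorphXn he eqxx.
have inf : forall n, exists2 s : seq K, uniq s & size s = n.
  apply: (@infinite_of_square_classes K a b); apply: nsK => f.
  - by have := @nonsquare 1 0 0 isT f; rewrite !expr0 !mulr1.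
  - by have := @nonsquare 0 1 0 isT f; rewrite !expr0 mul1r mulr1.
  - by have := @nonsquare 1 1 0 isT f; rewrite !expr0 !mulr1.
have hs f : f \in [:: S; u; v; w] -> adjoin iota T f.
  by move=> fs; apply/hT/hL; apply: adjoin_gen.
have [l [ul lT hl]] := adjoin_finite_seq hs.
have il := alg_indep_seq_indep iT ul lT.
have [k [j [phi [pj im cl]]]] := class_tower a0 b0 c0 two0 inf il.
have [S' SE] : exists z, phi z = S by apply/im/hl; rewrite !inE eqxx.
have [u' uE] : exists z, phi z = u by apply/im/hl; rewrite !inE eqxx ?orbT.
have [v' vE] : exists z, phi z = v by apply/im/hl; rewrite !inE eqxx ?orbT.
have [w' wE] : exists z, phi z = w by apply/im/hl; rewrite !inE eqxx ?orbT.
have S0 : S != 0.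
  apply/eqP => h; case: indep => _ [+ _]; apply; rewrite h; apply: alg_over_adjoin; exact: adjoin0.
have pjE z : phi (j z) = iota z by apply: pj.
have [||d d0 [_ [g [p [q [g0 e]]]]]] := cl S' u' v' w'.
- by rewrite -(fmorph_eq0 phi) SE.
- apply: (fmorph_inj phi).
  by rewrite !(rmorphXn phi, rmorphM phi, rmorphD phi) !pjE SE uE vE wE.
have inL z : L (phi z).
  apply/hT; have : adjoin iota (in_list l) (phi z) by apply/im; exists z.
  by apply: adjoin_sub => y yl; apply: adjoin_gen; apply: lT.
exists d; split=> //; exists (phi g), (phi \o p), (phi \o q); split=> //.
  by rewrite fmorph_eq0.
  by move=> i; split; apply: inL.
move/(congr1 phi): e; rewrite !(rmorphXn phi, rmorphM phi) pjE SE rmorph_prod => ->.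
by apply: eq_bigr => i _; rewrite !(rmorphB phi, rmorphXn phi, rmorphM phi) pjE.
Qed.

(** Since w is quadratic over K(u, S)(v), multiplication by the conjugate turns every denominator
    into a polynomial in v. *)
Lemma conic_fractions (E : fieldType) (phi : {rmorphism E -> F}) (A C : E) :
  (forall f, adjoin iota (in_list [:: u; S]) f -> exists z, phi z = f) ->
  (forall p : {poly E}, (map_poly phi p).[v] = 0 -> p = 0) ->
  w ^+ 2 = phi A * v ^+ 2 + phi C -> (forall e, e ^+ 2 != A) ->
  forall f, L f -> exists (b0 : conic_ring E) (D : {poly E}), D != 0 /\
    f = bev phi v w b0 / (map_poly phi D).[v].
Proof.
move=> im tr hwA nA f /hL.
set ev := fun p : {poly E} => (map_poly phi p).[v].
have ev0 D : D != 0 -> ev D != 0 by apply: contra_neq => /tr.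
have evM p q : ev (p * q) = ev p * ev q by rewrite /ev rmorphM hornerM.
have poly1 (p q : {poly E}) : exists (b0 : conic_ring E) (D : {poly E}), D != 0 /\
    ev p + ev q * w = bev phi v w b0 / ev D.
  by exists (p, q), 1; rewrite oner_neq0 /ev rmorph1 hornerC divr1.
have scal (q p : {poly E}) (b0 : conic_ring E) : bev phi v w (bmul A C (q, 0) b0) = ev q * bev phi v w b0.
  by rewrite (bevM hwA) /bev /= rmorph0 horner0 mul0r addr0.
have evz z : ev z%:P = phi z by rewrite /ev map_polyC hornerC.
have e00 : ev 0 = 0 by rewrite /ev rmorph0 horner0.
elim=> [z|g|g g' _ [b1 [D1 [D10 ->]]] _ [b2 [D2 [D20 ->]]]|g _ [b1 [D1 [D10 ->]]]|
   g g' _ [b1 [D1 [D10 ->]]] _ [b2 [D2 [D20 ->]]]|g _ [b1 [D1 [D10 ->]]]].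
- have [y yE] := im _ (adjoin_base iota (in_list [:: u; S]) z).
  by have := poly1 y%:P 0; rewrite evz e00 mul0r addr0 yE.
- rewrite /in_list !inE => /or4P[]/eqP ->.
  + have [|y yE] := im S; first by apply: adjoin_gen; rewrite /in_list !inE eqxx orbT.
    by have := poly1 y%:P 0; rewrite evz e00 mul0r addr0 yE.
  + have [|y yE] := im u; first by apply: adjoin_gen; rewrite /in_list !inE eqxx.
    by have := poly1 y%:P 0; rewrite evz e00 mul0r addr0 yE.
  + have := poly1 'X 0; rewrite e00 mul0r addr0.
    by have -> : ev 'X = v by rewrite /ev map_polyX hornerX.
  + have := poly1 0 1; rewrite e00 add0r.
    have e1 : ev 1 = 1 by rewrite /ev rmorph1 hornerC.
    by rewrite e1 mul1r.
- exists (bmul A C (D2, 0) b1 + bmul A C (D1, 0) b2), (D1 * D2).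
  rewrite mulf_neq0 //; split=> //; rewrite bevD !scal // -!/(ev _) evM.
  by have h1 := ev0 _ D10; have h2 := ev0 _ D20; field; rewrite h1 h2.
- by exists (- b1), D1; split=> //; rewrite bevN mulNr.
- exists (bmul A C b1 b2), (D1 * D2); rewrite mulf_neq0 //; split=> //.
  by rewrite (bevM hwA) -!/(ev _) evM mulf_div.
- rewrite -!/(ev _); case: (eqVneq b1 0) => [->|b10].
    have -> : bev phi v w 0 = 0 by rewrite /bev /= !rmorph0 !horner0 mul0r addr0.
    by rewrite mul0r invr0; have := poly1 0 0; rewrite e00 mul0r addr0.
  have n0 : bnorm A C b1 != 0 by apply: contra_neq b10 => /(bnorm_eq0 nA).
  exists (bmul A C (D1, 0) (bconj b1)), (bnorm A C b1); split=> //.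
  have := bev_norm hwA b1; rewrite -!/(ev _) scal // => en.
  have := ev0 _ n0; rewrite en mulf_eq0 negb_or => /andP[h1 h2].
  have h3 := ev0 _ D10; field; by rewrite h1 h2 h3.
Qed.
End Nonrational.

Lemma odd_predD m n : odd m -> odd n -> odd (m + n).-1.
Proof. by case: m => // m /=; rewrite oddD => /negPf -> ->. Qed.

(** * Comparison of degrees in S over the base of the conic *)

Section PencilNonrational.
Variables (K F : fieldType) (iota : {rmorphism K -> F}) (a b c : K) (S u v w : F).
Variable L : F -> Prop.
Hypothesis two0 : (2%:R : K) != 0.
Hypothesis nonsquare : forall i j l : nat, odd i || odd j || odd l ->
  forall f : F, f ^+ 2 != iota (a ^+ i * b ^+ j * c ^+ l).
Hypothesis indep : seq_indep iota (@no_gen F) [:: u; S; v].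
Hypothesis hw : w ^+ 2 = (S + iota a) * (u ^+ 2 * S + iota b) * (v ^+ 2 * S + iota c).
Hypothesis hL : forall f, L f <-> adjoin iota (in_list [:: S; u; v; w]) f.
Local Notation types := (norm_types a b c).

Section OverFractionField.
Variables (k1 E : fieldType) (c1 : {rmorphism K -> k1}) (tf : {rmorphism {poly k1} -> E}).
Variables (phi : {rmorphism E -> F}) (uk : k1).
Hypothesis tf_inj : forall p, tf p = 0 -> p = 0.
Hypothesis tf_frac : forall f, exists n d, d != 0 /\ f = tf n / tf d.
Hypothesis phi_c : forall z, phi (tf (c1 z)%:P) = iota z.
Hypothesis phi_u : phi (tf uk%:P) = u.
Hypothesis phi_S : phi (tf 'X) = S.
Hypothesis phi_im : forall f, adjoin iota (in_list [:: u; S]) f -> exists z, phi z = f.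
Hypothesis v_trans : forall p : {poly E}, (map_poly phi p).[v] = 0 -> p = 0.

Let f0 := pencil_factor (c1 a) (c1 b) uk.
Let A := tf (f0 * 'X).
Let C := tf (f0 * (c1 c)%:P).
Let x i := tf (c1 (types i))%:P.

Lemma u_neq0 : u != 0.
Proof.
by apply/eqP => h; case: indep => + _; apply; rewrite h; apply: alg_over_adjoin; apply: adjoin0.
Qed.

Lemma uk_neq0 : uk != 0.
Proof. by apply: contra_neq u_neq0 => h; rewrite -phi_u h polyC0 !rmorph0. Qed.

Lemma size_pencil e : e != 0 -> size (f0 * 'X * e%:P) = 4%N.
Proof.
move=> e0; have s1 : size ('X + (c1 a)%:P) = 2%N by rewrite size_XaddC.
have s2 : size ((uk ^+ 2)%:P * 'X + (c1 b)%:P) = 2%N.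
  rewrite size_polyDl ?size_Cmul ?size_polyX ?expf_neq0 ?uk_neq0 //.
  by rewrite (leq_ltn_trans (size_polyC_leq1 _)).
have n1 : 'X + (c1 a)%:P != 0 by rewrite -size_poly_eq0 s1.
have n2 : (uk ^+ 2)%:P * 'X + (c1 b)%:P != 0 by rewrite -size_poly_eq0 s2.
have n3 : f0 != 0 by rewrite mulf_neq0.
by rewrite mulrC mul_polyC size_scale // size_mulX // size_mul // s1 s2.
Qed.

Lemma A_nonsq e : e ^+ 2 != A.
Proof.
have := @size_pencil 1 (oner_neq0 _); rewrite polyC1 mulr1 => s.
by apply: odd_degree_nonsquare; rewrite // -?size_poly_eq0 s.
Qed.

Lemma types_neq0 i : types i != 0.
Proof.
apply/eqP => h; have := types_nonsquare nonsquare i 0.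
by rewrite h rmorph0 expr2 mul0r eqxx.
Qed.

Lemma Ax_nonsq i e : e ^+ 2 != A * x i.
Proof.
have c0 : c1 (types i) != 0 by rewrite fmorph_eq0 types_neq0.
have s := size_pencil c0; rewrite /A /x -rmorphM.
by apply: odd_degree_nonsquare; rewrite // -?size_poly_eq0 s.
Qed.

Lemma phi_x i : phi (x i) = iota (types i).
Proof. exact: phi_c. Qed.

Lemma hwA : w ^+ 2 = phi A * v ^+ 2 + phi C.
Proof.
have ef : phi (tf f0) = (S + iota a) * (u ^+ 2 * S + iota b).
  rewrite /f0 /pencil_factor !(rmorphM phi, rmorphM tf, rmorphD phi, rmorphD tf).
  by rewrite !phi_c phi_S rmorphXn !(rmorphXn phi, rmorphXn tf) phi_u.
have eA : phi A = phi (tf f0) * S by rewrite /A (rmorphM tf) (rmorphM phi) phi_S.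
have eC : phi C = phi (tf f0) * iota c by rewrite /C (rmorphM tf) (rmorphM phi) phi_c.
by rewrite hw eA eC ef; ring.
Qed.

Lemma bv_inj b0 : bev phi v w b0 = 0 -> b0 = 0.
Proof.
move=> h; apply: (bnorm_eq0 (A := A) (C := C) A_nonsq); apply: v_trans.
by rewrite (bev_norm hwA) h mul0r.
Qed.

Lemma pencil_contradiction_abstract : purely_transcendental iota L -> False.
Proof.
move=> pt; have [d [d0 [g [p [q [g0 Lg Lpq e]]]]]] := adjoin_rational_norms two0 nonsquare indep hw hL pt.
have fr := conic_fractions hL phi_im v_trans hwA A_nonsq.
pose ev (D : {poly E}) := (map_poly phi D).[v].
have ev0 D : D != 0 -> ev D != 0 by apply: contra_neq => /v_trans.
have evM D D' : ev (D * D') = ev D * ev D' by rewrite /ev rmorphM hornerM.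
have evX D n : ev (D ^+ n) = ev D ^+ n by rewrite /ev rmorphXn horner_exp.
have [G [Dg [Dg0 gE]]] := fr g Lg.
have /fin_all_exists[P hP] i : exists z : conic_ring E * {poly E}, z.2 != 0 /\ p i = bev phi v w z.1 / ev z.2.
  by have [b0 [D h]] := fr _ (Lpq i).1; exists (b0, D).
have /fin_all_exists[Q hQ] i : exists z : conic_ring E * {poly E}, z.2 != 0 /\ q i = bev phi v w z.1 / ev z.2.
  by have [b0 [D h]] := fr _ (Lpq i).2; exists (b0, D).
have scal (D : {poly E}) (b0 : conic_ring E) : bev phi v w (bmul A C (D, 0) b0) = ev D * bev phi v w b0.
  by rewrite (bevM hwA) /bev /= rmorph0 horner0 mul0r addr0.
pose DD := \prod_i ((P i).2 * (Q i).2).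
have DD0 : DD != 0.
  by apply/prodf_neq0 => i _; rewrite mulf_neq0 ?(hP i).1 ?(hQ i).1.
have evDD : ev DD = \prod_i (ev (P i).2 * ev (Q i).2).
  rewrite /DD /ev rmorph_prod horner_prod; apply: eq_bigr => i _.
  by rewrite rmorphM hornerM.
have bv0 : bev phi v w 0 = 0 by rewrite /bev /= !rmorph0 !horner0 mul0r addr0.
have vDg := ev0 _ Dg0.
(* The relation times the square of DD Dg^4, where each of the four norms takes one factor Dg along
   with its own two denominators. *)
have key : phi (tf ((c1 d)%:P * 'X)) * bev phi v w (bmul A C (DD * Dg ^+ 3, 0) G) ^+ 2 =
   \prod_i (bev phi v w (bmul A C ((Q i).2 * Dg, 0) (P i).1) ^+ 2 -
     phi (x i) * bev phi v w (bmul A C ((P i).2 * Dg, 0) (Q i).1) ^+ 2).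
  rewrite scal (rmorphM tf) (rmorphM phi) phi_c phi_S.
  transitivity (iota d * S * g ^+ 2 * (ev DD * ev Dg ^+ 4) ^+ 2).
    by rewrite gE -/(ev Dg) evM evX; field.
  rewrite e evDD.
  have -> : ev Dg ^+ 4 = \prod_(i < 4) ev Dg by rewrite prodr_const card_ord.
  rewrite -big_split -prodrXl -big_split; apply: eq_bigr => i _ /=.
  rewrite phi_x !scal !evM (hP i).2 (hQ i).2.
  have h1 := ev0 _ (hP i).1; have h2 := ev0 _ (hQ i).1; by field; rewrite h1 h2.
have s0 : tf ((c1 d)%:P * 'X) != 0.
  by rewrite (tf_eq0 tf_inj) mulf_neq0 ?polyX_eq0 // polyC_eq0 fmorph_eq0.
have G0 : bmul A C (DD * Dg ^+ 3, 0) G != 0.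
  have G1 : bev phi v w G != 0 by apply: contra_neq g0 => h; rewrite gE h mul0r.
  apply: contra_neq G1 => h; have := scal (DD * Dg ^+ 3) G; rewrite h bv0 => /esym/eqP.
  by rewrite mulf_eq0 (negPf (ev0 _ _)) ?mulf_neq0 ?expf_neq0 // => /eqP.
have twoE : (2%:R : E) != 0 by rewrite -(fmorph_eq0 phi) rmorph_nat -(rmorph_nat iota) fmorph_eq0.
have [|||g1 [p1 [q1 [g10 e1]]]] := @conic_norm_descent E F phi A C v w x twoE hwA A_nonsq Ax_nonsq
    _ _ bv_inj _ _ _ _ _ s0 G0 key.
- by move=> i f; rewrite phi_x; apply: types_nonsquare.
- move=> i l il f; rewrite rmorphM !phi_x -rmorphM.
  by have [z [_ _ _ _ [_ h]]] := exists_pair_witness nonsquare il; apply: h.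
- move=> k xi eta i l il hxi heta.
  have [z [z_cases n1 n2 n3 [n4 _]]] := exists_pair_witness nonsquare il.
  have nE y : (forall f : F, f ^+ 2 != iota y) -> forall e0 : E, e0 ^+ 2 != (tf \o polyC) (c1 y).
    by move=> h e0; apply/eqP => he; have := h (phi e0); rewrite -rmorphXn he /= phi_c eqxx.
  apply: (@conic_aniso k1 E tf tf_inj tf_frac (c1 a) (c1 b) (c1 c) uk (c1 (types i)) (c1 (types l)) (c1 z)) => //.
  + rewrite fmorph_eq0; apply/eqP => h; have := @nonsquare 0 0 1 isT 0.
    by rewrite h expr1 mulr0 rmorph0 expr2 mul0r eqxx.
  + exact: uk_neq0.
  + by rewrite -(rmorph_nat c1) fmorph_eq0.
  (* From u^2 a = b it would follow that a b = (u a)^2 is a square. *)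
  + apply/eqP => h; have := @nonsquare 1 1 0 isT (u * iota a); rewrite !expr1 expr0 mulr1.
    have hu : u ^+ 2 * iota a = iota b.
      have := congr1 (fun z => phi (tf z%:P)) h.
      by rewrite !(rmorphM polyC, rmorphM tf, rmorphM phi) -expr2 phi_u !phi_c.
    by rewrite exprMn expr2 [iota a ^+ 2]expr2 -expr2 mulrA hu mulrC -rmorphM eqxx.
  + by case: z_cases => ->; rewrite rmorphM; [left|right].
  + exact: nE.
  + by move=> e0; rewrite -rmorphM nE.
  + by move=> e0; rewrite -rmorphM nE.
  + by move=> e0; rewrite -!rmorphM nE.
have [D [D0 hD]] := common_denominator tf_inj tf_frac (g1 :: codom p1 ++ codom q1).
have [G1 G1E] : exists q, g1 = tf q / tf D by apply: hD; rewrite mem_head.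
have /fin_all_exists[P1 hP1] i : exists q, p1 i = tf q / tf D.
  by apply: hD; rewrite inE mem_cat codom_f orbT.
have /fin_all_exists[Q1 hQ1] i : exists q, q1 i = tf q / tf D.
  by apply: hD; rewrite inE mem_cat codom_f !orbT.
have tD : tf D != 0 by rewrite (tf_eq0 tf_inj).
(* Multiplication by D^8, that is, by D^2 for each norm, of which the left-hand side spends D^2 on
   the denominator of g1. *)
have e2 : (c1 d)%:P * 'X * G1 ^+ 2 * D ^+ 6 = \prod_i (P1 i ^+ 2 - (c1 (types i))%:P * Q1 i ^+ 2).
  apply: (tf_eq tf_inj); rewrite rmorph_prod.
  have -> : \prod_i tf (P1 i ^+ 2 - (c1 (types i))%:P * Q1 i ^+ 2) =
     \prod_i ((p1 i ^+ 2 - x i * q1 i ^+ 2) * tf D ^+ 2).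
    apply: eq_bigr => i _; rewrite hP1 hQ1 (rmorphB tf) !(rmorphXn tf, rmorphM tf) -/(x i); by field.
  rewrite big_split /= -e1 prodr_const card_ord G1E !(rmorphXn tf, rmorphM tf); by field.
have G10 : G1 != 0 by apply: contra_neq g10 => h; rewrite G1E h rmorph0 mul0r.
have lhs0 : (c1 d)%:P * 'X * G1 ^+ 2 * D ^+ 6 != 0.
  by rewrite !mulf_neq0 ?polyC_eq0 ?fmorph_eq0 ?polyX_eq0 ?expf_neq0.
(* The product of norms has even degree in S, while d S times squares has odd degree; in terms of
   [size] the parities are reversed. *)
have [_] : \prod_i (P1 i ^+ 2 - (c1 (types i))%:P * Q1 i ^+ 2) != 0 /\
    odd (size (\prod_i (P1 i ^+ 2 - (c1 (types i))%:P * Q1 i ^+ 2))).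
  have fac0 i : P1 i ^+ 2 - (c1 (types i))%:P * Q1 i ^+ 2 != 0.
    by move: lhs0; rewrite e2 => /prodf_neq0; apply.
  elim/big_ind: _ => [|f f' [f00 odf] [f00' odf']|i _].
  - by rewrite oner_neq0 size_poly1.
  - rewrite mulf_neq0 // size_mul //; split=> //.
    exact: odd_predD.
  - split=> //; apply: size_norm_odd => // e0; apply/eqP => h.
    have := types_nonsquare nonsquare i (phi (tf e0%:P)).
    by rewrite -phi_c -h polyC_exp !rmorphXn eqxx.
rewrite -e2 -mulrA -mulrA mul_polyC size_scale ?fmorph_eq0 // mulrC size_mulX ?mulf_neq0 ?expf_neq0 //.
rewrite expr2 (_ : D ^+ 6 = D ^+ 3 * D ^+ 3); last by rewrite -exprD.
have := expf_neq0 3 D0; move: (D ^+ 3) => D3 D30; rewrite !size_mul ?mulf_neq0 //.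
have oD (y : {poly k1}) : y != 0 -> odd (size y + size y).-1.
  by rewrite -size_poly_gt0; case: (size y) => // n _; rewrite addSn addnS /= oddD addbb.
by rewrite oddS odd_predD ?oD.
Qed.
End OverFractionField.

Theorem pencil_nonrational : ~ purely_transcendental iota L.
Proof.
have /seq_indep_rcons[i2 nv] : seq_indep iota (@no_gen F) (rcons [:: u; S] v) by exact: indep.
have /seq_indep_rcons[i1 nS] : seq_indep iota (@no_gen F) (rcons [:: u] S) by exact: i2.
have /seq_indep_rcons[_ nu] : seq_indep iota (@no_gen F) (rcons [::] u) by exact: i1.
have im0 := adjoin_no_generator iota.
have tr0 := @transcendental_over _ _ iota [::] K iota u (fun z => proj2 (im0 _) (ex_intro _ z erefl)) nu.
have [phi1 h1] := extend_fraction tr0; have im1 := extend_tower im0 h1.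
have tr1 := @transcendental_over _ _ iota _ _ phi1 S (fun z => proj2 (im1 _) (ex_intro _ z erefl)) nS.
have [phi2 h2] := extend_fraction tr1; have im2 := extend_tower im1 h2.
have tr2 := @transcendental_over _ _ iota _ _ phi2 v (fun z => proj2 (im2 _) (ex_intro _ z erefl)) nv.
apply: (@pencil_contradiction_abstract _ _ (tf_of K \o polyC) (tf_of _) phi2 (tf_of K 'X)) => //.
- exact: (@tf_of_inj _).
- exact: fracP.
- by move=> z; rewrite h2 map_polyC hornerC /= h1 map_polyC hornerC.
- by rewrite h2 map_polyC hornerC /= h1 map_polyX hornerX.
- by rewrite h2 map_polyX hornerX.
- by move=> f /im2.
Qed.
End PencilNonrational.

(** * Three generators *)

Ltac adjoin_mem := repeat first [ assumption
  | by apply: adjoin_gen; try match goal with M := in_list _ |- _ => rewrite /M end;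
    rewrite /in_list !inE !eqxx ?orbT
  | apply: adjoin_base | apply: adjoin0 | apply: adjoin1 | apply: adjoin_nat | apply: adjoin_exp
  | apply: adjoin_sub2 | apply: adjoin_add | apply: adjoin_opp | apply: adjoin_div
  | apply: adjoin_mul | apply: adjoin_inv ].
Ltac nonzero := by repeat (apply/andP; split).

Section ThreeGenerators.
Variables (K F : fieldType) (iota : {rmorphism K -> F}).
Local Notation adj := (adjoin iota).
Local Notation indep := (seq_indep iota (@no_gen F)).

Fixpoint all_adjoin (A : F -> Prop) (l : seq F) : Prop :=
  if l is f :: l' then adj A f /\ all_adjoin A l' else True.

Lemma all_adjoinP A l f : all_adjoin A l -> f \in l -> adj A f.
Proof. by elim: l => //= g l IH [h1 h2]; rewrite inE => /orP[/eqP->|/IH]; auto. Qed.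

Lemma adjoin_eq l l' : all_adjoin (in_list l') l -> all_adjoin (in_list l) l' ->
  forall f, adj (in_list l) f <-> adj (in_list l') f.
Proof. by move=> h h' f; split; apply: adjoin_sub => g; apply: all_adjoinP. Qed.

Lemma indep_neq l t f : indep (rcons l t) -> adj (in_list l) f -> t != f.
Proof.
by move=> /seq_indep_rcons[_ h] hf; apply/eqP => e; apply: h; rewrite e; apply: alg_over_adjoin.
Qed.

Lemma indep_change l l' : indep l -> (size l' <= size l)%N ->
  (forall f, f \in l -> alg_over iota (in_list l') f) -> indep l'.
Proof.
move=> hl hs h; apply: (generating_seq_indep hl hs) => f /h.
by apply: alg_over_sub => g hg; right.
Qed.

Lemma indep_adjoin l l' : indep l -> (size l' <= size l)%N -> all_adjoin (in_list l') l -> indep l'.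
Proof.
move=> hl hs h; apply: (indep_change hl hs) => f hf.
by apply: alg_over_adjoin; apply: all_adjoinP hf.
Qed.

Lemma indep_perm l l' : perm_eq l l' -> indep l -> indep l'.
Proof.
move=> h hl; apply: (indep_change hl); first by rewrite (perm_size h).
by move=> f; rewrite (perm_mem h) => hf; apply: alg_over_adjoin; apply: adjoin_gen.
Qed.

Lemma indep_size l l' : indep l -> (size l' < size l)%N ->
  ~ (forall f, f \in l -> alg_over iota (in_list l') f).
Proof.
move=> hl hs h; have : (size l <= size l')%N; last by rewrite leqNgt hs.
by apply: (steinitz hl) => f /h; apply: alg_over_sub => g hg; right.
Qed.

Lemma alg_over_sqrt A f : alg_over iota A (f ^+ 2) -> alg_over iota A f.
Proof.
have n0 : ('X^2 - (f ^+ 2)%:P : {poly F}) != 0 by rewrite -size_poly_eq0 size_XnsubC.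
move=> h; apply: (@alg_over_trans _ _ iota (eq (f ^+ 2))); first by move=> g <-.
apply: (@alg_overP _ _ iota _ ('X^2 - (f ^+ 2)%:P)) => // [i|]; last by rewrite /root !hornerE subrr.
rewrite coefB coefXn coefC; apply: adjoin_sub2; first exact: adjoin_nat.
by case: ifP => _; [apply: adjoin_gen|apply: adjoin0].
Qed.

Definition three_generated (L : F -> Prop) : Prop :=
  exists y1 y2 y3, forall f, L f <-> adj (in_list [:: y1; y2; y3]) f.

Lemma three_generated_eq (L L' : F -> Prop) : (forall f, L f <-> L' f) ->
  three_generated L -> three_generated L'.
Proof. by move=> h [y1 [y2 [y3 hy]]]; exists y1, y2, y3 => f; rewrite -h. Qed.

Lemma three_generated_list l y1 y2 y3 : all_adjoin (in_list l) [:: y1; y2; y3] ->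
  all_adjoin (in_list [:: y1; y2; y3]) l -> three_generated (adj (in_list l)).
Proof. by move=> h1 h2; exists y1, y2, y3; apply: adjoin_eq. Qed.

(** The equations are linear in Z2 and Z3. When both powers are present, the determinant b c - c2 c3
    is a nonzero multiple of Z2 + Z3 - 1. *)
Lemma solve_pair M (b c c2 c3 Z2 Z3 : F) (e e' : bool) : adj M b -> adj M c -> adj M c2 -> adj M c3 ->
  b != 0 -> c != 0 -> Z2 != 0 -> Z3 != 0 -> Z3 != 1 - Z2 ->
  b * (1 - Z2) = c2 * Z3 ^+ e -> c * (1 - Z3) = c3 * Z2 ^+ e' -> adj M Z2 /\ adj M Z3.
Proof.
move=> mb mc m2 m3 b0 c0 z2 z3 n h2 h3.
have e2 : Z2 = 1 - c2 * Z3 ^+ e / b by rewrite -h2; field.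
have e3 : Z3 = 1 - c3 * Z2 ^+ e' / c by rewrite -h3; field.
case: e {n} (n) h2 e2 => n h2 e2; last first.
  have M2 : adj M Z2 by rewrite e2; adjoin_mem.
  by split=> //; rewrite e3; adjoin_mem.
case: e' h3 e3 => h3 e3; last first.
  have M3 : adj M Z3 by rewrite e3; adjoin_mem.
  by split=> //; rewrite e2; adjoin_mem.
have c2E : c2 = b * (1 - Z2) / Z3 by rewrite h2; field.
have c3E : c3 = c * (1 - Z3) / Z2 by rewrite h3; field.
have n' : Z2 + Z3 - 1 != 0 by apply: contra_neq n => h; rewrite -[Z3]subr0 -h; ring.
have D0 : b * c - c2 * c3 != 0.
  have -> : b * c - c2 * c3 = b * c * (Z2 + Z3 - 1) / (Z2 * Z3).
    by rewrite c2E c3E; field; nonzero.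
  by rewrite !mulf_neq0 ?invr_neq0 ?mulf_neq0.
have M2 : adj M Z2.
  have -> : Z2 = c * (b - c2) / (b * c - c2 * c3).
    apply: (mulIf D0); rewrite divfK //; rewrite c2E c3E; by field; nonzero.
  by adjoin_mem.
by split=> //; rewrite e3; adjoin_mem.
Qed.

Section System.
Variables a b c : K.

(* [bij] stands for epsilon_ij = -1.  The unknowns are the squares Z_i of
   (x_i^2 - a_i) / (x_i^2 + a_i) and the invariants r_i of degree two over K(Z_1, Z_2, Z_3). *)
Definition twist_system (b12 b13 b21 b23 b31 b32 : bool) (Z1 Z2 Z3 r1 r2 r3 : F) : Prop :=
  [/\ [/\ a != 0, b != 0 & c != 0], indep [:: Z1; Z2; Z3],
      iota a * (1 - Z1) = Z2 ^+ b21 * Z3 ^+ b31 * r1 ^+ 2,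
      iota b * (1 - Z2) = Z1 ^+ b12 * Z3 ^+ b32 * r2 ^+ 2
    & iota c * (1 - Z3) = Z1 ^+ b13 * Z2 ^+ b23 * r3 ^+ 2].

Lemma indep3_neq Z1 Z2 Z3 : indep [:: Z1; Z2; Z3] ->
  [/\ forall f, adj (in_list [:: Z2; Z3]) f -> Z1 != f,
      forall f, adj (in_list [:: Z1; Z3]) f -> Z2 != f
    & forall f, adj (in_list [:: Z1; Z2]) f -> Z3 != f].
Proof.
move=> h; split=> f; apply: indep_neq => //.
  by apply: indep_perm h; rewrite /= -[[:: Z1; _; _]]/([:: Z1] ++ [:: Z2; Z3]) perm_catC.
by apply: indep_perm h; rewrite /= perm_cons -[[:: Z2; _]]/([:: Z2] ++ [:: Z3]) perm_catC.
Qed.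

Lemma twist_system_neq0 b12 b13 b21 b23 b31 b32 Z1 Z2 Z3 r1 r2 r3 :
  twist_system b12 b13 b21 b23 b31 b32 Z1 Z2 Z3 r1 r2 r3 ->
  [/\ [/\ iota a != 0, iota b != 0 & iota c != 0], [/\ Z1 != 0, Z2 != 0 & Z3 != 0],
      [/\ 1 - Z1 != 0, 1 - Z2 != 0 & 1 - Z3 != 0] & [/\ r1 != 0, r2 != 0 & r3 != 0]].
Proof.
move=> [[a0 b0 c0] /indep3_neq[n1 n2 n3] h1 h2 h3].
have [a1 [b1 c1]] : iota a != 0 /\ iota b != 0 /\ iota c != 0 by rewrite !fmorph_eq0.
have z1 : 1 - Z1 != 0 by rewrite subr_eq0 eq_sym n1 //; adjoin_mem.
have z2 : 1 - Z2 != 0 by rewrite subr_eq0 eq_sym n2 //; adjoin_mem.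
have z3 : 1 - Z3 != 0 by rewrite subr_eq0 eq_sym n3 //; adjoin_mem.
have sq0 (x y m r : F) : x != 0 -> y != 0 -> x * y = m * r ^+ 2 -> r != 0.
  move=> x0 y0 e; apply/eqP => r0; have := mulf_neq0 x0 y0.
  by rewrite e r0 expr2 !mulr0 eqxx.
by split; split=> //; rewrite ?n1 ?n2 ?n3 ?(sq0 _ _ _ _ _ _ h1) ?(sq0 _ _ _ _ _ _ h2) ?(sq0 _ _ _ _ _ _ h3) //; adjoin_mem.
Qed.

Local Notation all_gens Z1 Z2 Z3 r1 r2 r3 := (adj (in_list [:: Z1; Z2; Z3; r1; r2; r3])).

Lemma generated_by_r Z1 Z2 Z3 r1 r2 r3 :
  let M := in_list [:: r1; r2; r3] in adj M Z1 -> adj M Z2 -> adj M Z3 ->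
  three_generated (all_gens Z1 Z2 Z3 r1 r2 r3).
Proof.
by move=> M h1 h2 h3; apply: (@three_generated_list _ r1 r2 r3); rewrite /=; do !split; adjoin_mem.
Qed.

(** The signs form a directed graph with an edge from j to i when epsilon_ji = -1. Nothing points to
    1, so r1 alone gives Z1 and the rest is linear. *)
Lemma indegree_zero b12 b13 b23 b32 Z1 Z2 Z3 r1 r2 r3 :
  twist_system b12 b13 false b23 false b32 Z1 Z2 Z3 r1 r2 r3 ->
  three_generated (all_gens Z1 Z2 Z3 r1 r2 r3).
Proof.
move=> h; have [[a0 b0 c0] [z1 z2 z3] _ _] := twist_system_neq0 h.
case: h => _ /indep3_neq[_ _ n3] h1 h2 h3.
set M := in_list [:: r1; r2; r3].
have M1 : adj M Z1.
  have -> : Z1 = 1 - r1 ^+ 2 / iota a by rewrite -[r1 ^+ 2]mul1r -[1 * _]mul1r mulrA -h1; field.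
  by adjoin_mem.
have [M2 M3] : adj M Z2 /\ adj M Z3.
  apply: (@solve_pair M (iota b) (iota c) (Z1 ^+ b12 * r2 ^+ 2) (Z1 ^+ b13 * r3 ^+ 2) Z2 Z3 b32 b23) => //; try by adjoin_mem.
  - by apply: n3; adjoin_mem.
  - by rewrite h2; ring.
  - by rewrite h3; ring.
by apply: generated_by_r.
Qed.

(** No edge leaves 1, so the last two equations form a linear system for Z2 and Z3 alone. *)
Lemma closed_pair b21 b23 b31 b32 Z1 Z2 Z3 r1 r2 r3 :
  twist_system false false b21 b23 b31 b32 Z1 Z2 Z3 r1 r2 r3 ->
  three_generated (all_gens Z1 Z2 Z3 r1 r2 r3).
Proof.
move=> h; have [[a0 b0 c0] [z1 z2 z3] _ _] := twist_system_neq0 h.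
case: h => _ /indep3_neq[_ _ n3] h1 h2 h3.
set M := in_list [:: r1; r2; r3].
have [M2 M3] : adj M Z2 /\ adj M Z3.
  apply: (@solve_pair M (iota b) (iota c) (r2 ^+ 2) (r3 ^+ 2) Z2 Z3 b32 b23) => //; try by adjoin_mem.
  - by apply: n3; adjoin_mem.
  - by rewrite h2; ring.
  - by rewrite h3; ring.
have M1 : adj M Z1.
  have -> : Z1 = 1 - Z2 ^+ b21 * Z3 ^+ b31 * r1 ^+ 2 / iota a by rewrite -h1; field.
  by adjoin_mem.
by apply: generated_by_r.
Qed.

(** A cyclic linear system with determinant a b c + (r1 r2 r3)^2; its vanishing would be an
    algebraic relation between Z1, Z2 and Z3. *)
Lemma three_cycle Z1 Z2 Z3 r1 r2 r3 :
  twist_system true false false true true false Z1 Z2 Z3 r1 r2 r3 ->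
  three_generated (all_gens Z1 Z2 Z3 r1 r2 r3).
Proof.
move=> h; have [[a0 b0 c0] [z1 z2 z3] [y1 y2 y3] [r10 r20 r30]] := twist_system_neq0 h.
case: h => _ /indep3_neq[n1 n2 n3] h1 h2 h3.
rewrite ?expr1 ?expr0 ?mul1r ?mulr1 in h1 h2 h3.
set M := in_list [:: r1; r2; r3].
have eb : iota b = Z1 * r2 ^+ 2 / (1 - Z2) by rewrite -h2; field.
have ea : iota a = Z3 * r1 ^+ 2 / (1 - Z1) by rewrite -h1; field.
have ec : iota c = Z2 * r3 ^+ 2 / (1 - Z3) by rewrite -h3; field.
have n : Z2 + Z3 - 1 != 0.
  have : Z3 != 1 - Z2 by apply: n3; adjoin_mem.
  by apply: contra_neq => h; rewrite -[Z3]subr0 -h; ring.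
have D0 : iota a * iota b * iota c + (r1 * r2 * r3) ^+ 2 != 0.
  have : Z1 != (Z2 + Z3 - 1 - Z2 * Z3) / (Z2 + Z3 - 1) by apply: n1; adjoin_mem.
  apply: contra_neq => h.
  have : (iota a * iota b * iota c + (r1 * r2 * r3) ^+ 2) * ((1 - Z1) * (1 - Z2) * (1 - Z3)) = 0 by rewrite h mul0r.
  have -> : (iota a * iota b * iota c + (r1 * r2 * r3) ^+ 2) * ((1 - Z1) * (1 - Z2) * (1 - Z3)) =
    (r1 * r2 * r3) ^+ 2 * (Z1 * (Z2 + Z3 - 1) - (Z2 + Z3 - 1 - Z2 * Z3)).
    by rewrite ea eb ec; field; nonzero.
  move/eqP; rewrite mulf_eq0 expf_eq0 !mulf_eq0 (negPf r10) (negPf r20) (negPf r30) /= subr_eq0.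
  by move/eqP => e; apply: (mulIf n); rewrite divfK.
have M1 : adj M Z1.
  have -> : Z1 = iota b * (iota a * iota c - iota c * r1 ^+ 2 + r1 ^+ 2 * r3 ^+ 2) /
      (iota a * iota b * iota c + (r1 * r2 * r3) ^+ 2).
    by apply: (mulIf D0); rewrite divfK // ea eb ec; field; nonzero.
  by adjoin_mem.
have M2 : adj M Z2.
  have -> : Z2 = 1 - Z1 * r2 ^+ 2 / iota b by rewrite -h2; field.
  by adjoin_mem.
have M3 : adj M Z3.
  have -> : Z3 = 1 - Z2 * r3 ^+ 2 / iota c by rewrite -h3; field.
  by adjoin_mem.
by apply: generated_by_r.
Qed.

(** The first two equations are linear in Z1 and Z2, and r1 enters the solution only through rho =
    r1 r2. The third then becomes a conic in Z3 and r3 over K(r2, rho) with a rational point, and t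
    parametrizes it. *)
Lemma indegrees_211 Z1 Z2 Z3 r1 r2 r3 :
  twist_system true false true true true false Z1 Z2 Z3 r1 r2 r3 ->
  three_generated (all_gens Z1 Z2 Z3 r1 r2 r3).
Proof.
move=> h; have [[a0 b0 c0] [z1 z2 z3] [y1 y2 y3] [r10 r20 r30]] := twist_system_neq0 h.
case: h => _ /indep3_neq[n1 n2 n3] h1 h2 h3.
rewrite ?expr1 ?expr0 ?mul1r ?mulr1 in h1 h2 h3.
have ea : iota a = Z2 * Z3 * r1 ^+ 2 / (1 - Z1) by rewrite -h1; field.
have eb : iota b = Z1 * r2 ^+ 2 / (1 - Z2) by rewrite -h2; field.
have ec : iota c = Z2 * r3 ^+ 2 / (1 - Z3) by rewrite -h3; field.
pose rho := r1 * r2; pose E := iota a * iota b - Z3 * rho ^+ 2.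
pose B := iota b - r2 ^+ 2.
have B0 : B != 0.
  have : Z1 != 1 - Z2 by apply: n1; adjoin_mem.
  apply: contra_neq => h.
  have : B * (1 - Z2) = 0 by rewrite h mul0r.
  have -> : B * (1 - Z2) = r2 ^+ 2 * (Z1 - (1 - Z2)) by rewrite /B eb; field.
  by move/eqP; rewrite mulf_eq0 expf_eq0 (negPf r20) /= subr_eq0 => /eqP.
have E2 : Z2 * E = iota a * B by rewrite /E /B /rho ea eb; field; nonzero.
have E0 : E != 0.
  by have := mulf_neq0 a0 B0; rewrite -E2 mulf_eq0 (negPf z2).
(* Since Z2 E = a B, this is a B r3 / (1 - Z3), the slope of the line from the point Z3 = 1, r3 = 0
   in the coordinates Z3 and a B r3. *)
pose t := Z2 * r3 * E / (1 - Z3).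
have tE : t ^+ 2 * (1 - Z3) = iota a * iota c * B * E.
  have -> : iota a * iota c * B * E = iota c * E * (Z2 * E) by rewrite E2; ring.
  by rewrite /t ec; field.
have D0 : t ^+ 2 - iota a * iota c * B * rho ^+ 2 != 0.
  have : Z3 != (1 - Z1) * (1 - Z2) / (Z1 * Z2) by apply: n3; adjoin_mem.
  apply: contra_neq => h.
  have : (t ^+ 2 - iota a * iota c * B * rho ^+ 2) * (1 - Z3) = 0 by rewrite h mul0r.
  have -> : (t ^+ 2 - iota a * iota c * B * rho ^+ 2) * (1 - Z3) =
     iota a * iota c * B * (iota a * iota b - rho ^+ 2) by rewrite mulrBl tE /E; ring.
  move/eqP; rewrite !mulf_eq0 (negPf a0) (negPf c0) (negPf B0) /= => /eqP e.
  have : (iota a * iota b - rho ^+ 2) * (1 - Z1) * (1 - Z2) = 0 by rewrite e !mul0r.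
  have -> : (iota a * iota b - rho ^+ 2) * (1 - Z1) * (1 - Z2) =
     rho ^+ 2 * (Z3 * (Z1 * Z2) - (1 - Z1) * (1 - Z2)).
    by rewrite /rho ea eb; field; nonzero.
  move/eqP; rewrite mulf_eq0 expf_eq0 mulf_eq0 (negPf r10) (negPf r20) /= subr_eq0 => /eqP e'.
  by apply: (mulIf (mulf_neq0 z1 z2)); rewrite divfK ?mulf_neq0.
apply: (@three_generated_list _ r2 rho t).
  by rewrite /= /t /E /rho; do !split; adjoin_mem.
set M := in_list [:: r2; rho; t].
have mB : adj M B by rewrite /B; adjoin_mem.
have M3 : adj M Z3.
  have -> : Z3 = (t ^+ 2 - iota a * iota c * B * (iota a * iota b)) / (t ^+ 2 - iota a * iota c * B * rho ^+ 2).
    apply: (mulIf D0); rewrite divfK //; apply/eqP; rewrite -subr_eq0; apply/eqP.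
    transitivity (iota a * iota c * B * E - t ^+ 2 * (1 - Z3)); first by rewrite /E; ring.
    by rewrite tE subrr.
  by adjoin_mem.
have mE : adj M E by rewrite /E; adjoin_mem.
have M2 : adj M Z2.
  have -> : Z2 = iota a * B / E by rewrite -E2 mulfK.
  by adjoin_mem.
have M1 : adj M Z1.
  have -> : Z1 = iota b * (1 - Z2) / r2 ^+ 2 by rewrite h2 mulfK ?expf_neq0.
  by adjoin_mem.
have m1 : adj M r1.
  have -> : r1 = rho / r2 by rewrite /rho mulfK.
  by adjoin_mem.
have m3 : adj M r3.
  have -> : r3 = t * (1 - Z3) / (Z2 * E) by rewrite /t; field; nonzero.
  by adjoin_mem.
by rewrite /=; do !split; adjoin_mem.
Qed.

(** As before, but with Z3 included in rho: this makes the determinant E free of Z3 and B of degree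
    one in Z3, so that the third equation is again a conic with the point Z3 = 1, r3 = 0. *)
Lemma indegrees_221 Z1 Z2 Z3 r1 r2 r3 :
  twist_system true true true false true true Z1 Z2 Z3 r1 r2 r3 ->
  three_generated (all_gens Z1 Z2 Z3 r1 r2 r3).
Proof.
move=> h; have [[a0 b0 c0] [z1 z2 z3] [y1 y2 y3] [r10 r20 r30]] := twist_system_neq0 h.
case: h => _ /indep3_neq[n1 n2 n3] h1 h2 h3.
rewrite ?expr1 ?expr0 ?mul1r ?mulr1 in h1 h2 h3.
have ea : iota a = Z2 * Z3 * r1 ^+ 2 / (1 - Z1) by rewrite -h1; field.
have eb : iota b = Z1 * Z3 * r2 ^+ 2 / (1 - Z2) by rewrite -h2; field.
have ec : iota c = Z1 * r3 ^+ 2 / (1 - Z3) by rewrite -h3; field.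
pose rho := Z3 * r1 * r2; pose E := iota a * iota b - rho ^+ 2.
pose B := iota a - Z3 * r1 ^+ 2.
have E0 : E != 0.
  have : Z1 != 1 - Z2 by apply: n1; adjoin_mem.
  apply: contra_neq => h.
  have : E * (1 - Z1) * (1 - Z2) = 0 by rewrite h !mul0r.
  have -> : E * (1 - Z1) * (1 - Z2) = rho ^+ 2 * (Z1 - (1 - Z2)) by rewrite /E /rho ea eb; field; nonzero.
  move/eqP; rewrite mulf_eq0 expf_eq0 !mulf_eq0 (negPf z3) (negPf r10) (negPf r20) /= subr_eq0.
  by move=> /eqP.
have E1 : Z1 * E = iota b * B by rewrite /E /B /rho ea eb; field; nonzero.
pose t := Z1 * r3 * E / (1 - Z3).
have tE : t ^+ 2 * (1 - Z3) = iota b * iota c * B * E.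
  have -> : iota b * iota c * B * E = iota c * E * (Z1 * E) by rewrite E1; ring.
  by rewrite /t ec; field.
have D0 : t ^+ 2 - iota b * iota c * r1 ^+ 2 * E != 0.
  have : Z1 != 1 - Z2 * Z3 by apply: n1; adjoin_mem.
  apply: contra_neq => h.
  have : (t ^+ 2 - iota b * iota c * r1 ^+ 2 * E) * (1 - Z3) = 0 by rewrite h mul0r.
  have -> : (t ^+ 2 - iota b * iota c * r1 ^+ 2 * E) * (1 - Z3) =
     iota b * iota c * E * (iota a - r1 ^+ 2) by rewrite mulrBl tE /B; ring.
  move/eqP; rewrite !mulf_eq0 (negPf b0) (negPf c0) (negPf E0) /= => /eqP e.
  have : (iota a - r1 ^+ 2) * (1 - Z1) = 0 by rewrite e !mul0r.
  have -> : (iota a - r1 ^+ 2) * (1 - Z1) = r1 ^+ 2 * (Z1 - (1 - Z2 * Z3)).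
    by rewrite ea; field.
  by move/eqP; rewrite mulf_eq0 expf_eq0 (negPf r10) /= subr_eq0 => /eqP.
apply: (@three_generated_list _ r1 rho t).
  by rewrite /= /t /E /rho; do !split; adjoin_mem.
set M := in_list [:: r1; rho; t].
have mE : adj M E by rewrite /E; adjoin_mem.
have M3 : adj M Z3.
  have -> : Z3 = (t ^+ 2 - iota a * iota b * iota c * E) / (t ^+ 2 - iota b * iota c * r1 ^+ 2 * E).
    apply: (mulIf D0); rewrite divfK //; apply/eqP; rewrite -subr_eq0; apply/eqP.
    transitivity (iota b * iota c * B * E - t ^+ 2 * (1 - Z3)); first by rewrite /B; ring.
    by rewrite tE subrr.
  by adjoin_mem.
have mB : adj M B by rewrite /B; adjoin_mem.
have M1 : adj M Z1.
  have -> : Z1 = iota b * B / E by rewrite -E1 mulfK.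
  by adjoin_mem.
have m2 : adj M r2.
  have -> : r2 = rho / (Z3 * r1) by rewrite /rho; field; nonzero.
  by adjoin_mem.
have M2 : adj M Z2.
  have -> : Z2 = 1 - Z1 * Z3 * r2 ^+ 2 / iota b by rewrite -h2; field.
  by adjoin_mem.
have m3 : adj M r3.
  have -> : r3 = t * (1 - Z3) / (Z1 * E) by rewrite /t; field; nonzero.
  by adjoin_mem.
by rewrite /=; do !split; adjoin_mem.
Qed.
End System.

Section Symmetry.
Variables (a b c : K) (b12 b13 b21 b23 b31 b32 : bool) (Z1 Z2 Z3 r1 r2 r3 : F).

Lemma twist_system_swap12 : twist_system a b c b12 b13 b21 b23 b31 b32 Z1 Z2 Z3 r1 r2 r3 ->
  twist_system b a c b21 b23 b12 b13 b32 b31 Z2 Z1 Z3 r2 r1 r3.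
Proof.
move=> [[a0 b0 c0] h h1 h2 h3]; split=> //; last by rewrite h3 [X in X * _]mulrC.
by apply: indep_perm h; rewrite /= -[[:: Z1; _; _]]/([:: Z1] ++ [:: Z2] ++ [:: Z3]) perm_catCA.
Qed.

Lemma twist_system_swap23 : twist_system a b c b12 b13 b21 b23 b31 b32 Z1 Z2 Z3 r1 r2 r3 ->
  twist_system a c b b13 b12 b31 b32 b21 b23 Z1 Z3 Z2 r1 r3 r2.
Proof.
move=> [[a0 b0 c0] h h1 h2 h3]; split=> //; last by rewrite h1 [X in X * _]mulrC.
by apply: indep_perm h; rewrite /= perm_cons -[[:: Z2; _]]/([:: Z2] ++ [:: Z3]) perm_catC.
Qed.

Lemma all_gens_swap12 : three_generated (adj (in_list [:: Z2; Z1; Z3; r2; r1; r3])) ->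
  three_generated (adj (in_list [:: Z1; Z2; Z3; r1; r2; r3])).
Proof. by apply: three_generated_eq; apply: adjoin_eq; rewrite /=; do !split; adjoin_mem. Qed.

Lemma all_gens_swap23 : three_generated (adj (in_list [:: Z1; Z3; Z2; r1; r3; r2])) ->
  three_generated (adj (in_list [:: Z1; Z2; Z3; r1; r2; r3])).
Proof. by apply: three_generated_eq; apply: adjoin_eq; rewrite /=; do !split; adjoin_mem. Qed.
End Symmetry.

Ltac direct_case h := solve [ apply: indegree_zero h | apply: closed_pair h | apply: three_cycle h
  | apply: indegrees_211 h | apply: indegrees_221 h ].
(** The two transpositions generate all relabellings of 1, 2, 3, so alternating words of bounded
    length in them are tried. *)
Ltac permuted_case h := first [ direct_case h
  | apply: all_gens_swap12; permuted12 (twist_system_swap12 h)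
  | apply: all_gens_swap23; permuted23 (twist_system_swap23 h) ]
with permuted12 h := first [ direct_case h | apply: all_gens_swap23; permuted23 (twist_system_swap23 h) ]
with permuted23 h := first [ direct_case h | apply: all_gens_swap12; permuted12' (twist_system_swap12 h) ]
with permuted12' h := first [ direct_case h | apply: all_gens_swap23; direct_case (twist_system_swap23 h) ].

Definition exceptional_graph (b12 b13 b21 b23 b31 b32 : bool) : bool :=
  [|| [&& b12, b21, b13, b31, b23 & b32], [&& ~~ b12, ~~ b21, b13, b31, b23 & b32],
      [&& ~~ b13, ~~ b31, b12, b21, b23 & b32] | [&& ~~ b23, ~~ b32, b12, b21, b13 & b31]].

Lemma nonexceptional_three_generated a b c b12 b13 b21 b23 b31 b32 Z1 Z2 Z3 r1 r2 r3 :
  twist_system a b c b12 b13 b21 b23 b31 b32 Z1 Z2 Z3 r1 r2 r3 ->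
  ~~ exceptional_graph b12 b13 b21 b23 b31 b32 ->
  three_generated (adj (in_list [:: Z1; Z2; Z3; r1; r2; r3])).
Proof.
by case: b12 b13 b21 b23 b31 b32 => [] [] [] [] [] [] h //= _; permuted_case h.
Qed.
End ThreeGenerators.

(** * Rationality of the pencil when a product of its parameters is a square *)

Section Pencil.
Variables (K F : fieldType) (iota : {rmorphism K -> F}) (L : F -> Prop).
Local Notation adj := (adjoin iota).
Local Notation indep := (seq_indep iota (@no_gen F)).

Definition pencil_presentation (a b c : K) (S u v w : F) : Prop :=
  [/\ indep [:: S; u; v],
      w ^+ 2 = (S + iota a) * (u ^+ 2 * S + iota b) * (v ^+ 2 * S + iota c)
    & forall f, L f <-> adj (in_list [:: S; u; v; w]) f].

Lemma pencil_neq0 a b c S u v w : pencil_presentation a b c S u v w ->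
  [/\ S != 0, u != 0, v != 0, S + iota a != 0 & [/\ u ^+ 2 * S + iota b != 0, v ^+ 2 * S + iota c != 0 & w != 0]].
Proof.
move=> [/indep3_neq[n1 n2 n3] hw _].
have S0 : S != 0 by apply: n1; adjoin_mem.
have u0 : u != 0 by apply: n2; adjoin_mem.
have v0 : v != 0 by apply: n3; adjoin_mem.
have Sa : S + iota a != 0 by rewrite addr_eq0; apply: n1; adjoin_mem.
have Sb : u ^+ 2 * S + iota b != 0.
  have : S != - iota b / u ^+ 2 by apply: n1; adjoin_mem.
  apply: contra_neq => h; apply: (mulIf (expf_neq0 2 u0)); rewrite divfK ?expf_neq0 //.
  by apply/eqP; rewrite -addr_eq0 mulrC h.
have Sc : v ^+ 2 * S + iota c != 0.
  have : S != - iota c / v ^+ 2 by apply: n1; adjoin_mem.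
  apply: contra_neq => h; apply: (mulIf (expf_neq0 2 v0)); rewrite divfK ?expf_neq0 //.
  by apply/eqP; rewrite -addr_eq0 mulrC h.
split=> //; split=> //; have : w ^+ 2 != 0 by rewrite hw !mulf_neq0.
by rewrite expf_eq0.
Qed.

(** Only the square class of S matters: with u^2 S in place of S the first two factors exchange
    their roles. *)
Lemma pencil_swap12 a b c S u v w : pencil_presentation a b c S u v w ->
  pencil_presentation b a c (u ^+ 2 * S) u^-1 (v / u) w.
Proof.
move=> h; have [S0 u0 v0 _ _] := pencil_neq0 h; case: h => hi hw hL.
set A := in_list [:: u ^+ 2 * S; u^-1; v / u; w].
set B := in_list [:: u ^+ 2 * S; u^-1; v / u].
have M1 : adj B u by rewrite -[u]invrK; adjoin_mem.
have M2 : adj B S.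
  have -> : S = (u ^+ 2 * S) / u ^+ 2 by rewrite mulrAC mulfV ?mul1r ?expf_neq0.
  by adjoin_mem.
have M3 : adj B v.
  have -> : v = (v / u) * u by rewrite divfK.
  by adjoin_mem.
have BA f : adj B f -> adj A f.
  by apply: adjoin_sub => g hg; apply: adjoin_gen; move: hg; rewrite /B /A /in_list !inE => /or3P[]->; rewrite ?orbT.
split.
- by apply: (indep_adjoin hi) => //=; do !split.
- by rewrite hw; field.
- move=> f; rewrite hL; apply: adjoin_eq; rewrite /=; first by split; [exact: BA|split; [exact: BA|split; [exact: BA|split=> //; adjoin_mem]]].
  by do !split; adjoin_mem.
Qed.

Lemma pencil_swap23 a b c S u v w : pencil_presentation a b c S u v w ->
  pencil_presentation a c b S v u w.
Proof.
move=> [hi hw hL]; split.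
- by apply: (indep_adjoin hi) => //=; do !split; adjoin_mem.
- by rewrite hw; ring.
- by move=> f; rewrite hL; apply: adjoin_eq; rewrite /=; do !split; adjoin_mem.
Qed.

Lemma adjoin_algebraic_sqrt A f : adj (alg_over iota A) (f ^+ 2) -> adj (alg_over iota A) f.
Proof. by move=> /alg_over_closed/alg_over_sqrt; apply: adjoin_gen. Qed.

(** Three independent elements are not algebraic over two; this rules out vanishing denominators in
    the projections below. *)
Lemma pencil_two_generators a b c S u v w y z : pencil_presentation a b c S u v w ->
  adj (alg_over iota (in_list [:: y; z])) S -> adj (alg_over iota (in_list [:: y; z])) u ->
  adj (alg_over iota (in_list [:: y; z])) v -> False.
Proof.
move=> [hi _ _] hS hu hv; apply: (@indep_size _ _ iota _ [:: y; z] hi) => // f.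
by rewrite !inE => /or3P[] /eqP->; apply: alg_over_closed.
Qed.

(* With r = w / (v^2 S + c), the pencil becomes the quadric
   c r^2 + S (r v)^2 = (S + a) (S u^2 + b) over K(S), and each of the three
   square conditions provides a point from which to project. *)
Lemma pencil_quadric a b c S u v w : pencil_presentation a b c S u v w ->
  let r := w / (v ^+ 2 * S + iota c) in
  iota c * r ^+ 2 + S * (r * v) ^+ 2 = (S + iota a) * (u ^+ 2 * S + iota b).
Proof.
move=> h r; have [_ _ _ _ [_ V0 _]] := pencil_neq0 h; case: h => _ hw _.
transitivity (w ^+ 2 / (v ^+ 2 * S + iota c)); first by rewrite /r; field.
by rewrite hw mulfK.
Qed.

(** With c r^2 = a b x^2 the quadric at S = 0 reads x^2 = 1. Substituting x = 1 + S t and cancelling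
    S leaves an equation of degree one in S over K(t, y, u). *)
Lemma pencil_rational_abc a b c k S u v w : a != 0 -> b != 0 -> c != 0 -> k ^+ 2 = a * b * c ->
  pencil_presentation a b c S u v w -> three_generated iota L.
Proof.
move=> a0 b0 c0 hk h; have [S0 u0 v0 Sa [Sb V0 w0]] := pencil_neq0 h.
have hq := pencil_quadric h; have no2 := pencil_two_generators h; case: h => hi hw hL.
have k0 : k != 0 by rewrite -sqrf_eq0 hk !mulf_neq0.
have [a1 b1 k1] : [/\ iota a != 0, iota b != 0 & iota k != 0] by rewrite !fmorph_eq0.
have hk' : iota k ^+ 2 = iota a * iota b * iota c by rewrite -rmorphXn hk !rmorphM.
set V := v ^+ 2 * S + iota c in V0 hq; set r := w / V in hq; pose y := r * v.
have r0 : r != 0 by rewrite mulf_neq0 ?invr_neq0.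
pose x := iota k * r / (iota a * iota b); pose t := (x - 1) / S.
have rE : r = iota a * iota b * x / iota k by rewrite /x; field; nonzero.
have xE : x = 1 + S * t by rewrite /t; field.
have x2 : iota a * iota b * x ^+ 2 = iota c * r ^+ 2.
  rewrite /x expr_div_n exprMn hk'; by field; nonzero.
have key : S * (iota a * iota b * t ^+ 2 - u ^+ 2) =
    iota b + iota a * u ^+ 2 - y ^+ 2 - iota a * iota b * t *+ 2.
  apply: (mulfI S0); apply/eqP; rewrite -subr_eq0; apply/eqP.
  transitivity (iota a * iota b * (1 + S * t) ^+ 2 + S * y ^+ 2 - (S + iota a) * (u ^+ 2 * S + iota b)).
    by ring.
  by rewrite -xE x2 hq subrr.
have vE : v = y / r by rewrite /y; field.
(* If the coefficient of S vanished, u and y, hence v, would be algebraic over K(S, t), against the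
   independence of S, u, v. *)
have D0 : iota a * iota b * t ^+ 2 - u ^+ 2 != 0.
  apply/eqP => e; move: key; rewrite e mulr0 => key.
  have mS : adj (alg_over iota (in_list [:: S; t])) S.
    by apply: adjoin_gen; apply: alg_over_adjoin; adjoin_mem.
  have mt : adj (alg_over iota (in_list [:: S; t])) t.
    by apply: adjoin_gen; apply: alg_over_adjoin; adjoin_mem.
  have mu : adj (alg_over iota (in_list [:: S; t])) u.
    apply: adjoin_algebraic_sqrt; have -> : u ^+ 2 = iota a * iota b * t ^+ 2 by rewrite -[LHS]addr0 -e; ring.
    by adjoin_mem.
  have my : adj (alg_over iota (in_list [:: S; t])) y.
    apply: adjoin_algebraic_sqrt.
    have -> : y ^+ 2 = iota b + iota a * u ^+ 2 - iota a * iota b * t * 2%:R.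
      by rewrite -[LHS]addr0 key mulr_natr; ring.
    by adjoin_mem.
  apply: (no2 S t) => //; rewrite vE rE xE; by adjoin_mem.
apply: three_generated_eq (fun f => iff_sym (hL f)) _.
apply: (@three_generated_list _ _ _ _ t y u).
  by rewrite /= /t /x /y /r /V; do !split; adjoin_mem.
set M := in_list [:: t; y; u].
have mS : adj M S.
  have -> : S = (iota b + iota a * u ^+ 2 - y ^+ 2 - iota a * iota b * t * 2%:R) /
     (iota a * iota b * t ^+ 2 - u ^+ 2) by rewrite mulr_natr -key mulfK.
  by adjoin_mem.
have mr : adj M r by rewrite rE xE; adjoin_mem.
have mv : adj M v by rewrite vE; adjoin_mem.
have mw : adj M w.
  have -> : w = r * V by rewrite /r divfK.
  by rewrite /V; adjoin_mem.
by rewrite /=; do !split; adjoin_mem.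
Qed.

(** The coordinates r / u, r v / u, 1 / u are written as S y0, k + S y1, S y3; since a = k^2 the
    equation becomes divisible by S^2, and the quotient has degree one in S. *)
Lemma pencil_rational_a a b c k S u v w : c != 0 -> k ^+ 2 = a ->
  pencil_presentation a b c S u v w -> three_generated iota L.
Proof.
move=> c0 hk h; have [S0 u0 v0 Sa [Sb V0 w0]] := pencil_neq0 h.
have hq := pencil_quadric h; have no2 := pencil_two_generators h; case: h => hi hw hL.
have c1 : iota c != 0 by rewrite fmorph_eq0.
have hk' : iota k ^+ 2 = iota a by rewrite -rmorphXn hk.
set V := v ^+ 2 * S + iota c in V0 hq; set r := w / V in hq.
have r0 : r != 0 by rewrite mulf_neq0 ?invr_neq0.
pose y0 := r / (u * S); pose y3 := (u * S)^-1; pose y1 := (r * v / u - iota k) / S.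
have uE : u = (S * y3)^-1.
  have -> : S * y3 = u^-1 by rewrite /y3; field; nonzero.
  by rewrite invrK.
have rE : r = S * y0 * u by rewrite /y0; field; nonzero.
have vE : v = (iota k + S * y1) * u / r by rewrite /y1; field; nonzero.
have key : S * (y1 ^+ 2 - iota b * y3 ^+ 2) =
    1 + iota a * iota b * y3 ^+ 2 - iota c * y0 ^+ 2 - iota k * y1 *+ 2.
  apply: (mulfI (expf_neq0 2 (mulf_neq0 u0 S0))); apply/eqP; rewrite -subr_eq0; apply/eqP.
  transitivity (iota c * r ^+ 2 + S * (r * v) ^+ 2 - (S + iota k ^+ 2) * (u ^+ 2 * S + iota b)).
    by rewrite /y0 /y1 /y3 -hk'; field; nonzero.
  by rewrite hk' hq subrr.
have D0 : y1 ^+ 2 - iota b * y3 ^+ 2 != 0.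
  apply/eqP => e; move: key; rewrite e mulr0 => key.
  have mS : adj (alg_over iota (in_list [:: S; y3])) S.
    by apply: adjoin_gen; apply: alg_over_adjoin; adjoin_mem.
  have m3 : adj (alg_over iota (in_list [:: S; y3])) y3.
    by apply: adjoin_gen; apply: alg_over_adjoin; adjoin_mem.
  have m1 : adj (alg_over iota (in_list [:: S; y3])) y1.
    apply: adjoin_algebraic_sqrt; have -> : y1 ^+ 2 = iota b * y3 ^+ 2 by rewrite -[RHS]addr0 -e; ring.
    by adjoin_mem.
  have m0 : adj (alg_over iota (in_list [:: S; y3])) y0.
    apply: adjoin_algebraic_sqrt.
    have -> : y0 ^+ 2 = (1 + iota a * iota b * y3 ^+ 2 - iota k * y1 * 2%:R) / iota c.
      apply: (mulIf c1); rewrite divfK // -[LHS]addr0 key mulr_natr; ring.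
    by adjoin_mem.
  have mu : adj (alg_over iota (in_list [:: S; y3])) u by rewrite uE; apply: adjoin_inv; apply: adjoin_mul.
  have mr : adj (alg_over iota (in_list [:: S; y3])) r by rewrite rE; adjoin_mem.
  by apply: (no2 S y3) => //; rewrite vE; adjoin_mem.
apply: three_generated_eq (fun f => iff_sym (hL f)) _.
apply: (@three_generated_list _ _ _ _ y0 y1 y3).
  by rewrite /= /y0 /y1 /y3 /r /V; do !split; adjoin_mem.
set M := in_list [:: y0; y1; y3].
have mS : adj M S.
  have -> : S = (1 + iota a * iota b * y3 ^+ 2 - iota c * y0 ^+ 2 - iota k * y1 * 2%:R) /
     (y1 ^+ 2 - iota b * y3 ^+ 2) by rewrite mulr_natr -key mulfK.
  by adjoin_mem.
have mu : adj M u by rewrite uE; apply: adjoin_inv; apply: adjoin_mul; adjoin_mem.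
have mr : adj M r by rewrite rE; adjoin_mem.
have mv : adj M v by rewrite vE; adjoin_mem.
have mw : adj M w.
  have -> : w = r * V by rewrite /r divfK.
  by rewrite /V; adjoin_mem.
by rewrite /=; do !split; adjoin_mem.
Qed.

(** The analogue at s = S + a = 0, with r / u, r v / u, 1 / u equal to s y0, s y1, k + s y3; since a
    = b k^2 the equation is divisible by s^2, and the quotient has degree one in s. *)
Lemma pencil_rational_ab a b c k S u v w : c != 0 -> b * k ^+ 2 = a ->
  pencil_presentation a b c S u v w -> three_generated iota L.
Proof.
move=> c0 hk h; have [S0 u0 v0 Sa [Sb V0 w0]] := pencil_neq0 h.
have hq := pencil_quadric h; have no2 := pencil_two_generators h; case: h => hi hw hL.
have c1 : iota c != 0 by rewrite fmorph_eq0.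
have hk' : iota b * iota k ^+ 2 = iota a by rewrite -rmorphXn -rmorphM hk.
set V := v ^+ 2 * S + iota c in V0 hq; set r := w / V in hq.
have r0 : r != 0 by rewrite mulf_neq0 ?invr_neq0.
pose s := S + iota a.
pose y0 := r / (u * s); pose y3 := (u^-1 - iota k) / s; pose y1 := r * v / (u * s).
have SE : S = s - iota a by rewrite /s; ring.
have uE : u = (iota k + s * y3)^-1.
  have -> : iota k + s * y3 = u^-1 by rewrite /y3; field; nonzero.
  by rewrite invrK.
have rE : r = s * y0 * u by rewrite /y0; field; nonzero.
have vE : v = s * y1 * u / r by rewrite /y1; field; nonzero.
have key : s * (y1 ^+ 2 - iota b * y3 ^+ 2) =
    1 + iota b * iota k * y3 *+ 2 - iota c * y0 ^+ 2 + iota a * y1 ^+ 2.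
  apply: (mulfI (expf_neq0 2 (mulf_neq0 u0 Sa))); apply/eqP; rewrite -subr_eq0; apply/eqP.
  transitivity (iota c * r ^+ 2 + S * (r * v) ^+ 2 - s * (u ^+ 2 * (s - iota b * iota k ^+ 2) + iota b)).
    by rewrite /y0 /y1 /y3 [in S * _]SE -/s; field; nonzero.
  by rewrite hk' -SE hq subrr.
have D0 : y1 ^+ 2 - iota b * y3 ^+ 2 != 0.
  apply/eqP => e; move: key; rewrite e mulr0 => key.
  have ms : adj (alg_over iota (in_list [:: s; y3])) s.
    by apply: adjoin_gen; apply: alg_over_adjoin; adjoin_mem.
  have mS : adj (alg_over iota (in_list [:: s; y3])) S by rewrite SE; adjoin_mem.
  have m3 : adj (alg_over iota (in_list [:: s; y3])) y3.
    by apply: adjoin_gen; apply: alg_over_adjoin; adjoin_mem.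
  have m1 : adj (alg_over iota (in_list [:: s; y3])) y1.
    apply: adjoin_algebraic_sqrt; have -> : y1 ^+ 2 = iota b * y3 ^+ 2 by rewrite -[RHS]addr0 -e; ring.
    by adjoin_mem.
  have m0 : adj (alg_over iota (in_list [:: s; y3])) y0.
    apply: adjoin_algebraic_sqrt.
    have -> : y0 ^+ 2 = (1 + iota b * iota k * y3 * 2%:R + iota a * y1 ^+ 2) / iota c.
      apply: (mulIf c1); rewrite divfK // -[LHS]addr0 key mulr_natr; ring.
    by adjoin_mem.
  have mu : adj (alg_over iota (in_list [:: s; y3])) u by rewrite uE; adjoin_mem.
  have mr : adj (alg_over iota (in_list [:: s; y3])) r by rewrite rE; adjoin_mem.
  by apply: (no2 s y3) => //; rewrite vE; adjoin_mem.
apply: three_generated_eq (fun f => iff_sym (hL f)) _.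
apply: (@three_generated_list _ _ _ _ y0 y1 y3).
  by rewrite /= /y0 /y1 /y3 /r /V /s; do !split; adjoin_mem.
set M := in_list [:: y0; y1; y3].
have ms : adj M s.
  have -> : s = (1 + iota b * iota k * y3 * 2%:R - iota c * y0 ^+ 2 + iota a * y1 ^+ 2) /
     (y1 ^+ 2 - iota b * y3 ^+ 2) by rewrite mulr_natr -key mulfK.
  by adjoin_mem.
have mS : adj M S by rewrite SE; adjoin_mem.
have mu : adj M u by rewrite uE; adjoin_mem.
have mr : adj M r by rewrite rE; adjoin_mem.
have mv : adj M v by rewrite vE; adjoin_mem.
have mw : adj M w.
  have -> : w = r * V by rewrite /r divfK.
  by rewrite /V; adjoin_mem.
by rewrite /=; do !split; adjoin_mem.
Qed.

(** The swaps permute a, b, c, so the seven nontrivial products reduce to a b c, a b and a. *)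
Lemma pencil_rational a b c (i j l : bool) k S u v w : a != 0 -> b != 0 -> c != 0 ->
  i || j || l -> k ^+ 2 = a ^+ i * b ^+ j * c ^+ l ->
  pencil_presentation a b c S u v w -> three_generated iota L.
Proof.
have half (x y z : K) : y != 0 -> z ^+ 2 = x * y -> y * (z / y) ^+ 2 = x.
  by move=> y0 e; rewrite expr_div_n e; field.
move=> a0 b0 c0; case: i j l => [] [] [] //= _; rewrite ?expr1 ?expr0 ?mulr1 ?mul1r => hk h.
- exact: pencil_rational_abc hk h.
- exact: pencil_rational_ab c0 (half _ _ _ b0 hk) h.
- exact: pencil_rational_ab b0 (half _ _ _ c0 hk) (pencil_swap23 h).
- exact: pencil_rational_a c0 hk h.
- exact: pencil_rational_ab a0 (half _ _ _ c0 hk) (pencil_swap23 (pencil_swap12 h)).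
- exact: pencil_rational_a c0 hk (pencil_swap12 h).
- exact: pencil_rational_a b0 hk (pencil_swap12 (pencil_swap23 h)).
Qed.
End Pencil.

(** * The invariant field for exceptional signs as a pencil *)

Section NormalForms.
Variables (K F : fieldType) (iota : {rmorphism K -> F}) (a b c : K) (Z1 Z2 Z3 r1 r2 r3 : F).
Local Notation adj := (adjoin iota).
Local Notation L := (adj (in_list [:: Z1; Z2; Z3; r1; r2; r3])).

(** The three elements a_i Z_i / (1 - Z_i) all have the square class of Z1 Z2 Z3, which makes them
    S, u^2 S and v^2 S. *)
Lemma complete_graph_pencil : twist_system iota a b c true true true true true true Z1 Z2 Z3 r1 r2 r3 ->
  exists S u v w, pencil_presentation iota L a b c S u v w.
Proof.
move=> h; have [[a0 b0 c0] [z1 z2 z3] [y1 y2 y3] [r10 r20 r30]] := twist_system_neq0 h.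
case: h => _ hi h1 h2 h3; rewrite ?expr1 in h1 h2 h3.
have ea : iota a = Z2 * Z3 * r1 ^+ 2 / (1 - Z1) by rewrite -h1; field.
have eb : iota b = Z1 * Z3 * r2 ^+ 2 / (1 - Z2) by rewrite -h2; field.
have ec : iota c = Z1 * Z2 * r3 ^+ 2 / (1 - Z3) by rewrite -h3; field.
pose S := iota a * Z1 / (1 - Z1).
pose u := iota b * Z2 * r1 / (iota a * Z1 * r2).
pose v := iota c * Z3 * r1 / (iota a * Z1 * r3).
pose w := iota a * iota b * iota c / (Z1 * Z2 * Z3 * r1 * r2 * r3).
have SaE : S + iota a = iota a / (1 - Z1) by rewrite /S; field.
have uS : u ^+ 2 * S = iota b * Z2 / (1 - Z2).
  by rewrite /u /S ea eb; field; nonzero.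
have vS : v ^+ 2 * S = iota c * Z3 / (1 - Z3).
  by rewrite /v /S ea ec; field; nonzero.
have Z1E : Z1 = S / (S + iota a) by rewrite SaE /S; field; nonzero.
have Z2E : Z2 = (u ^+ 2 * S) / (u ^+ 2 * S + iota b).
  have -> : u ^+ 2 * S + iota b = iota b / (1 - Z2) by rewrite uS; field.
  by rewrite uS; field; nonzero.
have Z3E : Z3 = (v ^+ 2 * S) / (v ^+ 2 * S + iota c).
  have -> : v ^+ 2 * S + iota c = iota c / (1 - Z3) by rewrite vS; field.
  by rewrite vS; field; nonzero.
have u0 : u != 0 by rewrite !mulf_neq0 ?invr_neq0 ?mulf_neq0.
have v0 : v != 0 by rewrite !mulf_neq0 ?invr_neq0 ?mulf_neq0.
have w0 : w != 0 by rewrite !mulf_neq0 ?invr_neq0 ?mulf_neq0.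
exists S, u, v, w; split.
- apply: (indep_adjoin hi) => //=; set M := in_list [:: S; u; v].
  by do !split => //; rewrite ?Z1E ?Z2E ?Z3E; adjoin_mem.
- rewrite SaE uS vS /w ea eb ec; by field; nonzero.
- apply: adjoin_eq; last by rewrite /= /S /u /v /w; do !split; adjoin_mem.
  set M := in_list [:: S; u; v; w].
  have M1 : adj M Z1 by rewrite Z1E; adjoin_mem.
  have M2 : adj M Z2 by rewrite Z2E; adjoin_mem.
  have M3 : adj M Z3 by rewrite Z3E; adjoin_mem.
  have m1 : adj M r1.
    (* The first three factors are r1 r2 r3, r1 / r2 and r1 / r3, with product r1^3, and the divisor
       is r1^2. *)
    have -> : r1 = (iota a * iota b * iota c / (w * Z1 * Z2 * Z3)) *
        ((iota a * Z1 * u) / (iota b * Z2)) * ((iota a * Z1 * v) / (iota c * Z3)) /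
        (iota a * (1 - Z1) / (Z2 * Z3)).
      rewrite h1 /w /u /v; by field; nonzero.
    by adjoin_mem.
  have m2 : adj M r2.
    have -> : r2 = iota b * Z2 * r1 / (iota a * Z1 * u) by rewrite /u; field; nonzero.
    by adjoin_mem.
  have m3 : adj M r3.
    have -> : r3 = iota c * Z3 * r1 / (iota a * Z1 * v) by rewrite /v; field; nonzero.
    by adjoin_mem.
  by rewrite /=; do !split; adjoin_mem.
Qed.

(** Here -a c / (1 - Z1), -b c / (1 - Z2) and -c Z3 share the square class of -c Z3; adding a c, b c
    and c to them gives a product that is a square. *)
Lemma path_graph_pencil : twist_system iota a b c false true false true true true Z1 Z2 Z3 r1 r2 r3 ->
  exists S u v w, pencil_presentation iota L (a * c) (b * c) c S u v w.
Proof.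
move=> h; have [[a0 b0 c0] [z1 z2 z3] [y1 y2 y3] [r10 r20 r30]] := twist_system_neq0 h.
case: h => _ hi h1 h2 h3; rewrite ?expr1 ?expr0 ?mul1r in h1 h2 h3.
have ea : iota a = Z3 * r1 ^+ 2 / (1 - Z1) by rewrite -h1; field.
have eb : iota b = Z3 * r2 ^+ 2 / (1 - Z2) by rewrite -h2; field.
have ec : iota c = Z1 * Z2 * r3 ^+ 2 / (1 - Z3) by rewrite -h3; field.
pose S := - (iota a * iota c) / (1 - Z1).
pose u := iota b * r1 / (iota a * r2).
pose v := Z3 * r1 / iota a.
pose w := iota a * iota b * iota c * Z1 * Z2 * r3 / (Z3 * r1 * r2).
have uS : u ^+ 2 * S = - (iota b * iota c) / (1 - Z2).
  by rewrite /u /S ea eb; field; nonzero.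
have vS : v ^+ 2 * S = - (iota c * Z3) by rewrite /v /S ea; field; nonzero.
have Z3E : Z3 = - (v ^+ 2 * S) / iota c by rewrite vS; field.
have r1E : r1 = iota a * v / Z3 by rewrite /v; field; nonzero.
have u0 : u != 0 by rewrite !mulf_neq0 ?invr_neq0 ?mulf_neq0.
have r2E : r2 = iota b * r1 / (iota a * u) by rewrite /u; field; nonzero.
have Z1E : Z1 = 1 - Z3 * r1 ^+ 2 / iota a by rewrite -h1; field.
have Z2E : Z2 = 1 - Z3 * r2 ^+ 2 / iota b by rewrite -h2; field.
exists S, u, v, w; split.
- apply: (indep_adjoin hi) => //=; set M := in_list [:: S; u; v].
  have M3 : adj M Z3 by rewrite Z3E; adjoin_mem.
  have m1 : adj M r1 by rewrite r1E; adjoin_mem.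
  have m2 : adj M r2 by rewrite r2E; adjoin_mem.
  by do !split => //; rewrite ?Z1E ?Z2E; adjoin_mem.
- rewrite uS vS /w /S !rmorphM ea eb ec; by field; nonzero.
- apply: adjoin_eq; last by rewrite /= /S /u /v /w; do !split; adjoin_mem.
  set M := in_list [:: S; u; v; w].
  have M3 : adj M Z3 by rewrite Z3E; adjoin_mem.
  have m1 : adj M r1 by rewrite r1E; adjoin_mem.
  have m2 : adj M r2 by rewrite r2E; adjoin_mem.
  have M1 : adj M Z1 by rewrite Z1E; adjoin_mem.
  have M2 : adj M Z2 by rewrite Z2E; adjoin_mem.
  have m3 : adj M r3.
    have -> : r3 = w * (Z3 * r1 * r2) / (iota a * iota b * iota c * Z1 * Z2) by rewrite /w; field; nonzero.
    by adjoin_mem.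
  by rewrite /=; do !split; adjoin_mem.
Qed.
End NormalForms.

(** * The field of invariants *)

Section FixedFields.
Variables (K F : fieldType) (iota : {rmorphism K -> F}).
Local Notation adj := (adjoin iota).

Lemma fixed_adjoin (s : {rmorphism F -> F}) A f : (forall k, s (iota k) = iota k) ->
  (forall g, A g -> s g = g) -> adj A f -> s f = f.
Proof.
move=> hk hA; elim=> [//|//|g h _ e _ e'|g _ e|g h _ e _ e'|g _ e].
- by rewrite rmorphD e e'.
- by rewrite rmorphN e.
- by rewrite rmorphM e e'.
- by rewrite fmorphV e.
Qed.

(** Every element of A(z) has the form f0 + f1 z, and s acts as the conjugation of this quadratic
    extension. *)
Lemma quadratic_fixed (s : {rmorphism F -> F}) A z f : (2%:R : K) != 0 ->
  (forall k, s (iota k) = iota k) -> (forall g, A g -> s g = g) ->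
  adj A (z ^+ 2) -> z != 0 -> s z = - z -> adj (fun g => A g \/ g = z) f -> s f = f -> adj A f.
Proof.
move=> two0 hk hA hz z0 sz hf sf.
have fx g : adj A g -> s g = g by apply: fixed_adjoin.
have [f0 [f1 [h0 h1 fE]]] : exists f0 f1, [/\ adj A f0, adj A f1 & f = f0 + f1 * z].
  elim: hf => [k|g [Ag|->]|g h _ [g0 [g1 [m0 m1 ->]]] _ [g2 [g3 [m2 m3 ->]]]|
    g _ [g0 [g1 [m0 m1 ->]]]|g h _ [g0 [g1 [m0 m1 ->]]] _ [g2 [g3 [m2 m3 ->]]]|g _ [g0 [g1 [m0 m1 ->]]]].
  - by exists (iota k), 0; split; [apply: adjoin_base|apply: adjoin0|rewrite mul0r addr0].
  - by exists g, 0; split; [apply: adjoin_gen|apply: adjoin0|rewrite mul0r addr0].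
  - by exists 0, 1; split; [apply: adjoin0|apply: adjoin1|rewrite mul1r add0r].
  - by exists (g0 + g2), (g1 + g3); split; [apply: adjoin_add|apply: adjoin_add|ring].
  - by exists (- g0), (- g1); split; [apply: adjoin_opp|apply: adjoin_opp|ring].
  - exists (g0 * g2 + g1 * g3 * z ^+ 2), (g0 * g3 + g1 * g2); split; last by ring.
      by adjoin_mem.
    by adjoin_mem.
  - have [e|e] := eqVneq (g0 + g1 * z) 0.
      by exists 0, 0; split; [apply: adjoin0|apply: adjoin0|rewrite e invr0 mul0r addr0].
    have e' : g0 - g1 * z != 0.
      have -> : g0 - g1 * z = s (g0 + g1 * z) by rewrite rmorphD rmorphM (fx g0) // (fx g1) // sz mulrN.
      by rewrite fmorph_eq0.
    have e2 : g0 ^+ 2 - g1 ^+ 2 * z ^+ 2 != 0.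
      have -> : g0 ^+ 2 - g1 ^+ 2 * z ^+ 2 = (g0 + g1 * z) * (g0 - g1 * z) by ring.
      by rewrite mulf_neq0.
    exists (g0 / (g0 ^+ 2 - g1 ^+ 2 * z ^+ 2)), (- g1 / (g0 ^+ 2 - g1 ^+ 2 * z ^+ 2)).
    split; [by adjoin_mem|by adjoin_mem|].
    apply: (mulfI e); rewrite mulfV // -(mulfV e2); move: (_^-1) => y; ring.
move: sf; rewrite fE rmorphD rmorphM (fx f0) // (fx f1) // sz mulrN => /addrI/eqP.
rewrite eq_sym -addr_eq0 -mulr2n -mulr_natl mulf_eq0 -(rmorph_nat iota) fmorph_eq0 (negPf two0) /=.
by rewrite mulf_eq0 (negPf z0) orbF => /eqP ->; rewrite mul0r addr0.
Qed.

Lemma fixed_field_generators (s1 s2 s3 : F -> F) f :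
  fixed_field (automorphism_group (fun s => [\/ s = s1, s = s2 | s = s3])) f <->
  [/\ s1 f = f, s2 f = f & s3 f = f].
Proof.
split=> [h|[h1 h2 h3] s].
  by split; apply: h; apply: automorphism_group_mem; [apply: Or31|apply: Or32|apply: Or33].
elim=> [//|t [|->|->] //|t t' _ e _ e' /=|t t' _ e c1 c2]; first by move->.
  by rewrite e' e.
by rewrite -{1}e c1.
Qed.

Section Invariants.
Variables (a b c : K) (b12 b13 b21 b23 b31 b32 : bool) (x1 x2 x3 : F).
Variables (s1 s2 s3 : {rmorphism F -> F}).
Hypothesis two0 : (2%:R : K) != 0.
Hypotheses (a0 : a != 0) (b0 : b != 0) (c0 : c != 0).
Hypothesis x_gen : forall f, adj (in_list [:: x1; x2; x3]) f.
Hypothesis x_indep : seq_indep iota (@no_gen F) [:: x1; x2; x3].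
Hypotheses (k1 : forall k, s1 (iota k) = iota k) (k2 : forall k, s2 (iota k) = iota k)
  (k3 : forall k, s3 (iota k) = iota k).
Hypotheses (h11 : s1 x1 = iota a / x1) (h12 : s1 x2 = (-1) ^+ b12 * x2) (h13 : s1 x3 = (-1) ^+ b13 * x3).
Hypotheses (h21 : s2 x1 = (-1) ^+ b21 * x1) (h22 : s2 x2 = iota b / x2) (h23 : s2 x3 = (-1) ^+ b23 * x3).
Hypotheses (h31 : s3 x1 = (-1) ^+ b31 * x1) (h32 : s3 x2 = (-1) ^+ b32 * x2) (h33 : s3 x3 = iota c / x3).

Definition trace_of (d x : F) := x + d / x.
Definition zeta (d x : F) := (x - d / x) / (x + d / x).

Lemma transcendental_neq0 d x : d != 0 -> ~ alg_over iota (@no_gen F) x ->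
  [/\ x != 0, trace_of (iota d) x != 0, zeta (iota d) x != 0 & 1 - zeta (iota d) x != 0].
Proof.
move=> d0 hx; have nx f : adj (@no_gen F) f -> x != f.
  by move=> hf; apply/eqP => e; apply: hx; rewrite e; apply: alg_over_adjoin.
have n2 f : adj (@no_gen F) f -> x ^+ 2 != f.
  by move=> hf; apply/eqP => e; apply: hx; apply: alg_over_sqrt; rewrite e; apply: alg_over_adjoin.
have x0 : x != 0 by apply: nx; apply: adjoin0.
have d1 : iota d != 0 by rewrite fmorph_eq0.
have t0 : trace_of (iota d) x != 0.
  have -> : trace_of (iota d) x = (x ^+ 2 - - iota d) / x by rewrite /trace_of; field.
  rewrite mulf_neq0 ?invr_neq0 // subr_eq0; apply: n2; adjoin_mem.
have q0 : x - iota d / x != 0.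
  have -> : x - iota d / x = (x ^+ 2 - iota d) / x by field.
  rewrite mulf_neq0 ?invr_neq0 // subr_eq0; apply: n2; adjoin_mem.
split=> //; first by rewrite mulf_neq0 ?invr_neq0.
have -> : 1 - zeta (iota d) x = 2%:R * iota d / (x * trace_of (iota d) x).
  rewrite /zeta /trace_of; field; rewrite x0 /= -expr2 addr_eq0; apply: n2; adjoin_mem.
by rewrite !mulf_neq0 ?invr_neq0 ?mulf_neq0 // -(rmorph_nat iota) fmorph_eq0.
Qed.

Lemma sign_morph (s : {rmorphism F -> F}) d x (e : bool) : (forall k, s (iota k) = iota k) ->
  s x = (-1) ^+ e * x -> s (trace_of (iota d) x) = (-1) ^+ e * trace_of (iota d) x /\
  s (zeta (iota d) x) = zeta (iota d) x.
Proof.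
move=> hk hx; rewrite /zeta /trace_of; case: e hx => hx.
  rewrite expr1 !mulN1r in hx *.
  have e : s (iota d / x) = - (iota d / x) by rewrite rmorphM fmorphV hx hk invrN mulrN.
  by rewrite rmorphM fmorphV rmorphB !rmorphD e hx -!opprD invrN mulrNN.
rewrite expr0 mul1r in hx *.
have e : s (iota d / x) = iota d / x by rewrite rmorphM fmorphV hx hk.
by rewrite rmorphM fmorphV rmorphB !rmorphD e hx mul1r.
Qed.

Lemma invert_morph (s : {rmorphism F -> F}) d x : d != 0 -> x != 0 -> (forall k, s (iota k) = iota k) ->
  s x = iota d / x -> s (trace_of (iota d) x) = trace_of (iota d) x /\
  s (zeta (iota d) x) = - zeta (iota d) x.
Proof.
move=> d0 x0 hk hx; have d1 : iota d != 0 by rewrite fmorph_eq0.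
have e : s (iota d / x) = x by rewrite rmorphM fmorphV hx hk invf_div mulrCA mulfV ?mulr1.
rewrite /zeta /trace_of rmorphM fmorphV rmorphB !rmorphD e hx addrC; split=> //.
by rewrite -mulNr opprB.
Qed.

Let z1 := zeta (iota a) x1.
Let z2 := zeta (iota b) x2.
Let z3 := zeta (iota c) x3.
Let p1 := trace_of (iota a) x1.
Let p2 := trace_of (iota b) x2.
Let p3 := trace_of (iota c) x3.
Let r1 := 2%:R * iota a / (p1 * (z2 ^+ b21 * z3 ^+ b31)).
Let r2 := 2%:R * iota b / (p2 * (z1 ^+ b12 * z3 ^+ b32)).
Let r3 := 2%:R * iota c / (p3 * (z1 ^+ b13 * z2 ^+ b23)).
Let Y := [:: z1 ^+ 2; z2 ^+ 2; z3 ^+ 2; r1; r2; r3].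

Lemma x_transcendental : [/\ ~ alg_over iota (@no_gen F) x1, ~ alg_over iota (@no_gen F) x2
  & ~ alg_over iota (@no_gen F) x3].
Proof.
have [i1 [i2 i3]] : seq_indep iota (@no_gen F) [:: x1; x2; x3] /\
  seq_indep iota (@no_gen F) [:: x2; x1; x3] /\ seq_indep iota (@no_gen F) [:: x3; x1; x2].
  split=> //; split; apply: (indep_adjoin x_indep) => //=; do !split; adjoin_mem.
by case: i1 => ? _; case: i2 => ? _; case: i3.
Qed.

(** The first formula recovers x from the trace and zeta; the second shows that x is algebraic over
    K(zeta). *)
Lemma zeta_inverse d x : d != 0 -> ~ alg_over iota (@no_gen F) x ->
  x = trace_of (iota d) x * (1 + zeta (iota d) x) / 2%:R /\
  x ^+ 2 = iota d * (1 + zeta (iota d) x) / (1 - zeta (iota d) x).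
Proof.
move=> d0 hx; have [x0 t0 _ n0] := transcendental_neq0 d0 hx.
have two1 : (2%:R : F) != 0 by rewrite -(rmorph_nat iota) fmorph_eq0.
have e1 : trace_of (iota d) x * (1 + zeta (iota d) x) = 2%:R * x.
  rewrite /zeta -/(trace_of _ _) mulrDr mulr1 mulrCA mulfV // mulr1 /trace_of; ring.
have e2 : trace_of (iota d) x * (1 - zeta (iota d) x) = 2%:R * iota d / x.
  rewrite /zeta -/(trace_of _ _) mulrBr mulr1 mulrCA mulfV // mulr1 /trace_of; ring.
split; first by rewrite e1 mulrAC mulfV ?mul1r.
apply: (mulIf n0); rewrite divfK //; apply: (mulfI t0).
by rewrite mulrCA e2 [RHS]mulrCA e1; field.
Qed.

(** This is (x + d / x)^2 - (x - d / x)^2 = 4 d divided by the square of the trace; it is the source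
    of the relations between Z_i and r_i. *)
Lemma pythagoras d x : d != 0 -> ~ alg_over iota (@no_gen F) x ->
  iota d * (1 - zeta (iota d) x ^+ 2) = (2%:R * iota d / trace_of (iota d) x) ^+ 2.
Proof.
move=> d0 hx; have [x0 t0 _ _] := transcendental_neq0 d0 hx.
apply: (mulIf (expf_neq0 2 t0)); rewrite -exprMn divfK // /zeta -/(trace_of _ _).
transitivity (iota d * (trace_of (iota d) x ^+ 2 - (x - iota d / x) ^+ 2)); first by field; rewrite t0 x0.
by rewrite /trace_of; field.
Qed.

Lemma zeta_neq0s : [/\ z1 != 0, z2 != 0 & z3 != 0].
Proof.
have [t1 t2 t3] := x_transcendental.
by split; [case: (transcendental_neq0 a0 t1)|case: (transcendental_neq0 b0 t2)|case: (transcendental_neq0 c0 t3)].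
Qed.

Lemma invariants_system :
  twist_system iota a b c b12 b13 b21 b23 b31 b32 (z1 ^+ 2) (z2 ^+ 2) (z3 ^+ 2) r1 r2 r3.
Proof.
have [t1 t2 t3] := x_transcendental; have [y1 y2 y3] := zeta_neq0s.
have rel (d p z m : F) : m != 0 -> d * (1 - z ^+ 2) = (2%:R * d / p) ^+ 2 ->
   d * (1 - z ^+ 2) = m ^+ 2 * (2%:R * d / (p * m)) ^+ 2.
  by move=> m0 ->; rewrite -exprMn; congr (_ ^+ 2); rewrite invfM [RHS]mulrC -!mulrA mulVf // mulr1.
split=> //.
- apply: (indep_change x_indep) => // f; set M := in_list _.
  have mz z : adj M (z ^+ 2) -> adj (alg_over iota M) z.
    by move=> h; apply: adjoin_algebraic_sqrt; apply: adjoin_gen; apply: alg_over_adjoin.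
  have key d x : d != 0 -> ~ alg_over iota (@no_gen F) x -> adj M (zeta (iota d) x ^+ 2) ->
     alg_over iota M x.
    move=> d0 tx /mz h; apply: alg_over_closed; apply: adjoin_algebraic_sqrt.
    by rewrite (zeta_inverse d0 tx).2; adjoin_mem.
  rewrite !inE => /or3P[] /eqP->.
  + by apply: key a0 t1 _; adjoin_mem.
  + by apply: key b0 t2 _; adjoin_mem.
  + by apply: key c0 t3 _; adjoin_mem.
- rewrite /r1 -!exprM ![(2 * _)%N]mulnC !exprM -exprMn.
  by apply: rel; [rewrite mulf_neq0 ?expf_neq0|apply: pythagoras].
- rewrite /r2 -!exprM ![(2 * _)%N]mulnC !exprM -exprMn.
  by apply: rel; [rewrite mulf_neq0 ?expf_neq0|apply: pythagoras].
- rewrite /r3 -!exprM ![(2 * _)%N]mulnC !exprM -exprMn.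
  by apply: rel; [rewrite mulf_neq0 ?expf_neq0|apply: pythagoras].
Qed.

Lemma fixed_quotient (s : {rmorphism F -> F}) d p y z (g f f' e e' : bool) :
  (forall k, s (iota k) = iota k) -> s p = (-1) ^+ g * p ->
  s y = (-1) ^+ f * y -> s z = (-1) ^+ f' * z -> g = (f && e) (+) (f' && e') ->
  s (2%:R * iota d / (p * (y ^+ e * z ^+ e'))) = 2%:R * iota d / (p * (y ^+ e * z ^+ e')).
Proof.
move=> hk hp hy hz hg.
have hm : s (y ^+ e * z ^+ e') = (-1) ^+ g * (y ^+ e * z ^+ e').
  rewrite hg rmorphM !rmorphXn hy hz !exprMn signr_addb -!exprM -!mulnb; ring.
rewrite rmorphM fmorphV (rmorphM s p) (rmorphM s 2%:R) rmorph_nat hk hp hm mulrACA.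
by rewrite -expr2 sqrr_sign mul1r.
Qed.

Lemma invariants_fixed f : f \in Y -> [/\ s1 f = f, s2 f = f & s3 f = f].
Proof.
have [t1 t2 t3] := x_transcendental.
have [x10 _ _ _] := transcendental_neq0 a0 t1.
have [x20 _ _ _] := transcendental_neq0 b0 t2.
have [x30 _ _ _] := transcendental_neq0 c0 t3.
have [p11 z11] := invert_morph a0 x10 k1 h11.
have [p12 z12] := sign_morph b k1 h12.
have [p13 z13] := sign_morph c k1 h13.
have [p21 z21] := sign_morph a k2 h21.
have [p22 z22] := invert_morph b0 x20 k2 h22.
have [p23 z23] := sign_morph c k2 h23.
have [p31 z31] := sign_morph a k3 h31.
have [p32 z32] := sign_morph b k3 h32.
have [p33 z33] := invert_morph c0 x30 k3 h33.
have pos (s : {rmorphism F -> F}) z : s z = z -> s z = (-1) ^+ false * z by rewrite mul1r.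
have neg (s : {rmorphism F -> F}) z : s z = - z -> s z = (-1) ^+ true * z by rewrite mulN1r.
have sq (s : {rmorphism F -> F}) z (e : bool) : s z = (-1) ^+ e * z -> s (z ^+ 2) = z ^+ 2.
  by move=> h; rewrite rmorphXn h exprMn sqrr_sign mul1r.
rewrite !inE => /or4P[/eqP->|/eqP->|/eqP->|/or3P[]/eqP->]; split.
- exact: sq (neg _ _ z11).
- exact: sq (pos _ _ z21).
- exact: sq (pos _ _ z31).
- exact: sq (pos _ _ z12).
- exact: sq (neg _ _ z22).
- exact: sq (pos _ _ z32).
- exact: sq (pos _ _ z13).
- exact: sq (pos _ _ z23).
- exact: sq (neg _ _ z33).
- exact: (fixed_quotient _ k1 (pos _ _ p11) (pos _ _ z12) (pos _ _ z13)).
- exact: (fixed_quotient _ k2 p21 (neg _ _ z22) (pos _ _ z23) (esym (addbF _))).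
- exact: (fixed_quotient _ k3 p31 (pos _ _ z32) (neg _ _ z33)).
- exact: (fixed_quotient _ k1 p12 (neg _ _ z11) (pos _ _ z13) (esym (addbF _))).
- exact: (fixed_quotient _ k2 (pos _ _ p22) (pos _ _ z21) (pos _ _ z23)).
- exact: (fixed_quotient _ k3 p32 (pos _ _ z31) (neg _ _ z33)).
- exact: (fixed_quotient _ k1 p13 (neg _ _ z11) (pos _ _ z12) (esym (addbF _))).
- exact: (fixed_quotient _ k2 p23 (pos _ _ z21) (neg _ _ z22)).
- exact: (fixed_quotient _ k3 (pos _ _ p33) (pos _ _ z31) (pos _ _ z32)).
Qed.

Lemma fixed_field_invariants f :
  fixed_field (automorphism_group (fun s => [\/ s = s1, s = s2 | s = s3])) f <-> adj (in_list Y) f.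
Proof.
rewrite fixed_field_generators; split; last first.
  by move=> h; split; apply: fixed_adjoin h => // g /invariants_fixed[].
have [t1 t2 t3] := x_transcendental; have [y1 y2 y3] := zeta_neq0s.
have [x10 u1 _ _] := transcendental_neq0 a0 t1.
have [x20 u2 _ _] := transcendental_neq0 b0 t2.
have [x30 u3 _ _] := transcendental_neq0 c0 t3.
have [_ z11] := invert_morph a0 x10 k1 h11.
have [_ z21] := sign_morph a k2 h21.
have [_ z22] := invert_morph b0 x20 k2 h22.
have [_ z31] := sign_morph a k3 h31.
have [_ z32] := sign_morph b k3 h32.
have [_ z33] := invert_morph c0 x30 k3 h33.
have [[a1 b1 c1] _ _ [r10 r20 r30]] := twist_system_neq0 invariants_system.
move=> [e1 e2 e3].
pose A1 := fun g => in_list Y g \/ g = z1.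
pose A2 := fun g => A1 g \/ g = z2.
pose A3 := fun g => A2 g \/ g = z3.
have inY g : g \in Y -> adj (in_list Y) g by move=> h; apply: adjoin_gen.
have two1 : (2%:R : F) != 0 by rewrite -(rmorph_nat iota) fmorph_eq0.
(* Together with the zeta_j, each r_i gives back the trace p_i and then x_i, so the whole field is
   generated. *)
have hA3 : adj A3 f.
  apply: adjoin_sub (x_gen f) => g.
  have mz1 : adj A3 z1 by apply: adjoin_gen; left; left; right.
  have mz2 : adj A3 z2 by apply: adjoin_gen; left; right.
  have mz3 : adj A3 z3 by apply: adjoin_gen; right.
  have mY h : h \in Y -> adj A3 h by move=> hY; apply: adjoin_gen; do 3!left.
  have m1 : adj A3 r1 by apply: mY; rewrite !inE eqxx ?orbT.
  have m2 : adj A3 r2 by apply: mY; rewrite !inE eqxx ?orbT.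
  have m3 : adj A3 r3 by apply: mY; rewrite !inE eqxx ?orbT.
  have tr (d p m : F) : d != 0 -> p != 0 -> m != 0 -> p = 2%:R * d / ((2%:R * d / (p * m)) * m).
    by move=> d0 p0 m0; field; nonzero.
  have q1 : adj A3 p1.
    rewrite /p1 (@tr (iota a) (trace_of (iota a) x1) (z2 ^+ b21 * z3 ^+ b31)) ?mulf_neq0 ?expf_neq0 //.
    by rewrite -/p1 -/r1; adjoin_mem.
  have q2 : adj A3 p2.
    rewrite /p2 (@tr (iota b) (trace_of (iota b) x2) (z1 ^+ b12 * z3 ^+ b32)) ?mulf_neq0 ?expf_neq0 //.
    by rewrite -/p2 -/r2; adjoin_mem.
  have q3 : adj A3 p3.
    rewrite /p3 (@tr (iota c) (trace_of (iota c) x3) (z1 ^+ b13 * z2 ^+ b23)) ?mulf_neq0 ?expf_neq0 //.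
    by rewrite -/p3 -/r3; adjoin_mem.
  rewrite /in_list !inE => /or3P[] /eqP->.
  - by rewrite (zeta_inverse a0 t1).1 -/p1 -/z1; adjoin_mem.
  - by rewrite (zeta_inverse b0 t2).1 -/p2 -/z2; adjoin_mem.
  - by rewrite (zeta_inverse c0 t3).1 -/p3 -/z3; adjoin_mem.
have hA2 : adj A2 f.
  apply: (@quadratic_fixed s3 A2 z3) => //.
  - by move=> g [[/invariants_fixed[]|->]|->].
  - by apply: adjoin_gen; do 2!left; rewrite /in_list !inE eqxx ?orbT.
have hA1 : adj A1 f.
  apply: (@quadratic_fixed s2 A1 z2) => //.
  - by move=> g [/invariants_fixed[]|->].
  - by apply: adjoin_gen; left; rewrite /in_list !inE eqxx ?orbT.
apply: (@quadratic_fixed s1 (in_list Y) z1) => //.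
- by move=> g /invariants_fixed[].
- by apply: adjoin_gen; rewrite /in_list !inE eqxx ?orbT.
Qed.

Lemma invariants_rational (L : F -> Prop) : (forall f, L f <-> adj (in_list Y) f) ->
  three_generated iota L -> purely_transcendental iota L.
Proof.
move=> hL [y1 [y2 [y3 hy]]]; have [t1 t2 t3] := x_transcendental.
apply: (@purely_transcendental_generators _ _ iota [:: x1; x2; x3] [:: y1; y2; y3]) => // f; set M := in_list _.
have mz d x : d != 0 -> ~ alg_over iota (@no_gen F) x -> zeta (iota d) x ^+ 2 \in Y -> alg_over iota M x.
  move=> d0 tx hY; apply: alg_over_closed; apply: adjoin_algebraic_sqrt.
  have h : adj (alg_over iota M) (zeta (iota d) x).
    apply: adjoin_algebraic_sqrt; apply: adjoin_gen; apply: alg_over_adjoin.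
    by apply/hy/hL; apply: adjoin_gen.
  by rewrite (zeta_inverse d0 tx).2; adjoin_mem.
rewrite !inE => /or3P[] /eqP->.
- by apply: mz a0 t1 _; rewrite !inE eqxx ?orbT.
- by apply: mz b0 t2 _; rewrite !inE eqxx ?orbT.
- by apply: mz c0 t3 _; rewrite !inE eqxx ?orbT.
Qed.

(** Hides the formulas for the invariants: only their relations, the generation of the fixed field
    and the sufficiency of three generators are used from here on. *)
Lemma invariants_exist : exists Z1 Z2 Z3 r1' r2' r3',
  [/\ twist_system iota a b c b12 b13 b21 b23 b31 b32 Z1 Z2 Z3 r1' r2' r3',
      forall f, fixed_field (automorphism_group (fun s => [\/ s = s1, s = s2 | s = s3])) f <->
        adj (in_list [:: Z1; Z2; Z3; r1'; r2'; r3']) f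
    & forall L : F -> Prop, (forall f, L f <-> adj (in_list [:: Z1; Z2; Z3; r1'; r2'; r3']) f) ->
        three_generated iota L -> purely_transcendental iota L].
Proof.
exists (z1 ^+ 2), (z2 ^+ 2), (z3 ^+ 2), r1, r2, r3; split.
- exact: invariants_system.
- exact: fixed_field_invariants.
- exact: invariants_rational.
Qed.
End Invariants.
End FixedFields.

(** * Square classes of a, b, c and the degree of K(sqrt a, sqrt b, sqrt c) *)

Section SquareProducts.
Variable K : fieldType.
Implicit Types a b c k : K.

Definition square_product a b c : Prop :=
  exists (i j l : bool) k, i || j || l /\ k ^+ 2 = a ^+ i * b ^+ j * c ^+ l.

Lemma square_product_swap12 a b c : square_product a b c -> square_product b a c.
Proof.
move=> [i [j [l [k [h hk]]]]]; exists j, i, l, k; split; first by rewrite [j || i]orbC.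
by rewrite hk [X in X * _]mulrC.
Qed.

Lemma square_product_swap23 a b c : square_product a b c -> square_product a c b.
Proof.
move=> [i [j [l [k [h hk]]]]]; exists i, l, j, k; split; first by rewrite orbAC.
by rewrite hk mulrAC.
Qed.

Lemma square_product_twist a b c : c != 0 -> square_product (a * c) (b * c) c <-> square_product a b c.
Proof.
move=> c0; split=> -[i [j [l [k [h hk]]]]].
  (* The exponent i + j + l of c is its parity plus twice the majority of i, j, l, and the even part
     is moved into the root. *)
  exists i, j, (i (+) j (+) l), (k / c ^+ [|| i && j, i && l | j && l]); split; first by case: i j l h {hk} => [] [] [].
  by rewrite expr_div_n hk; case: i j l {h hk} => [] [] [] /=; rewrite ?expr1 ?expr0 ?expr1n ?divr1; first [by field|by ring].
exists i, j, (i (+) j (+) l), (k * c ^+ [|| i && j, i && ~~ l | j && ~~ l]); split; first by case: i j l h {hk} => [] [] [].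
by rewrite exprMn hk; case: i j l {h hk} => [] [] [] /=; rewrite ?expr1 ?expr0; ring.
Qed.

Lemma square_product_odd a b c (i j l : nat) k : a != 0 -> b != 0 -> c != 0 ->
  odd i || odd j || odd l -> k ^+ 2 = a ^+ i * b ^+ j * c ^+ l -> square_product a b c.
Proof.
move=> a0 b0 c0 h hk; exists (odd i), (odd j), (odd l), (k / (a ^+ i./2 * b ^+ j./2 * c ^+ l./2)); split=> //.
have ex (x : K) n : x ^+ n = x ^+ odd n * (x ^+ n./2) ^+ 2.
  by rewrite -exprM muln2 -exprD odd_double_half.
rewrite expr_div_n hk (ex a i) (ex b j) (ex c l).
have := expf_neq0 i./2 a0; have := expf_neq0 j./2 b0; have := expf_neq0 l./2 c0.
move: (a ^+ odd i) (b ^+ odd j) (c ^+ odd l) (a ^+ _) (b ^+ _) (c ^+ _) => x y z x' y' z' h1 h2 h3.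
by field; nonzero.
Qed.

Section Degree.
Variable L : fieldExtType K.
Hypothesis two0 : (2%:R : K) != 0.

Lemma mem_sqrt_adjoin (E : {subfield L}) (y x : L) : y ^+ 2 \in E -> x \in <<E; y>>%VS ->
  exists e0 e1, [/\ e0 \in E, e1 \in E & x = e0 + e1 * y].
Proof.
move=> hy /Fadjoin_polyP[p hp ->]; elim/poly_ind: p hp => [|p d IH] hp.
  by exists 0, 0; rewrite horner0 mul0r addr0 rpred0.
have hc i : (p * 'X + d%:P)`_i \in E by apply/polyOverP.
have hd : d \in E by have := hc 0%N; rewrite coefD coefMX coefC add0r.
have [|e0 [e1 [h0 h1 e]]] := IH.
  by apply/polyOverP => i; have := hc i.+1; rewrite coefD coefMX coefC addr0.
exists (e1 * y ^+ 2 + d), e0; split=> //; first by apply: rpredD => //; apply: rpredM.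
by rewrite hornerMXaddC e mulrDl -mulrA -expr2 -addrA addrC.
Qed.

(** Squaring x = e0 + e1 y shows that 2 e0 e1 y lies in E. *)
Lemma sqrt_in_sqrt_adjoin (E : {subfield L}) (y x : L) : y ^+ 2 \in E -> x ^+ 2 \in E ->
  x \in <<E; y>>%VS -> [\/ y \in E, x \in E | x * y \in E].
Proof.
move=> hy hx /(mem_sqrt_adjoin hy)[e0 [e1 [h0 h1 e]]].
have two1 : (2%:R : L) != 0.
  by rewrite -(rmorph_nat (in_alg L : {rmorphism K -> L})) fmorph_eq0.
have [z|nz] := eqVneq e1 0; first by constructor 2; rewrite e z mul0r addr0.
have [z|nz'] := eqVneq e0 0.
  by constructor 3; rewrite e z add0r -mulrA -expr2 rpredM.
constructor 1; have -> : y = (x ^+ 2 - e0 ^+ 2 - e1 ^+ 2 * y ^+ 2) / (2%:R * e0 * e1).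
  by rewrite e; field; nonzero.
apply: rpred_div; last by rewrite !rpredM ?rpred_nat.
by apply: rpredB; [apply: rpredB => //; apply: rpredX|apply: rpredM => //; apply: rpredX].
Qed.

Lemma sqrt_in_base (x : L) d : x ^+ 2 = d%:A -> x \in 1%VS -> exists k, k ^+ 2 = d.
Proof.
move=> hx /vlineP[k xE]; exists k.
pose ia : {rmorphism K -> L} := in_alg L.
by apply: (fmorph_inj ia); rewrite rmorphXn /= -xE hx.
Qed.

Lemma adjoin_degree_sqrt_le (E : {subfield L}) (y : L) : y ^+ 2 \in E ->
  adjoin_degree E y = if y \in E then 1%N else 2%N.
Proof.
move=> hy; case: ifPn => h; last exact: adjoin_degree_sqrt.
by apply/eqP; rewrite adjoin_deg_eq1.
Qed.

Lemma scalar_in (E : {subfield L}) d : d%:A \in E.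
Proof. by rewrite rpredZ ?rpred1. Qed.

(** Each root contributes a factor 1 or 2 to the degree, so the degree is at most 4 exactly when one
    of them lies in the field generated by the previous ones. *)
Lemma dim_three_sqrt a b c (ra rb rc : L) : a != 0 -> b != 0 -> c != 0 ->
  ra ^+ 2 = a%:A -> rb ^+ 2 = b%:A -> rc ^+ 2 = c%:A ->
  (\dim <<1 & [:: ra; rb; rc]>>%VS <= 4)%N <-> square_product a b c.
Proof.
move=> a0 b0 c0 ha hb hc; rewrite !adjoin_cons adjoin_nil.
rewrite agenv_id.
have sA (E : {subfield L}) : ra ^+ 2 \in E by rewrite ha scalar_in.
have sB (E : {subfield L}) : rb ^+ 2 \in E by rewrite hb scalar_in.
have sC (E : {subfield L}) : rc ^+ 2 \in E by rewrite hc scalar_in.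
rewrite !dim_Fadjoin dimv1 muln1 !adjoin_degree_sqrt_le //.
pose ia : {rmorphism K -> L} := in_alg L.
have sqM (x y : L) d e : x ^+ 2 = d%:A -> y ^+ 2 = e%:A -> (x * y) ^+ 2 = (d * e)%:A.
  by move=> hx hy; rewrite exprMn hx hy -(rmorphM ia).
have inA (x : L) d : x ^+ 2 = d%:A -> x \in <<1; ra>>%VS ->
    [\/ exists k, k ^+ 2 = a, exists k, k ^+ 2 = d | exists k, k ^+ 2 = d * a].
  move=> hx h; have hx1 : x ^+ 2 \in 1%AS by rewrite hx scalar_in.
  case: (sqrt_in_sqrt_adjoin (sA _) hx1 h) => h1.
  - by constructor 1; apply: sqrt_in_base ha h1.
  - by constructor 2; apply: sqrt_in_base hx h1.
  - by constructor 3; apply: sqrt_in_base (sqM _ _ _ _ hx ha) h1.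
split=> [|[i [j [l [k [hijl hk]]]]]].
  have wA : (exists k, k ^+ 2 = a) -> square_product a b c.
    by move=> [k hk]; exists true, false, false, k; rewrite hk expr1 !expr0 !mulr1.
  case: ifPn => hC; last case: ifPn => hB; last case: ifPn => hA //; move=> _.
  - have := sqrt_in_sqrt_adjoin (sB _) (sC _) hC; case=> h.
    + case: (inA _ _ hb h) => // -[k hk].
        by exists false, true, false, k; rewrite hk !expr0 expr1 mulr1 mul1r.
      by exists true, true, false, k; rewrite hk !expr0 !expr1 mulr1 mulrC.
    + case: (inA _ _ hc h) => // -[k hk].
        by exists false, false, true, k; rewrite hk !expr0 expr1 !mul1r.
      by exists true, false, true, k; rewrite hk !expr0 !expr1 mulr1 mulrC.
    + case: (inA _ _ (sqM _ _ _ _ hc hb) h) => // -[k hk].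
        by exists false, true, true, k; rewrite hk !expr0 !expr1 !mul1r mulrC.
      by exists true, true, true, k; rewrite hk !expr1; split=> //; ring.
  - case: (inA _ _ hb hB) => // -[k hk].
      by exists false, true, false, k; rewrite hk !expr0 expr1 mulr1 mul1r.
    by exists true, true, false, k; rewrite hk !expr0 !expr1 mulr1 mulrC.
  - by apply: wA; apply: sqrt_in_base ha hA.
have nz (x : L) d : d != 0 -> x ^+ 2 = d%:A -> x != 0.
  by move=> d0 hx; rewrite -sqrf_eq0 hx (_ : d%:A = ia d) // fmorph_eq0.
(* The product of the chosen roots is k or - k, hence lies in K, and it can be solved for the last
   root that occurs. *)
have pm : exists k', ra ^+ i * rb ^+ j * rc ^+ l = ia k'.
  have : (ra ^+ i * rb ^+ j * rc ^+ l) ^+ 2 = ia k ^+ 2.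
    rewrite -rmorphXn hk !rmorphM !rmorphXn !exprMn -!exprM ![(_ * 2)%N]mulnC !exprM.
    by rewrite ha hb hc.
  by move/eqP; rewrite eqf_sqr => /orP[]/eqP ->; [exists k|exists (- k); rewrite rmorphN].
have [k' hk'] := pm.
have scal (E : {subfield L}) z : ia z \in E by apply: scalar_in.
have mA : ra \in <<1; ra>>%VS by apply: memv_adjoin.
have mA2 : ra \in <<<<1; ra>>; rb>>%VS by apply: (subvP (subv_adjoin _ _)).
have mB : rb \in <<<<1; ra>>; rb>>%VS by apply: memv_adjoin.
have pw (E : {subfield L}) (x : L) (n : bool) : x \in E -> x ^+ n \in E by move=> h; apply: rpredX.
case: l hijl hk' {hk pm} => [_|]; last case: j => [_|]; last case: i => // _.
- rewrite expr1 => e.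
  have -> : rc \in <<<<1; ra>>; rb>>%VS; last by do 2!case: ifP.
  have -> : rc = ia k' / (ra ^+ i * rb ^+ j).
    by rewrite -e mulrAC mulfV ?mul1r // mulf_neq0 ?expf_neq0 ?(nz ra a) ?(nz rb b).
  by rewrite rpred_div ?rpredM ?pw ?scal.
- rewrite expr1 expr0 mulr1 => e.
  have -> : rb \in <<1; ra>>%VS; last by do 2!case: ifP.
  have -> : rb = ia k' / ra ^+ i by rewrite -e mulrAC mulfV ?mul1r ?expf_neq0 ?(nz ra a).
  by rewrite rpred_div ?pw ?scal.
- rewrite expr1 !expr0 !mulr1 => e.
  have -> : ra \in 1%VS by rewrite e; apply: scal.
  by do 2!case: ifP.
Qed.
End Degree.
End SquareProducts.

(** * The rational function field in the three indeterminates *)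

Section Indeterminates.
Variable K : fieldType.

Lemma indets_algebraically_independent :
  algebraically_independent (const3 K) (fun f => exists i, f = indet K i).
Proof.
move=> n y uy hy p hp.
have [t ht] := fin_all_exists hy.
have t_inj : injective t.
  by move=> i j e; apply: (tuple_uniqP _ uy); rewrite !ht e.
pose th : {rmorphism {mpoly K[n]} -> {mpoly K[3]}} := mmap (@mpolyC 3 K) (fun j => 'X_(t j)).
pose ps : {rmorphism {mpoly K[3]} -> {mpoly K[n]}} := mmap (@mpolyC n K)
  (fun i => if [pick j | t j == i] is Some j then 'X_j else 0).
have e1 : (@FracField.tofrac {mpoly K[3]} \o th : {rmorphism {mpoly K[n]} -> ratfun3 K}) =1 mmap (const3 K) (tnth y).
  apply: mpoly_morph_ext => [k|i] /=; first by rewrite !mmapC.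
  by rewrite !mmapX !mmap1U ht.
have e2 : ps \o th =1 id.
  apply: (@mpoly_morph_ext _ _ _ (ps \o th) idfun) => [k|i] /=; first by rewrite !mmapC.
  rewrite !mmapX !mmap1U mmapX mmap1U; case: pickP => [j /eqP/t_inj->//|/(_ i)].
  by rewrite eqxx.
have /eqP : FracField.tofrac (th p) = 0 by rewrite -hp -e1.
by rewrite tofrac_eq0 => /eqP h; rewrite -(e2 p) /= h rmorph0.
Qed.

Lemma indets_indep : seq_indep (const3 K) (@no_gen _) [:: x1; x2; x3 : ratfun3 K].
Proof.
apply: (alg_indep_seq_indep indets_algebraically_independent).
  have inj i j : indet K i = indet K j -> i = j.
    move=> /eqP; rewrite tofrac_eq => /eqP /(congr1 (@mlead _ _)); rewrite !mleadXm.
    by move=> /(congr1 (fun m : 'X_{1..3} => m i)); rewrite !mnm1E eqxx; case: eqP.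
  by rewrite /= !inE !negb_or /=; do !(apply/andP; split) => //; apply/eqP => /inj.
by move=> f; rewrite !inE => /or3P[]/eqP->; eexists.
Qed.

Lemma indets_generate (f : ratfun3 K) : adjoin (const3 K) (in_list [:: x1; x2; x3]) f.
Proof.
have hx (i : 'I_3) : adjoin (const3 K) (in_list [:: x1; x2; x3]) (indet K i).
  apply: adjoin_gen; case: i => -[|[|[|//]]] h; rewrite (bool_irrelevance h isT) /in_list.
  - exact: mem_head.
  - by rewrite in_cons; apply/orP; right; exact: mem_head.
  - by do 2!(rewrite in_cons; apply/orP; right); exact: mem_head.
have hp (p : {mpoly K[3]}) : adjoin (const3 K) (in_list [:: x1; x2; x3]) (FracField.tofrac p : ratfun3 K).
  elim/mpolyind: p => [|k m p _ _ IH]; first by rewrite rmorph0; apply: adjoin0.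
  rewrite rmorphD; apply: adjoin_add => //; rewrite -mul_mpolyC rmorphM.
  apply: adjoin_mul; first exact: adjoin_base.
  rewrite mpolyXE_id rmorph_prod; elim/big_ind: _ => [|g h|i _]; [exact: adjoin1|exact: adjoin_mul|].
  by rewrite rmorphXn; apply: adjoin_exp; apply: hx.
by case: (frac_repr f) => _ ->; apply: adjoin_div.
Qed.

(** Leading coefficients are multiplicative, so comparing them in n^2 = k d^2 gives a square root of
    k in K. *)
Lemma ratfun3_square (f : ratfun3 K) k : f ^+ 2 = const3 K k -> exists k', k' ^+ 2 = k.
Proof.
case: (fracP f) => n [d [d0 ->]] e.
have td : FracField.tofrac d != 0 :> ratfun3 K by rewrite tofrac_eq0.
have e2 : n * n = k%:MP * (d * d).
  apply/eqP; rewrite -tofrac_eq !tofracM -(inj_eq (mulIf (invr_neq0 (mulf_neq0 td td)))).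
  by rewrite mulfK ?mulf_neq0 // -[X in _ == X]e expr2 mulf_div.
have lcM (p q : {mpoly K[3]}) : mleadc (p * q) = mleadc p * mleadc q.
  have [->|p0] := eqVneq p 0; first by rewrite mul0r mleadc0 mul0r.
  have [->|q0] := eqVneq q 0; first by rewrite mulr0 mleadc0 mulr0.
  by apply: mleadcM_proper; rewrite mulf_neq0 ?mleadc_eq0.
have d1 : mleadc d != 0 by rewrite mleadc_eq0.
exists (mleadc n / mleadc d); rewrite expr_div_n expr2 -lcM e2 !lcM mleadcC.
by rewrite -expr2 mulfK ?expf_neq0.
Qed.
End Indeterminates.

(** * The criterion for exceptional signs and the theorem *)

Lemma pencil_rational_iff (K F : fieldType) (iota : {rmorphism K -> F}) (L : F -> Prop) a b c S u v w :
  (2%:R : K) != 0 -> a != 0 -> b != 0 -> c != 0 ->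
  (forall f k, f ^+ 2 = iota k -> exists k', k' ^+ 2 = k) ->
  (three_generated iota L -> purely_transcendental iota L) ->
  pencil_presentation iota L a b c S u v w ->
  purely_transcendental iota L <-> square_product a b c.
Proof.
move=> two0 a0 b0 c0 sq tg h; split; last first.
  by move=> [i [j [l [k [hi hk]]]]]; apply: tg; apply: pencil_rational hi hk h.
move=> pt; apply: NNPP => ns; case: h => hi hw hL.
apply: (@pencil_nonrational _ _ iota a b c S u v w L) pt => //.
- move=> i j l o f; apply/eqP => /sq[k hk]; apply: ns.
  exact: square_product_odd o hk.
- by apply: (indep_adjoin hi) => //=; do !split; adjoin_mem.
Qed.

Lemma exceptionalP (K : fieldType) (b12 b13 b21 b23 b31 b32 : bool) : (2%:R : K) != 0 ->
  exceptional ((-1) ^+ b12 : K) ((-1) ^+ b13) ((-1) ^+ b21) ((-1) ^+ b23) ((-1) ^+ b31) ((-1) ^+ b32) <->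
  exceptional_graph b12 b13 b21 b23 b31 b32.
Proof.
move=> two0; have n1 : (1 : K) <> -1.
  by move=> e; case/eqP: two0; rewrite mulr2n {2}e subrr.
have pos (e : bool) : (-1) ^+ e = 1 :> K -> e = false by case: e => //; rewrite expr1 => /esym/n1.
have neg (e : bool) : (-1) ^+ e = -1 :> K -> e = true by case: e => //; rewrite expr0 => /n1.
split.
  by case=> -[] => [/pos->/pos->/neg->/neg->[/neg->/neg->]|/pos->/pos->/neg->/neg->[/neg->/neg->]|
     /pos->/pos->/neg->/neg->[/neg->/neg->]|/neg->/neg->/neg->/neg->[/neg->/neg->]].
rewrite /exceptional_graph => /or4P[] /and5P[].
- by move=> -> -> -> -> /andP[-> ->]; constructor 4.
- by move=> /negPf-> /negPf-> -> -> /andP[-> ->]; constructor 1.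
- by move=> /negPf-> /negPf-> -> -> /andP[-> ->]; constructor 2.
- by move=> /negPf-> /negPf-> -> -> /andP[-> ->]; constructor 3.
Qed.

(** The three sign patterns of case (i) differ by a relabelling, and passing from a c, b c, c back
    to a, b, c does not change whether some product is a square. *)
Lemma exceptional_rational_iff (K F : fieldType) (iota : {rmorphism K -> F}) a b c
    b12 b13 b21 b23 b31 b32 Z1 Z2 Z3 r1 r2 r3 :
  let L := adjoin iota (in_list [:: Z1; Z2; Z3; r1; r2; r3]) in
  (2%:R : K) != 0 -> (forall f k, f ^+ 2 = iota k -> exists k', k' ^+ 2 = k) ->
  (three_generated iota L -> purely_transcendental iota L) ->
  twist_system iota a b c b12 b13 b21 b23 b31 b32 Z1 Z2 Z3 r1 r2 r3 ->
  exceptional_graph b12 b13 b21 b23 b31 b32 ->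
  purely_transcendental iota L <-> square_product a b c.
Proof.
move=> L two0 sq tg hs.
have perm L' a' b' c' S u v w : (forall f, L' f <-> L f) ->
    pencil_presentation iota L' a' b' c' S u v w -> pencil_presentation iota L a' b' c' S u v w.
  by move=> hLL [hi hw hL]; split=> // f; rewrite -hLL.
have [[a0 b0 c0] _ _ _ _] := hs.
rewrite /exceptional_graph => /or4P[] /and5P[].
- move=> e1 e2 e3 e4 /andP[e5 e6]; rewrite e1 e2 e3 e4 e5 e6 in hs.
  have [S [u [v [w h]]]] := complete_graph_pencil hs.
  exact: pencil_rational_iff h.
- move=> /negPf e1 /negPf e2 e3 e4 /andP[e5 e6]; rewrite e1 e2 e3 e4 e5 e6 in hs.
  have [S [u [v [w h]]]] := path_graph_pencil hs.
  rewrite -(square_product_twist a b c0).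
  by apply: pencil_rational_iff h => //; rewrite mulf_neq0.
- move=> /negPf e1 /negPf e2 e3 e4 /andP[e5 e6]; rewrite e1 e2 e3 e4 e5 e6 in hs.
  have [S [u [v [w h]]]] := path_graph_pencil (twist_system_swap23 hs).
  have hLL f : adjoin iota (in_list [:: Z1; Z3; Z2; r1; r3; r2]) f <-> L f.
    by apply: adjoin_eq; rewrite /=; do !split; adjoin_mem.
  have -> : square_product a b c <-> square_product a c b by split; apply: square_product_swap23.
  rewrite -(square_product_twist a c b0).
  by apply: pencil_rational_iff (perm _ _ _ _ _ _ _ _ hLL h) => //; rewrite mulf_neq0.
- move=> /negPf e1 /negPf e2 e3 e4 /andP[e5 e6]; rewrite e1 e2 e3 e4 e5 e6 in hs.
  have [S [u [v [w h]]]] := path_graph_pencil (twist_system_swap23 (twist_system_swap12 hs)).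
  have hLL f : adjoin iota (in_list [:: Z2; Z3; Z1; r2; r3; r1]) f <-> L f.
    by apply: adjoin_eq; rewrite /=; do !split; adjoin_mem.
  have -> : square_product a b c <-> square_product b c a.
    split=> hsq; first by apply/square_product_swap23/square_product_swap12.
    by apply/square_product_swap12/square_product_swap23.
  rewrite -(square_product_twist b c a0).
  by apply: pencil_rational_iff (perm _ _ _ _ _ _ _ _ hLL h) => //; rewrite mulf_neq0.
Qed.

Lemma purely_transcendental_eq (K F : fieldType) (iota : {rmorphism K -> F}) (L L' : F -> Prop) :
  (forall f, L f <-> L' f) -> purely_transcendental iota L <-> purely_transcendental iota L'.
Proof. by move=> h; split=> -[A hA hL]; exists A => // f; rewrite -hL h. Qed.

Theorem theorem8 (K : fieldType) (charK : 2%N \notin [pchar K])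
    (a b c : K) (a_neq0 : a != 0) (b_neq0 : b != 0) (c_neq0 : c != 0)
    (e12 e13 e21 e23 e31 e32 : K)
    (e12_sign : e12 = 1 \/ e12 = -1) (e13_sign : e13 = 1 \/ e13 = -1)
    (e21_sign : e21 = 1 \/ e21 = -1) (e23_sign : e23 = 1 \/ e23 = -1)
    (e31_sign : e31 = 1 \/ e31 = -1) (e32_sign : e32 = 1 \/ e32 = -1)
    (sigma1 sigma2 sigma3 : {rmorphism ratfun3 K -> ratfun3 K})
    (sigma1_aut : is_automorphism_over (const3 K) sigma1)
    (sigma2_aut : is_automorphism_over (const3 K) sigma2)
    (sigma3_aut : is_automorphism_over (const3 K) sigma3)
    (sigma1_x : [/\ sigma1 x1 = const3 K a / x1,
                    sigma1 x2 = const3 K e12 * x2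
                  & sigma1 x3 = const3 K e13 * x3])
    (sigma2_x : [/\ sigma2 x1 = const3 K e21 * x1,
                    sigma2 x2 = const3 K b / x2
                  & sigma2 x3 = const3 K e23 * x3])
    (sigma3_x : [/\ sigma3 x1 = const3 K e31 * x1,
                    sigma3 x2 = const3 K e32 * x2
                  & sigma3 x3 = const3 K c / x3]) :
  let G := automorphism_group
             (fun s => [\/ s = sigma1, s = sigma2 | s = sigma3]) in
  let rational := purely_transcendental (const3 K) (fixed_field G) in
  (~ exceptional e12 e13 e21 e23 e31 e32 -> rational) /\
  (exceptional e12 e13 e21 e23 e31 e32 ->
   forall (L : fieldExtType K) (ra rb rc : L),
     ra ^+ 2 = a%:A -> rb ^+ 2 = b%:A -> rc ^+ 2 = c%:A ->
     (rational <-> (\dim <<1 & [:: ra; rb; rc]>>%VS <= 4)%N)).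
Proof.
move=> G rational.
have two0 : (2%:R : K) != 0 by apply: contraNneq charK => h; rewrite inE /= h.
have sign e : e = 1 \/ e = -1 -> exists s : bool, e = (-1) ^+ s :> K.
  by case=> ->; [exists false|exists true].
have [b12 E12] := sign _ e12_sign; have [b13 E13] := sign _ e13_sign.
have [b21 E21] := sign _ e21_sign; have [b23 E23] := sign _ e23_sign.
have [b31 E31] := sign _ e31_sign; have [b32 E32] := sign _ e32_sign.
have cE (s : bool) : const3 K ((-1) ^+ s) = (-1) ^+ s by rewrite rmorph_sign.
rewrite {}E12 {}E13 {}E21 {}E23 {}E31 {}E32 !cE {e12_sign e13_sign e21_sign e23_sign e31_sign e32_sign}
  in sigma1_x sigma2_x sigma3_x *.
have [h11 h12 h13] := sigma1_x; have [h21 h22 h23] := sigma2_x; have [h31 h32 h33] := sigma3_x.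
have [Z1 [Z2 [Z3 [r1 [r2 [r3 [hs hfix tg]]]]]]] :=
  invariants_exist two0 a_neq0 b_neq0 c_neq0 (@indets_generate K) (@indets_indep K)
    sigma1_aut.2 sigma2_aut.2 sigma3_aut.2 h11 h12 h13 h21 h22 h23 h31 h32 h33.
have tg' := tg _ (fun f => iff_refl _).
have fixE := purely_transcendental_eq (const3 K) hfix.
have excE := exceptionalP b12 b13 b21 b23 b31 b32 two0.
split=> [ne|/excE ex L ra rb rc ha hb hc].
  apply/fixE/tg'; apply: nonexceptional_three_generated hs _.
  by apply/negP => /excE.
apply: iff_trans fixE _; apply: iff_trans (iff_sym (dim_three_sqrt two0 a_neq0 b_neq0 c_neq0 ha hb hc)).
exact: (exceptional_rational_iff two0 (@ratfun3_square K) tg' hs ex).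
Qed.
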